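(* Let $V$ be a Probability Vector Field on $\mathcal{P}(\mathbb{R}^n)$ which is support sublinear with constant $C$ and such that $V:\mathcal{P}_c(\mathbb{R}^n)\to\mathcal{P}_c(T\mathbb{R}^n)$ is continuous for the topologies given by the Wasserstein metrics $W^{\mathbb{R}^n}$ and $W^{T\mathbb{R}^n}$. Then for every $T>0$ and every $\mu_0\in\mathcal{P}_c(\mathbb{R}^n)$ there exists a solution $\mu:[0,T]\to\mathcal{P}_c(\mathbb{R}^n)$ to the Cauchy problem $\dot\mu=V[\mu]$, $\mu(0)=\mu_0$, obtained as a limit, uniform in $t\in[0,T]$ for the Wasserstein metric, of (a subsequence of) the Lattice Approximate Solutions $\mu^N$ with initial datum $\mu_0$. Moreover, if $\mathrm{Supp}(\mu_0)\subset B(0,R)$, then for all $t,s\in[0,T]$ $$W(\mu(t),\mu(s))\le C\,e^{CT}\,(R+1)\,|t-s|.$$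
   Context: $T\mathbb{R}^n=\mathbb{R}^n\times\mathbb{R}^n$ with points $(x,v)$, and $\pi_1(x,v)=x$. For a Polish space $(X,d)$, $\mathcal{P}(X)$ is the set of Borel probability measures, $\mathcal{P}_c(X)$ those with compact support, and $W^X(\mu,\nu)=\inf_\tau\int d(x,y)\,d\tau(x,y)$ over all couplings $\tau$ of $\mu,\nu$ (1-Wasserstein metric); $W=W^{\mathbb{R}^n}$. $B(0,R)$ is the ball of radius $R$ centered at the origin. A Probability Vector Field (PVF) is a map $V:\mathcal{P}(\mathbb{R}^n)\to\mathcal{P}(T\mathbb{R}^n)$ with $\pi_1\#V[\mu]=\mu$. It is support sublinear with constant $C>0$ if for every $\mu\in\mathcal{P}_c(\mathbb{R}^n)$: $\sup_{(x,v)\in \mathrm{Supp}(V[\mu])}|v|\le C(1+\sup_{x\in \mathrm{Supp}(\mu)}|x|)$. Solution: $\mu:[0,T]\to\mathcal{P}(\mathbb{R}^n)$ is a solution to $\dot\mu=V[\mu]$, $\mu(0)=\mu_0$, if $\mu(0)=\mu_0$ and for every $f\in C_c^\infty(\mathbb{R}^n)$: the integral $\int_{T\mathbb{R}^n}\nabla f(x)\cdot v\,dV[\mu(s)](x,v)$ is defined for a.e. $s$ and is an $L^1$ function of $s\in[0,T]$, the map $t\mapsto\int f\,d\mu(t)$ is absolutely continuous, and for a.e. $t\in[0,T]$, $\frac{d}{dt}\int f\,d\mu(t)=\int_{T\mathbb{R}^n}\nabla f(x)\cdot v\,dV[\mu(t)](x,v)$. Lattice Approximate Solutions (LAS): for $N\in\mathbb{N}$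 let $\Delta_N=1/N$, let $x_i$ be the points of $(\mathbb{Z}^n/N^2)\cap[-N,N]^n$ and $v_j$ the points of $(\mathbb{Z}^n/N)\cap[-N,N]^n$. Set $\mu^N_0=\sum_i\mu_0(x_i+[0,N^{-2})^n)\,\delta_{x_i}$. Recursively, given $\mu^N_\ell$ supported on the points $x_i$, put $m_{ij}=V[\mu^N_\ell](\{(x_i,v): v\in v_j+[0,N^{-1})^n\})$ and, for $t\in[0,\Delta_N]$, $\mu^N(\ell\Delta_N+t)=\sum_{i,j}m_{ij}\,\delta_{x_i+t v_j}$, with $\mu^N_{\ell+1}=\mu^N((\ell+1)\Delta_N)$. This is considered for $N$ large enough (depending on $T$, $\mathrm{Supp}(\mu_0)$, $V$) that all mass stays within the grids on $[0,T]$. *)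

(* Defs.v *)
From HB Require Import structures.
From mathcomp Require Import all_boot all_order all_algebra.
From mathcomp Require Import all_classical all_reals all_analysis.
From mathcomp Require Import giry.

Set Implicit Arguments.
Unset Strict Implicit.
Unset Printing Implicit Defensive.

Import Order.TTheory GRing.Theory Num.Theory.
Import numFieldNormedType.Exports.

Local Open Scope classical_set_scope.
Local Open Scope ring_scope.

(* R^n is 'rV[R]_n, with the Borel sigma-algebra of its (product) topology.
   T R^n is the pair type 'rV[R]_n * 'rV[R]_n with the product topology and
   product sigma-algebra; the latter is the Borel one, R^n being second
   countable. *)
HB.instance Definition _ (R : realType) (m n : nat) :=
  @isMeasurable.Build (sigma_display (@open 'M[R]_(m, n))) 'M[R]_(m, n)
    <<s @open 'M[R]_(m, n) >> (@sigma_algebra0 _ setT _) (@sigma_algebraC _ _)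
    (@sigma_algebra_bigcup _ setT _).

Section euclidean.
Context {R : realType} {n : nat}.
Implicit Types x v : 'rV[R]_n.

Definition dot x v : R := \sum_(i < n) x 0 i * v 0 i.

(* The library norm of 'rV[R]_n is the sup norm: same topology, but the
   estimates are about the Euclidean norm. *)
Definition enorm x : R := Num.sqrt (dot x x).

Definition edist x y : R := enorm (x - y).

(* Euclidean distance of T R^n = R^(2n) *)
Definition tdist (p q : 'rV[R]_n * 'rV[R]_n) : R :=
  Num.sqrt (edist p.1 q.1 ^+ 2 + edist p.2 q.2 ^+ 2).

End euclidean.

Section measures.
Context {R : realType} {d : measure_display} {X : measurableType d}.
Implicit Types mu nu : probability X R.

Definition coupling mu nu (tau : probability (X * X)%type R) : Prop :=
  forall A, measurable A ->
    pushforward tau fst A = mu A /\ pushforward tau snd A = nu A.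

Definition wasserstein (dist : X -> X -> R) mu nu : \bar R :=
  ereal_inf [set (\int[tau]_p (dist p.1 p.2)%:E)%E | tau in coupling mu nu].

End measures.

Definition msupport {R : realType} {X : topologicalType}
    (mu : set X -> \bar R) : set X :=
  [set x | forall U, open U -> U x -> (0 < mu U)%E].

Section test_functions.
Context {R : realType} {n : nat}.
Implicit Types (f : 'rV[R]_n -> R) (x : 'rV[R]_n).

Definition partial (i : 'I_n) f : 'rV[R]_n -> R :=
  fun x => 'D_(delta_mx 0 i) f x.

Definition grad f x : 'rV[R]_n := \row_i partial i f x.

Definition smooth f : Prop :=
  forall (s : seq 'I_n) x, differentiable (foldr partial f s) x.

Definition compactly_supported f : Prop :=
  compact (closure [set x | f x != 0]).

Definition test_function f : Prop := smooth f /\ compactly_supported f.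

End test_functions.

Definition absolutely_continuous {R : realType} (a b : R) (g : R -> R) : Prop :=
  forall e : R, 0 < e -> exists2 dl : R, 0 < dl &
    forall (m : nat) (l r : 'I_m -> R),
      (forall k, a <= l k /\ l k <= r k /\ r k <= b) ->
      trivIset [set: 'I_m] (fun k => `]l k, r k[%classic) ->
      \sum_(k < m) (r k - l k) < dl ->
      \sum_(k < m) `|g (r k) - g (l k)| < e.

Section pvf.
Context {R : realType} {n : nat}.

Local Notation E := 'rV[R]_n.
Local Notation P := (probability E R).
Local Notation PT := (probability (E * E)%type R).

Definition W (mu nu : P) : \bar R := wasserstein edist mu nu.

Definition WT (mu nu : PT) : \bar R := wasserstein tdist mu nu.

Definition Pc : set P := [set mu | compact (msupport mu)].

Definition PTc : set PT := [set mu | compact (msupport mu)].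

(* Two terms of type P denote the same Borel measure when they agree on
   measurable sets (their values elsewhere are unconstrained junk), whence the
   first clause: V is a map on Borel measures. *)
Definition is_pvf (V : P -> PT) : Prop :=
  (forall mu nu : P, measure_eq mu nu -> measure_eq (V mu) (V nu)) /\
  (forall mu A, measurable A -> pushforward (V mu) fst A = mu A).

Definition support_sublinear (C : R) (V : P -> PT) : Prop :=
  forall mu, Pc mu ->
    (ereal_sup [set (enorm p.2)%:E | p in msupport (V mu)] <=
     C%:E * (1 + ereal_sup [set (enorm x)%:E | x in msupport mu]))%E.

Definition continuous_on_Pc (V : P -> PT) : Prop :=
  (forall mu, Pc mu -> PTc (V mu)) /\
  (forall mu, Pc mu -> forall e : R, 0 < e -> exists2 dl : R, 0 < dl &
     forall nu, Pc nu -> (W mu nu < dl%:E)%E -> (WT (V mu) (V nu) < e%:E)%E).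

(* Only the values of mu on [0, T] matter: in the last clause the end points,
   where the derivative would see mu outside of [0, T], are negligible.
   An almost everywhere defined function is L^1 when it agrees almost
   everywhere with an integrable function g. *)
Definition is_solution (V : P -> PT) (T : R) (mu0 : P) (mu : R -> P) : Prop :=
  measure_eq (mu 0) mu0 /\
  forall f : E -> R, test_function f ->
    let leb := @lebesgue_measure R in
    let F := fun p : E * E => dot (grad f p.1) p.2 in
    [/\ {ae leb, forall s, `[0, T]%classic s ->
           (V (mu s)).-integrable setT (EFin \o F)},
        exists2 g : R -> R, leb.-integrable `[0, T]%classic (EFin \o g) &
          {ae leb, forall s, `[0, T]%classic s -> \int[V (mu s)]_p F p = g s},
        absolutely_continuous 0 T (fun t => \int[mu t]_x f x) &
        {ae leb, forall t, `[0, T]%classic t ->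
           is_derive t 1 (fun t => \int[mu t]_x f x : R)
             (\int[V (mu t)]_p F p)}].

(* (h Z)^n `&` [-b, b]^n *)
Definition grid (h b : R) : set E :=
  [set x | forall i, (exists z : int, x 0 i = z%:~R * h) /\ `|x 0 i| <= b].

(* a + [0, h)^n *)
Definition cell (a : E) (h : R) : set E :=
  [set x | forall i, a 0 i <= x 0 i /\ x 0 i < a 0 i + h].

Definition xgrid (N : nat) : set E := grid (N%:R ^- 2) N%:R.

Definition vgrid (N : nat) : set E := grid N%:R^-1 N%:R.

Definition las_init (N : nat) (mu0 : P) (A : set E) : \bar R :=
  (\sum_(x \in xgrid N) mu0 (cell x (N%:R ^- 2)) * \d_x A)%E.

Definition las_step (V : P -> PT) (N : nat) (mu : P) (t : R) (A : set E) :
    \bar R :=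
  (\sum_(x \in xgrid N) \sum_(v \in vgrid N)
     V mu ([set x] `*` cell v N%:R^-1) * \d_(x + t *: v)%R A)%E.

(* las : R -> P is the Lattice Approximate Solution of index N on [0, T].  The
   l-th measure of the recursion is las (l / N).  That las takes values in
   probabilities and charges only the grid at the times l / N expresses that
   all mass stays within the grids; las is then determined on [0, T], as a
   curve of Borel measures, by V, N and mu0. *)
Definition is_las (V : P -> PT) (T : R) (mu0 : P) (N : nat) (las : R -> P) :
    Prop :=
  [/\ forall A, measurable A -> las 0 A = las_init N mu0 A,
      forall l : nat, l%:R / N%:R <= T ->
        las (l%:R / N%:R) (xgrid N) = 1%E &
      forall (l : nat) (t : R), 0 <= t <= N%:R^-1 -> l%:R / N%:R + t <= T ->
        forall A, measurable A ->
          las (l%:R / N%:R + t) A = las_step V N (las (l%:R / N%:R)) t A].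

End pvf.

(* Main.v *)
(* Superposition on path space.  Each Lattice Approximate Solution is the time
   marginal of a random polygonal path with finitely many values: at a node,
   the next velocity is drawn from the conditional law of the quantized V given
   the position.  Support sublinearity and a discrete Gronwall estimate bound
   the speeds by C e^(CT) (R + 1) + O(1/N).  Ordering the paths of index N by
   the first N bits of their values at rational times turns them into random
   variables on the single probability space [0, 1[; Helly selection on these
   monotone codes then yields a subsequence along which almost every path
   converges, at all times.  The limit paths are C e^(CT) (R + 1)-Lipschitz, and
   every Wasserstein estimate follows from an explicit coupling (the joint law
   of two marginals): neither the triangle inequality for W nor the compactness
   of P(K) is needed.  For the equation, the increment of \int f over a time
   step is, up to O(1/N^2), the step length times the integral of grad f . v for
   V at the node; continuity of V along the limit curve makes the latter nearly
   constant on short time intervals, which gives the derivative at each interior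
   time. *)

Require Import Defs.
From HB Require Import structures.
From mathcomp Require Import all_boot all_order all_algebra.
From mathcomp Require Import all_classical all_reals all_analysis measurable_realfun.
From mathcomp Require Import ring lra zify.

Set Implicit Arguments.
Unset Strict Implicit.
Unset Printing Implicit Defensive.

Import Order.TTheory GRing.Theory Num.Theory.
Import numFieldNormedType.Exports.

Local Open Scope classical_set_scope.
Local Open Scope ring_scope.

Local Notation edist := Defs.edist.
(** * Borel structure of R^n and T R^n *)

(** Putting all approximations on one probability space turns convergence of measures into pointwise
    convergence of paths, so distances become integrals of [edist] to which dominated convergence
    applies. The obstacle is to make the random paths converge: sorting by codes makes each fixed
    binary prefix monotone in the sample point and bounded, which is all that Helly's argument uses.
    The sharp Lipschitz constant survives because the speeds [las_speed] exceed it by a multiple of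
    [1 / N]. A second obstacle is that [V] is only continuous point by point and that [v] enters the
    equation linearly. Since velocities are bounded, [dot (grad f x) v] may be replaced by a
    truncated integrand, bounded and Lipschitz on the whole of T R^n, whose integral a [WT] bound
    controls; and each time [t] gets its own window, in which [V] at the nodes is compared with
    [V (mu t)] only. *)

Section countable_base.
Context d {X : topologicalType} {Y : measurableType d}.
Context {I : countType} (B : I -> set X).
Hypothesis baseB : forall (U : set X) x, open U -> U x ->
  exists2 i, B i x & B i `<=` U.

Lemma open_bigcup_base (U : set X) :
  open U -> U = \bigcup_(i in [set i | B i `<=` U]) B i.
Proof.
move=> oU; apply/seteqP; split=> [x /(baseB oU)[i Bix BU]|x [i /= BU Bix]].
  by exists i.
exact: BU.
Qed.

Lemma base_bigcup_measurable (f : Y -> X) (D : set I) :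
  (forall i, measurable (f @^-1` B i)) ->
  measurable (f @^-1` (\bigcup_(i in D) B i)).
Proof.
move=> mB; rewrite preimage_bigcup bigcup_mkcond.
apply: countable_bigcupT_measurable => // i.
by case: ifP => // _; exact: measurable0.
Qed.

End countable_base.

Section rational_boxes.
Context {R : realType} {n : nat}.
Local Notation E := 'rV[R]_n.

Definition ratbox (ck : 'rV[rat]_n * nat) : set E :=
  [set x | forall i, `|ratr (ck.1 0 i) - x 0 i| < ck.2.+1%:R^-1].

Lemma ratboxE ck : ratbox ck = ball (map_mx ratr ck.1 : E) ck.2.+1%:R^-1.
Proof.
apply/seteqP; split=> [x xck|x [_ xck] i].
  split=> // i j; rewrite (ord1 i) /ball_ /= mxE; exact: xck.
by have := xck 0 i; rewrite /ball_/= mxE.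
Qed.

Lemma ratbox_open ck : open (ratbox ck).
Proof. by rewrite ratboxE; apply: ball_open; rewrite invr_gt0. Qed.

Lemma ratbox_center (x : E) (e : R) : 0 < e ->
  exists2 ck, ratbox ck x & ratbox ck `<=` ball x e.
Proof.
move=> e0.
have [k kP] : exists k : nat, k.+1%:R^-1 < e / 2.
  exists (Num.truncn (e / 2)^-1); rewrite -[ltRHS]invrK ltf_pV2 ?posrE//.
    exact: Num.Theory.truncnS_gt.
  by rewrite invr_gt0 divr_gt0.
have cP i : exists q : rat, `|ratr q - x 0 i| < k.+1%:R^-1.
  have /rat_in_itvoo[q] : x 0 i - k.+1%:R^-1 < x 0 i + k.+1%:R^-1.
    by rewrite ltrBlDr -addrA ltrDl addr_gt0 ?invr_gt0.
  by rewrite in_itv/= => /andP[h1 h2]; exists q; rewrite distrC ltr_distlC h1 h2.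
exists (\row_i projT1 (cid (cP i)), k).
  move=> i /=; rewrite mxE; case: cid => /= q; exact.
move=> y /= yb; split=> // i j; rewrite (ord1 i) /ball_ /=.
have := yb j => /=; rewrite mxE; case: cid => /= q hq hy.
suff : `|x 0 j - y 0 j| < e by [].
rewrite [ltLHS](_ : _ = `|(x 0 j - ratr q) + (ratr q - y 0 j)|); last by congr `|_|; ring.
apply: le_lt_trans (ler_normD _ _) _.
rewrite (splitr e); apply: ltrD.
  by rewrite distrC (lt_trans hq).
by rewrite (lt_trans hy).
Qed.

Lemma ratbox_base (U : set E) x : open U -> U x ->
  exists2 ck, ratbox ck x & ratbox ck `<=` U.
Proof.
rewrite openE => oU /oU /nbhs_ballP[e /= e0 eU].
by have [ck xck ckU] := ratbox_center x e0; exists ck => // y /ckU /eU.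
Qed.

Lemma openrV_measurable (U : set E) : open U -> measurable U.
Proof. exact: sub_sigma_algebra. Qed.

Lemma closedrV_measurable (U : set E) : closed U -> measurable U.
Proof.
move=> cU; rewrite -[U]setCK; apply: measurableC; apply: openrV_measurable.
exact: closed_openC.
Qed.

Definition ratbox2 (c : ('rV[rat]_n * nat) * ('rV[rat]_n * nat)) :
  set (E * E) := ratbox c.1 `*` ratbox c.2.

Lemma ratbox2_base (U : set (E * E)) x : open U -> U x ->
  exists2 c, ratbox2 c x & ratbox2 c `<=` U.
Proof.
rewrite openE => oU /oU [[P Q] /= [nP nQ] PQU].
have /nbhs_ballP[e /= e0 eP] := nP; have /nbhs_ballP[f /= f0 fQ] := nQ.
have [ck xck ckU] := ratbox_center x.1 e0.
have [cl xcl clU] := ratbox_center x.2 f0.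
exists (ck, cl); first by split.
move=> [y z] [/= yck zcl]; apply: PQU; split => /=.
  exact/eP/ckU.
exact/fQ/clU.
Qed.

Lemma ratbox2_measurable c : measurable (ratbox2 c).
Proof.
by apply: measurableX; apply: openrV_measurable; exact: ratbox_open.
Qed.

Lemma open2_measurable (U : set (E * E)) : open U -> measurable U.
Proof.
move=> oU; rewrite (open_bigcup_base ratbox2_base oU) -[X in measurable X]preimage_id.
exact: (base_bigcup_measurable _ ratbox2_measurable).
Qed.

Lemma coord_measurable (i : 'I_n) : measurable_fun [set: E] (fun x => x 0 i).
Proof.
apply: (measurability _ (measurable_realfun.RGenOpens.measurableE R)).
move=> _ [_ [a [b ->]] <-]; rewrite setTI; apply: openrV_measurable.
apply: open_comp => [x _|]; first exact: coord_continuous.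
exact: interval_open.
Qed.

(** Open sets are countable unions of rational boxes, and the preimage of a box is a finite
    intersection of conditions on single coordinates. *)
Lemma measurable_fun_rV d (T : measurableType d) (f : T -> E) :
  (forall i, measurable_fun [set: T] (fun t => f t 0 i)) <->
  measurable_fun [set: T] f.
Proof.
split=> [mf|mf i]; last exact: (measurableT_comp (coord_measurable i) mf).
apply: (measurability (@open E)) => // _ [U oU <-]; rewrite setTI.
rewrite (open_bigcup_base ratbox_base oU); apply: base_bigcup_measurable => ck.
have -> : f @^-1` ratbox ck = \bigcap_(i in [set: 'I_n])
    ((fun t => f t 0 i) @^-1` ball (ratr (ck.1 0 i) : R) ck.2.+1%:R^-1).
  by apply/seteqP; split=> [t tf i _|t tf i]; [exact: tf|exact: tf].
apply: fin_bigcap_measurable => // i _.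
rewrite -[X in measurable X]setTI; apply: mf => //.
by apply: measurable_realfun.open_measurable; exact: ball_open.
Qed.

End rational_boxes.
(** * Laws, couplings and supports *)

Section laws.
Context d d' {T : measurableType d} {T' : measurableType d'} {R : realType}.

Definition law (P : probability T R) (f : T -> T')
    (mf : measurable_fun [set: T] f) : probability T' R :=
  distribution P (HB.pack_for {mfun T >-> T'} f (isMeasurableFun.Build _ _ _ _ f mf)).

Lemma lawE P f mf A : @law P f mf A = P (f @^-1` A).
Proof. by []. Qed.

Lemma prob_ae_bounded (P : probability T R) (h : T -> R) (c : R) : 0 <= c ->
  measurable_fun [set: T] h -> {ae P, forall x, `|h x| <= c} ->
  P.-integrable [set: T] (EFin \o h) /\ `|\int[P]_x h x| <= c.
Proof.
move=> c0 mh hc.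
have le_c : (\int[P]_x `|(h x)%:E| <= c%:E)%E.
  apply: le_trans.
    apply: (@integral_le_bound _ _ _ P setT (EFin \o h) c%:E) => //.
    - exact/measurable_EFinP.
    - by apply: filterS hc => x + _ /=; rewrite lee_fin.
  by rewrite [X in (_ * X)%E](_ : _ = 1%E) ?mule1//; exact: probability_setT.
have ih : P.-integrable [set: T] (EFin \o h).
  apply/integrableP; split; first exact/measurable_EFinP.
  by rewrite (le_lt_trans le_c)// ltry.
split=> //; rewrite -lee_fin EFin_normr_Rintegral//.
by apply: le_trans le_c; apply: le_abse_integral => //; exact/measurable_EFinP.
Qed.

Lemma prob_bounded (P : probability T R) (h : T -> R) (c : R) :
  measurable_fun [set: T] h -> (forall x, `|h x| <= c) ->
  P.-integrable [set: T] (EFin \o h) /\ `|\int[P]_x h x| <= c.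
Proof.
move=> mh hc; have [c0|c0] := leP 0 c; first by apply: prob_ae_bounded => //; exact: aeW.
have x : T by exact: point.
by have := le_trans (normr_ge0 _) (hc x); rewrite leNgt c0.
Qed.

Lemma law_Rintegral (P : probability T R) f mf (g : T' -> R) (c : R) :
  measurable_fun [set: T'] g -> (forall x, `|g x| <= c) ->
  \int[@law P f mf]_y g y = \int[P]_x g (f x).
Proof.
move=> mg gc; rewrite /Rintegral; congr fine.
rewrite [LHS]integral_distribution//; first exact/measurable_EFinP.
apply: (prob_bounded P _ (fun x => gc (f x))).1.
exact: measurableT_comp.
Qed.

Lemma eq_Rintegral_measure (mu nu : probability T R) (g : T -> R) :
  (forall A, measurable A -> mu A = nu A) ->
  \int[mu]_x g x = \int[nu]_x g x.
Proof.
move=> munu; rewrite /Rintegral (@eq_measure_integral _ _ _ _ nu)// => A mA _.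
exact: munu.
Qed.

End laws.

Section couplings.
Context d d' {T : measurableType d} {X : measurableType d'} {R : realType}.
Variables (dist : X -> X -> R).
Hypothesis mdist : measurable_fun [set: X * X] (fun p => dist p.1 p.2).
Hypothesis dist_ge0 : forall x y, 0 <= dist x y.

Lemma eq_wasserstein (mu mu' nu nu' : probability X R) :
  (forall A, measurable A -> mu A = mu' A) ->
  (forall A, measurable A -> nu A = nu' A) ->
  wasserstein dist mu nu = wasserstein dist mu' nu'.
Proof.
move=> emu enu; rewrite /wasserstein; do 2 f_equal; apply/seteqP.
by split=> tau c A mA; have [-> ->] := c A mA; rewrite emu// enu.
Qed.

Lemma wasserstein_ge0 (mu nu : probability X R) :
  (0 <= wasserstein dist mu nu)%E.
Proof.
apply: le_ereal_inf_tmp => _ [tau _ <-]; apply: integral_ge0 => p _.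
by rewrite lee_fin.
Qed.

Lemma wasserstein_law (P : probability T R) (f g : T -> X)
    (mf : measurable_fun [set: T] f) (mg : measurable_fun [set: T] g) :
  (wasserstein dist (law P mf) (law P mg) <=
   \int[P]_x (dist (f x) (g x))%:E)%E.
Proof.
have mfg : measurable_fun [set: T] (fun x => (f x, g x)).
  exact: measurable_fun_pair.
apply: ereal_inf_lbound; exists (law P mfg).
  by move=> A mA; split.
rewrite [LHS]ge0_integral_distribution//; last by move=> p; rewrite lee_fin.
exact/measurable_EFinP.
Qed.

(** The easy half of Kantorovich duality: the strict bound provides a coupling of cost below [e], on
    which both integrals are read. *)
Lemma wasserstein_Rintegral (mu nu : probability X R) (g : X -> R) (c L e : R) :
  measurable_fun [set: X] g -> (forall x, `|g x| <= c) -> 0 <= L ->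
  (forall x y, `|g x - g y| <= L * dist x y) ->
  (wasserstein dist mu nu < e%:E)%E ->
  `|\int[mu]_x g x - \int[nu]_x g x| <= L * e.
Proof.
move=> mg gc L0 gL /ereal_inf_lt[_ [tau ctau <-]] taue.
have mg1 : measurable_fun [set: X * X] (fun p => g p.1).
  exact: measurableT_comp.
have mg2 : measurable_fun [set: X * X] (fun p => g p.2).
  exact: measurableT_comp.
have -> : \int[mu]_x g x = \int[tau]_p g p.1.
  rewrite -(law_Rintegral tau measurable_fst mg gc).
  by apply: eq_Rintegral_measure => A mA; have [<-] := ctau A mA.
have -> : \int[nu]_x g x = \int[tau]_p g p.2.
  rewrite -(law_Rintegral tau measurable_snd mg gc).
  by apply: eq_Rintegral_measure => A mA; have [_ <-] := ctau A mA.
have i1 := (prob_bounded tau mg1 (fun p => gc p.1)).1.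
have i2 := (prob_bounded tau mg2 (fun p => gc p.2)).1.
rewrite -RintegralB//.
rewrite -lee_fin EFin_normr_Rintegral//; last first.
  apply: (prob_bounded tau (c := c + c) _ _).1; first exact: measurable_funB.
  by move=> p; rewrite (le_trans (ler_normB _ _))// lerD.
apply: le_trans.
  apply: le_abse_integral => //.
  by apply/measurable_EFinP; exact: measurable_funB.
apply: (@le_trans _ _ (\int[tau]_p (L%:E * (dist p.1 p.2)%:E))%E).
  apply: ge0_le_integral => //=.
  - by apply/measurable_EFinP; apply: measurableT_comp => //; exact: measurable_funB.
  - by apply: measurable_funeM; exact/measurable_EFinP.
  - by move=> p _; rewrite -EFinM lee_fin.
rewrite ge0_integralZl//.
- by rewrite EFinM lee_wpmul2l ?lee_fin// ltW.
- exact/measurable_EFinP.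
- by move=> p _; rewrite lee_fin.
Qed.

End couplings.

Section supports.
Context {X : topologicalType} {R : realType}.
Variable (mu : set X -> \bar R).

Lemma msupport_closed : closed (msupport mu).
Proof.
move=> x clx U oU Ux; have /clx[y [my Uy]] : nbhs x U by apply: open_nbhs_nbhs.
exact: my.
Qed.

Lemma msupport_sub (S : set X) : closed S -> mu (~` S) = 0%E ->
  msupport mu `<=` S.
Proof.
move=> cS mu0 x mx; apply: contrapT => nSx.
by have := mx _ (closed_openC cS) nSx; rewrite mu0 ltxx.
Qed.

End supports.

(** A Lindelof argument: the null members of a countable family cover [U]. With rational boxes it
    shows that open sets disjoint from a support are null. *)
Lemma locally_null d {T : measurableType d} {R : realType}
    (mu : probability T R) {I : countType} (B : I -> set T) (U : set T) :
  measurable U -> (forall i, measurable (B i)) ->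
  (forall x, U x -> exists2 i, B i x & mu (B i) = 0%E) -> mu U = 0%E.
Proof.
move=> mU mB UB; apply/negligibleP => //.
pose F k := if (unpickle k : option I) is Some i then
  if mu (B i) == 0%E then B i else set0 else set0.
apply: (@negligibleS _ _ _ _ (\bigcup_k F k)).
  move=> x /UB[i Bix B0]; exists (pickle i) => //.
  by rewrite /F pickleK B0 eqxx.
apply: negligible_bigcup => k; rewrite /F.
case: unpickle => [i|]; last exact: negligible_set0.
by case: ifPn => [/eqP B0|_]; [exact/negligibleP|exact: negligible_set0].
Qed.

Section support_rV.
Context {R : realType} {n : nat}.
Local Notation E := 'rV[R]_n.

Lemma msupportC_null (mu : probability E R) (U : set E) : open U ->
  U `&` msupport mu = set0 -> mu U = 0%E.
Proof.
move=> oU Umu.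
have mB c : measurable (@ratbox R n c).
  by apply: openrV_measurable; exact: ratbox_open.
apply: (locally_null _ mB _); first exact: openrV_measurable.
move=> x Ux; have : ~ msupport mu x.
  by move=> mx; have : (U `&` msupport mu) x by []; rewrite Umu.
move=> /existsNP[Q /not_implyP[oQ /not_implyP[Qx /negP]]]; rewrite -leNgt => Q0.
have [c xc cQ] := ratbox_base oQ Qx; exists c => //; apply/eqP.
rewrite eq_le measure_ge0 andbT (le_trans _ Q0)// le_measure ?inE//.
exact: openrV_measurable.
Qed.

Lemma msupportC_null2 (mu : probability (E * E)%type R) (U : set (E * E)) :
  open U -> U `&` msupport mu = set0 -> mu U = 0%E.
Proof.
move=> oU Umu.
apply: (locally_null _ (@ratbox2_measurable R n) _); first exact: open2_measurable.
move=> x Ux; have : ~ msupport mu x.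
  by move=> mx; have : (U `&` msupport mu) x by []; rewrite Umu.
move=> /existsNP[Q /not_implyP[oQ /not_implyP[Qx /negP]]]; rewrite -leNgt => Q0.
have [c xc cQ] := ratbox2_base oQ Qx; exists c => //; apply/eqP.
rewrite eq_le measure_ge0 andbT (le_trans _ Q0)// le_measure ?inE//.
  exact: ratbox2_measurable.
exact: open2_measurable.
Qed.

End support_rV.
(** * Euclidean norm *)

Section euclidean_norm.
Context {R : realType} {n : nat}.
Implicit Types x y z : 'rV[R]_n.

Lemma dotC x y : dot x y = dot y x.
Proof. by apply: eq_bigr => i _; rewrite mulrC. Qed.

Lemma dotDr x y z : dot x (y + z) = dot x y + dot x z.
Proof. by rewrite -big_split; apply: eq_bigr => i _; rewrite mxE mulrDr. Qed.

Lemma dotZr a x y : dot x (a *: y) = a * dot x y.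
Proof. by rewrite mulr_sumr; apply: eq_bigr => i _; rewrite mxE; ring. Qed.

Lemma dotNr x y : dot x (- y) = - dot x y.
Proof. by rewrite -scaleN1r dotZr mulN1r. Qed.

Lemma dotDl x y z : dot (x + y) z = dot x z + dot y z.
Proof. by rewrite dotC dotDr !(dotC z). Qed.

Lemma dotZl a x y : dot (a *: x) y = a * dot x y.
Proof. by rewrite dotC dotZr dotC. Qed.

Lemma dot_ge0 x : 0 <= dot x x.
Proof. by apply: sumr_ge0 => i _; rewrite -expr2 sqr_ge0. Qed.

Lemma enorm_ge0 x : 0 <= enorm x.
Proof. exact: sqrtr_ge0. Qed.

Lemma enorm_sqr x : enorm x ^+ 2 = dot x x.
Proof. by rewrite sqr_sqrtr// dot_ge0. Qed.

Lemma dot_le_enorm x y : `|dot x y| <= enorm x * enorm y.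
Proof.
have key a b : 0 <= a ^+ 2 * dot x x + 2 * a * b * dot x y + b ^+ 2 * dot y y.
  have := dot_ge0 (a *: x + b *: y).
  rewrite !(dotDl, dotDr, dotZl, dotZr) (dotC y x); congr (_ <= _); ring.
rewrite -ler_sqr ?nnegrE ?mulr_ge0 ?enorm_ge0 ?normr_ge0// exprMn !enorm_sqr.
rewrite real_normK ?num_real//.
have [y0|y0] := eqVneq (dot y y) 0.
  rewrite y0 mulr0.
  have [->|xy0] := eqVneq (dot x y) 0; first by rewrite expr0n.
  (* With [dot y y = 0] the form is affine in [b], and this [b] makes it equal to -1: a
     contradiction unless [dot x y] vanishes. *)
  have := key 1 (- (dot x x + 1) / (2 * dot x y)); rewrite y0.
  have -> : 1 ^+ 2 * dot x x + 2 * 1 * (- (dot x x + 1) / (2 * dot x y)) * dot x y +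
     (- (dot x x + 1) / (2 * dot x y)) ^+ 2 * 0 = - 1 by field.
  by lra.
have yp : 0 < dot y y by rewrite lt_neqAle eq_sym y0 dot_ge0.
have := key (dot y y) (- dot x y).
have -> : dot y y ^+ 2 * dot x x + 2 * dot y y * - dot x y * dot x y +
  (- dot x y) ^+ 2 * dot y y = dot y y * (dot x x * dot y y - dot x y ^+ 2) by ring.
by rewrite pmulr_rge0// subr_ge0.
Qed.

Lemma ler_enormD x y : enorm (x + y) <= enorm x + enorm y.
Proof.
rewrite -ler_sqr ?nnegrE ?addr_ge0 ?enorm_ge0// sqrrD !enorm_sqr.
rewrite dotDl !dotDr (dotC y x).
have := le_trans (ler_norm _) (dot_le_enorm x y); lra.
Qed.

Lemma enormZ a x : enorm (a *: x) = `|a| * enorm x.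
Proof.
by rewrite /enorm dotZl dotZr mulrA -expr2 sqrtrM ?sqr_ge0// sqrtr_sqr.
Qed.

Lemma enormN x : enorm (- x) = enorm x.
Proof. by rewrite -scaleN1r enormZ normrN1 mul1r. Qed.

Lemma enorm0 : enorm (0 : 'rV[R]_n) = 0.
Proof. by rewrite -(scale0r 0) enormZ normr0 mul0r. Qed.

Lemma coord_le_enorm x i : `|x 0 i| <= enorm x.
Proof.
rewrite -ler_sqr ?nnegrE ?enorm_ge0 ?normr_ge0// enorm_sqr real_normK ?num_real//.
rewrite /dot (bigD1 i)//= expr2 lerDl.
by apply: sumr_ge0 => j _; rewrite -expr2 sqr_ge0.
Qed.

Lemma enorm_le_coord x a : (forall i, `|x 0 i| <= a) -> enorm x <= n%:R * a.
Proof.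
move=> xa.
(* When [n = 0] the hypothesis leaves the sign of [a] open, but both sides are zero. *)
have [i0|noi] := pselect (exists i : 'I_n, True); last first.
  rewrite (_ : x = 0) ?enorm0; last by apply/rowP => i; case: noi; exists i.
  rewrite (_ : n = 0)%N ?mul0r//; apply/eqP; rewrite eqn0Ngt; apply/negP => n0.
  by case: noi; exists (Ordinal n0).
have a0 : 0 <= a by case: i0 => i _; exact: le_trans (normr_ge0 _) (xa i).
rewrite -ler_sqr ?nnegrE ?mulr_ge0 ?enorm_ge0// enorm_sqr.
apply: (@le_trans _ _ (\sum_(i < n) a ^+ 2)).
  by apply: ler_sum => i _; rewrite -expr2 -[leLHS]real_normK ?num_real// ler_sqr ?nnegrE.
rewrite sumr_const card_ord exprMn -[leLHS]mulr_natl ler_wpM2r ?sqr_ge0//.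
rewrite -natrX ler_nat; case: (n) => // m; exact: leq_pmulr.
Qed.

Lemma edist_ge0 x y : 0 <= edist x y.
Proof. exact: enorm_ge0. Qed.

Lemma edistC x y : edist x y = edist y x.
Proof. by rewrite /edist -enormN opprB. Qed.

Lemma edist_triangle y x z : edist x z <= edist x y + edist y z.
Proof. by apply: le_trans (ler_enormD _ _); rewrite /edist addrA subrK. Qed.

Lemma dot_measurable d (T : measurableType d) (f g : T -> 'rV[R]_n) :
  measurable_fun [set: T] f -> measurable_fun [set: T] g ->
  measurable_fun [set: T] (fun t => dot (f t) (g t)).
Proof.
move=> mf mg; apply: measurable_sum => i.
by apply: measurable_funM; [exact: (measurable_fun_rV f).2|exact: (measurable_fun_rV g).2].
Qed.

Lemma enorm_measurable d (T : measurableType d) (f : T -> 'rV[R]_n) :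
  measurable_fun [set: T] f ->
  measurable_fun [set: T] (fun t => enorm (f t)).
Proof.
move=> mf; apply: (@measurableT_comp _ _ _ _ _ _ (@Num.sqrt R) setT _ _ (dot_measurable mf mf)).
by apply: continuous_measurable_fun; exact: sqrt_continuous.
Qed.

Lemma measurable_rowB d (T : measurableType d) (f g : T -> 'rV[R]_n) :
  measurable_fun [set: T] f -> measurable_fun [set: T] g ->
  measurable_fun [set: T] (fun t => f t - g t).
Proof.
move=> /measurable_fun_rV mf /measurable_fun_rV mg; apply/measurable_fun_rV => i.
under eq_fun do rewrite !mxE.
exact: measurable_funB.
Qed.

Lemma edist_measurable d (T : measurableType d) (f g : T -> 'rV[R]_n) :
  measurable_fun [set: T] f -> measurable_fun [set: T] g ->
  measurable_fun [set: T] (fun t => edist (f t) (g t)).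
Proof. by move=> mf mg; apply: enorm_measurable; exact: measurable_rowB. Qed.

Lemma edist_measurable_pair :
  measurable_fun [set: 'rV[R]_n * 'rV[R]_n] (fun p => edist p.1 p.2).
Proof. exact: edist_measurable. Qed.

Lemma enorm_continuous : continuous (@enorm R n).
Proof.
have cdot : continuous (fun x : 'rV[R]_n => \sum_(i < n) x 0 i * x 0 i).
  apply: continuous_big => [|i _ x]; first exact: add_continuous.
  have cc := @coord_continuous R 1 n 0 i x; exact: (cvgM cc cc).
by move=> x; apply: continuous_comp; [exact: cdot|exact: sqrt_continuous].
Qed.

Lemma eball_closed (r : R) : closed [set x : 'rV[R]_n | enorm x <= r].
Proof.
rewrite (_ : mkset _ = enorm @^-1` [set y | y <= r])//.
by apply: closed_comp => [x _|]; [exact: enorm_continuous|exact: closed_le].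
Qed.

Lemma eball_compact (r : R) : compact [set x : 'rV[R]_n | enorm x <= r].
Proof.
apply: bounded_closed_compact; last exact: eball_closed.
exists r; split; first exact: num_real.
move=> M rM x /= xr; rewrite [leLHS]mx_normrE; apply/bigmax_leP; split.
  by rewrite (le_trans (enorm_ge0 x))// (le_trans xr)// ltW.
move=> [i j] _ /=; rewrite (ord1 i) (le_trans (coord_le_enorm _ _))//.
by rewrite (le_trans xr)// ltW.
Qed.

End euclidean_norm.

Section tangent_distance.
Context {R : realType} {n : nat}.
Implicit Types p q : ('rV[R]_n * 'rV[R]_n)%type.

Lemma tdist_ge0 p q : 0 <= tdist p q.
Proof. exact: sqrtr_ge0. Qed.

Lemma edist1_le_tdist p q : edist p.1 q.1 <= tdist p q.
Proof.
rewrite -ler_sqr ?nnegrE ?edist_ge0 ?tdist_ge0//.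
by rewrite [leRHS]sqr_sqrtr ?addr_ge0 ?sqr_ge0// (lerDl (edist _ _ ^+ 2)) sqr_ge0.
Qed.

Lemma edist2_le_tdist p q : edist p.2 q.2 <= tdist p q.
Proof.
rewrite -ler_sqr ?nnegrE ?edist_ge0 ?tdist_ge0//.
by rewrite [leRHS]sqr_sqrtr ?addr_ge0 ?sqr_ge0// (lerDr (edist _ _ ^+ 2)) sqr_ge0.
Qed.

Lemma tdist_measurable : measurable_fun
  [set: ('rV[R]_n * 'rV[R]_n) * ('rV[R]_n * 'rV[R]_n)]
  (fun pq => tdist pq.1 pq.2).
Proof.
apply: measurableT_comp.
  by apply: continuous_measurable_fun; exact: sqrt_continuous.
apply: measurable_funD; apply: measurable_funX; apply: edist_measurable.
all: by apply: measurableT_comp.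
Qed.

End tangent_distance.
(** * Sampling and selection of random paths *)

Section unit_interval.
Context {R : realType}.

(** The carrier is the whole line, so that random variables are plain functions of a real; their
    values off [[0, 1[] are invisible to this law. *)
Definition unif := mrestr (@lebesgue_measure R)
  (measurable_itv `[0, 1[ : measurable (`[0, 1[%classic : set (measurableTypeR R))).

HB.instance Definition _ := Measure.on unif.

Let unif_setT : unif [set: _] = 1%E.
Proof.
by rewrite /unif /mrestr setTI lebesgue_measure_itv/= lte_fin ltr01 oppr0 adde0.
Qed.

HB.instance Definition _ := Measure_isProbability.Build _ _ _ unif unif_setT.

Lemma unif_countable (D : set R) : countable D -> unif D = 0%E.
Proof.
move=> cD; have cD' : countable (D `&` `[0, 1[%classic).
  by apply: sub_countable cD; apply: subset_card_le; exact: subIsetl.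
exact: countable_lebesgue_measure0.
Qed.

End unit_interval.

Section sampling.
Context {R : realType} {A : choiceType} (a0 : A).
Implicit Types (s : seq (R * A)) (Q : set A) (a w : R).

(** Quantile function of the discrete law [s]: consecutive intervals of lengths [p.1] are laid out
    from [a], and [w] selects the one containing it. The default [a0] is reached only past the last
    interval. *)
Fixpoint pick s a w : A :=
  if s is p :: s' then (if w < a + p.1 then p.2 else pick s' (a + p.1) w)
  else a0.

Lemma pick_measurable s a Q :
  measurable ([set w | Q (pick s a w)] : set (measurableTypeR R)).
Proof.
elim: s a => [|p s ih] a /=.
  have [Qa|Qa] := pselect (Q a0).
    by rewrite (_ : mkset _ = setT)//; apply/seteqP; split.
  by rewrite (_ : mkset _ = set0)//; apply/seteqP; split.
rewrite (_ : mkset _ = (`]-oo, (a + p.1)[%classic `&` [set _ | Q p.2]) `|`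
    (`[(a + p.1), +oo[%classic `&` [set w | Q (pick s (a + p.1) w)])); last first.
  apply/seteqP; split=> w /=; rewrite !in_itv/= andbT; case: ltP => wa.
  - by left.
  - by right.
  - by move=> [[]|[]].
  - by move=> [[]|[]].
apply: measurableU; apply: measurableI => //.
have [Qa|Qa] := pselect (Q p.2).
  by rewrite (_ : mkset _ = setT)//; apply/seteqP; split.
by rewrite (_ : mkset _ = set0)//; apply/seteqP; split.
Qed.

Definition mass s : R := \sum_(p <- s) p.1.

Lemma mass_cons p s : mass (p :: s) = p.1 + mass s.
Proof. exact: big_cons. Qed.

Lemma mass_ge0 s : all (fun p => 0 <= p.1) s -> 0 <= mass s.
Proof. by move=> /allP s0; rewrite /mass big_seq sumr_ge0. Qed.

Lemma pick_law s a Q : all (fun p => 0 <= p.1) s ->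
  lebesgue_measure ([set w | Q (pick s a w)] `&` `[a, (a + mass s)[%classic) =
  (\sum_(p <- s) p.1 * `[< Q p.2 >]%:R)%:E.
Proof.
elim: s a => [a _|p s ih a /= /andP[p0 s0]].
  by rewrite /mass !big_nil addr0 set_itvco0 setI0 measure0.
rewrite mass_cons big_cons addrA EFinD -(ih (a + p.1) s0).
have ms0 := mass_ge0 s0.
have -> : [set w | Q (if w < a + p.1 then p.2 else pick s (a + p.1) w)] `&`
      `[a, (a + p.1 + mass s)[ =
    ([set _ | Q p.2] `&` `[a, (a + p.1)[) `|` ([set w | Q (pick s (a + p.1) w)]
      `&` `[(a + p.1), (a + p.1 + mass s)[).
  apply/seteqP; split=> w /=; rewrite !in_itv/=.
    case: ltP => wa [Qw /andP[aw wb]]; first by left; rewrite aw.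
    by right.
  move=> [[Qw /andP[aw wa]]|[Qw /andP[aw wb]]].
    by rewrite wa aw/=; split => //; lra.
  by rewrite ltNge aw/= wb; split => //; lra.
rewrite measureU//; last 3 first.
- apply: measurableI => //; have [Qa|Qa] := pselect (Q p.2).
    by rewrite (_ : mkset _ = setT)//; apply/seteqP; split.
  by rewrite (_ : mkset _ = set0)//; apply/seteqP; split.
- by apply: measurableI => //; exact: pick_measurable.
- apply/seteqP; split=> // w /= [[_]]; rewrite !in_itv/= => /andP[_ wa] [_ /andP[]].
  by rewrite leNgt wa.
congr (_ + _)%E; case: asboolP => Qp.
  rewrite mulr1 (_ : [set _ | Q p.2] = setT) ?setTI; last by apply/seteqP; split.
  have : lebesgue_measure (`[a, (a + p.1)[%classic : set R) = p.1%:E.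
    rewrite lebesgue_measure_itv/= lte_fin; case: ltP => [_|h].
      by rewrite -EFinB; congr _%:E; ring.
    by congr _%:E; lra.
  exact.
rewrite mulr0 (_ : [set _ | Q p.2] = set0) ?set0I ?measure0//.
by apply/seteqP; split.
Qed.

(** An interval of length zero contains no point, so the chosen atom has positive weight. This
    matters because the bounds on paths are only available for atoms of positive weight. *)
Lemma pick_mem s a w : a <= w < a + mass s ->
  exists2 p, p \in s & 0 < p.1 /\ pick s a w = p.2.
Proof.
elim: s a => [a|p s ih a].
  by rewrite /mass big_nil => /andP[]; lra.
rewrite mass_cons addrA /=; case: (ltP w (a + p.1)) => wa /andP[aw wb].
  exists p; rewrite ?mem_head//; split => //; lra.
have [|q qs hq] := ih (a + p.1); first by rewrite wa.
by exists q => //; rewrite inE qs orbT.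
Qed.

Lemma pick_homo (c : A -> nat) s a w w' :
  sorted (fun p q => (c p.2 <= c q.2)%N) s ->
  all (fun p => 0 <= p.1) s ->
  a <= w -> w <= w' -> w' < a + mass s -> (c (pick s a w) <= c (pick s a w'))%N.
Proof.
elim: s a => [//|p s ih a ps /= /andP[p0 s0] aw ww' w'a].
have [wp|wp] := ltP w (a + p.1).
  have [//|q] := @pick_mem (p :: s) a w'; first by rewrite (le_trans aw ww').
  rewrite /= => qs [_ ->].
  move: ps; rewrite sorted_pairwise/=; last by move=> ? ? ?; exact: leq_trans.
  by move: qs; rewrite inE => /predU1P[-> //|qs] /andP[/allP/(_ _ qs)].
rewrite ltNge (le_trans wp ww')/=; apply: ih => //.
  exact: path_sorted ps.
by rewrite -addrA -mass_cons.
Qed.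

(** Sorting the atoms by [c] is a permutation, which keeps the law, and makes [c] nondecreasing
    along the intervals of [pick]: a monotone rearrangement. *)
Lemma sampling (c : A -> nat) s : all (fun p => 0 <= p.1) s -> mass s = 1 ->
  exists Z : R -> A,
    [/\ forall Q, measurable (Z @^-1` Q : set (measurableTypeR R)),
        forall Q, unif (Z @^-1` Q) = (\sum_(p <- s) p.1 * `[< Q p.2 >]%:R)%:E,
        forall w w', 0 <= w -> w <= w' -> w' < 1 -> (c (Z w) <= c (Z w'))%N &
        forall w, 0 <= w < 1 -> exists2 p, p \in s & 0 < p.1 /\ Z w = p.2].
Proof.
move=> s0 s1.
pose r := [rel p q : R * A | (c p.2 <= c q.2)%N].
have rt : total r by move=> p q; exact: leq_total.
have ps := permEl (perm_sort r s).
have s0' : all (fun p => 0 <= p.1) (sort r s) by rewrite all_sort.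
have s1' : mass (sort r s) = 1 by rewrite /mass (perm_big _ ps).
exists (pick (sort r s) 0); split.
- by move=> Q; exact: pick_measurable.
- move=> Q; have := pick_law 0 Q s0'; rewrite s1' add0r (perm_big _ ps)/=.
  exact.
- move=> w w' w0 ww' w'1; apply: (pick_homo (c := c)) => //.
    exact: sort_sorted.
  by rewrite s1' add0r.
- move=> w w01; have [|p pins hp] := @pick_mem (sort r s) 0 w.
    by rewrite s1' add0r.
  by exists p => //; rewrite -(perm_mem ps).
Qed.

End sampling.

(** * Subsequence extraction and Helly's argument on binary codes *)

Definition eventually_constant {A : Type} (u : nat -> A) : Prop :=
  exists c m0, forall m, (m0 <= m)%N -> u m = c.

(** Nested infinite index sets: [St j.+1] keeps the indices of [St j] whose [j]-th bit is [true] if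
    that happens infinitely often, and [false] otherwise; [phi m] is drawn from [St m]. *)
Lemma diagonal_extraction (u : nat -> nat -> bool) :
  exists2 phi : nat -> nat, {homo phi : i j / (i < j)%N} &
    forall j, eventually_constant (fun m => u j (phi m)).
Proof.
pose inf (S : set nat) := forall n, exists m, (n <= m)%N /\ S m.
pose nxt j (S : set nat) :=
  S `&` [set m | u j m = `[< inf (S `&` [set m | u j m]) >]].
have inf_nxt j S : inf S -> inf (nxt j S).
  move=> iS; rewrite /nxt; case: asboolP => // niS n.
  move/existsNP : niS => [n0 hn0].
  have [m [nm Sm]] := iS (maxn n n0); exists m.
  split; first exact: leq_trans (leq_maxl _ _) nm.
  split=> //=; apply/negP => um; apply: hn0; exists m.
  by split; first exact: leq_trans (leq_maxr _ _) nm.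
pose St := fix St j := if j is j'.+1 then nxt j' (St j') else setT.
have inf_St j : inf (St j).
  by elim: j => [n|j ih]; [exists n|exact: inf_nxt].
have St_sub i j : (i <= j)%N -> St j `<=` St i.
  elim: j => [|j ih]; first by rewrite leqn0 => /eqP ->.
  rewrite leq_eqVlt => /predU1P[->//|]; rewrite ltnS => /ih ij.
  by move=> x [] /ij.
pose phi := fix phi m := if m is m'.+1 then
  xget 0%N [set k | (phi m' < k)%N /\ St m'.+1 k] else 0%N.
have phiP m : (phi m < phi m.+1)%N /\ St m.+1 (phi m.+1).
  have [k [mk Sk]] := inf_St m.+1 (phi m).+1.
  by apply: (xgetPex 0%N (P := [set k | (phi m < k)%N /\ St m.+1 k])); exists k.
exists phi.
  by apply: homo_ltn => [|m]; [exact: ltn_trans|exact: (phiP m).1].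
move=> j; exists `[< inf (St j `&` [set m | u j m]) >], j.+1 => -[//|m] jm.
by have [] := St_sub _ _ jm _ (phiP m).2.
Qed.

Section binary_score.
Implicit Types (b : nat -> bool) (k : nat).

(** Bit 0 is the most significant, so comparing scores compares bit strings lexicographically; a
    shorter prefix is recovered by halving, the last bit by parity. *)
Fixpoint score b k : nat := if k is k'.+1 then (b k' + (score b k').*2)%N else 0.

Lemma score_bound b k : (score b k < 2 ^ k)%N.
Proof.
elim: k => [//|k ih /=]; rewrite expnS mul2n; case: (b k); rewrite ?ltn_double//.
by rewrite ltn_Sdouble.
Qed.

Lemma score_prefix b b' k k' : (k <= k')%N ->
  (score b k' <= score b' k')%N -> (score b k <= score b' k)%N.
Proof.
elim: k' => [|k' ih]; first by rewrite leqn0 => /eqP ->.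
rewrite leq_eqVlt => /predU1P[->//|kk'] /= /half_leq h; apply: ih => //.
by move: h; rewrite !half_bit_double.
Qed.

Lemma score_odd b k : b k = odd (score b k.+1).
Proof. by rewrite /= oddD odd_double addbF oddb. Qed.

End binary_score.

Section helly.
Context {R : realType} (b : nat -> R -> nat -> bool).
Hypothesis score_mono : forall N w w', 0 <= w -> w <= w' -> w' < 1 ->
  (score (b N w) N <= score (b N w') N)%N.

(* Helly's selection argument for the monotone integer-valued prefixes
   [score _ k]: once they converge at the rationals, they converge wherever
   the (monotone, bounded) limit does not jump. *)
Lemma helly_selection : exists2 phi : nat -> nat,
  {homo phi : i j / (i < j)%N} &
  exists2 D : set R, countable D & forall w, 0 <= w < 1 -> ~ D w ->
    forall j, eventually_constant (fun m => b (phi m) w j).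
Proof.
pose u i N := if (unpickle i : option (rat * nat)) is Some rj then
  b N (ratr rj.1) rj.2 else false.
have [phi phi_incr u_const] := diagonal_extraction u.
have le_phi m : (m <= phi m)%N.
  by elim: m => // m ih; rewrite (leq_ltn_trans ih)// phi_incr.
exists phi => //.
have rat_const (r : rat) k :
    eventually_constant (fun m => score (b (phi m) (ratr r)) k).
  elim: k => [|k [c [m0 hc]]]; first by exists 0%N, 0%N.
  have [d [m1 hd]] := u_const (pickle (r, k)).
  exists (d + c.*2)%N, (maxn m0 m1) => m; rewrite geq_max => /andP[h0 h1] /=.
  by rewrite hc//; have := hd m h1; rewrite /u pickleK/= => ->.
pose C k r := projT1 (cid (rat_const r k)).
have CP k r : exists m0, forall m, (m0 <= m)%N ->
    score (b (phi m) (ratr r)) k = C k r.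
  exact: projT2 (cid (rat_const r k)).
(* Index [N] is sorted by [N] bits only, so a prefix of length [k] is known to be monotone once the
   index reaches [k]. *)
have mono k m w w' : (k <= m)%N -> 0 <= w -> w <= w' -> w' < 1 ->
    (score (b (phi m) w) k <= score (b (phi m) w') k)%N.
  move=> km w0 ww' w'1; apply: (score_prefix _ (score_mono _ w0 ww' w'1)).
  exact: leq_trans km (le_phi m).
have C_mono k r r' : 0 <= ratr r :> R -> ratr r <= ratr r' :> R ->
    ratr r' < 1 :> R -> (C k r <= C k r')%N.
  move=> r0 rr' r'1; have [m0 h0] := CP k r; have [m1 h1] := CP k r'.
  pose m := maxn k (maxn m0 m1).
  rewrite -(h0 m) ?leq_max ?leqnn ?orbT// -(h1 m) ?leq_max ?leqnn ?orbT//.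
  by apply: mono => //; rewrite leq_max leqnn.
have C_bound k r : (C k r <= 2 ^ k)%N.
  by have [m0 h0] := CP k r; rewrite -(h0 m0)// ltnW// score_bound.
(* Points where the limit prefix [C k] jumps: no rational below [w] shares its value with a rational
   above. *)
pose Dk k := [set w : R | 0 < w < 1 /\ forall r r' : rat, 0 <= (ratr r : R) < w ->
  w < (ratr r' : R) < 1 -> C k r <> C k r'].
have cDk k : countable (Dk k).
  (* Here [v] is the largest limit value at rationals left of [w]. It increases strictly from one
     jump point to a later one, so [h] injects the jump set into the naturals. *)
  have maxP w : 0 < w -> exists v, (exists2 r : rat, 0 <= (ratr r : R) < w & C k r = v) /\
      forall r' : rat, 0 <= (ratr r' : R) < w -> (C k r' <= v)%N.
    move=> w0.
    have exv : exists v, `[< exists2 r : rat, 0 <= (ratr r : R) < w & C k r = v >].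
      exists (C k 0); apply/asboolP; exists 0 => //.
      by rewrite ler0q lexx [ratr _](rmorph0 (@ratr R)).
    have bv v : `[< exists2 r : rat, 0 <= (ratr r : R) < w & C k r = v >] -> (v <= 2 ^ k)%N.
      by move=> /asboolP[r _ <-].
    case: (ex_maxnP exv bv) => v /asboolP hv vmax; exists v; split => //.
    by move=> r' hr'; apply: vmax; apply/asboolP; exists r'.
  pose h w := if pselect (0 < w) is left w0 then projT1 (cid (maxP w w0)) else 0%N.
  have hlt w w' : Dk k w -> Dk k w' -> w < w' -> (h w < h w')%N.
    move=> [/andP[w0 w1] Dw] [/andP[w0' w1'] _] ww'.
    rewrite /h; case: pselect => // w0_; case: pselect => // w0'_.
    case: cid => /= v [[r /andP[r0 rw] <-] _]; case: cid => /= v' [_ v'max].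
    have /rat_in_itvoo[r'] := ww'; rewrite in_itv/= => /andP[wr' r'w'].
    apply: (@leq_trans (C k r')); last by apply: v'max; rewrite r'w' (le_trans _ (ltW wr'))// ltW.
    rewrite ltn_neqAle C_mono ?andbT//.
    - by apply/eqP; apply: Dw; rewrite ?r0 ?rw// wr' (lt_trans r'w').
    - by rewrite ltW// (lt_trans rw).
    - by rewrite (lt_trans r'w').
  apply/countable_injP; exists h => w w' /set_mem Dw /set_mem Dw' hww'.
  have [ww'|ww'|//] := ltgtP w w'.
    by have := hlt _ _ Dw Dw' ww'; rewrite hww' ltnn.
  by have := hlt _ _ Dw' Dw ww'; rewrite hww' ltnn.
(* The point 0 is excluded separately, as no nonnegative rational lies to its left; prefixes of
   length [k] therefore get index [k.+1]. *)
pose D k := if k is k'.+1 then Dk k' else [set 0].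
exists (\bigcup_k D k).
  apply: bigcup_countable => [|[|k] _]; [exact: countableP|exact: countable1|exact: cDk].
move=> w /andP[w0 w1] nD j.
have wp : 0 < w.
  rewrite lt_neqAle w0 andbT; apply/eqP => w00.
  by apply: nD; exists 0%N => //; rewrite /D /= w00.
have [r [r' [/andP[r0 rw] /andP[wr' r'1] Crr']]] : exists r r',
    [/\ 0 <= (ratr r : R) < w, w < (ratr r' : R) < 1 & C j.+1 r = C j.+1 r'].
  apply: contrapT => /forallNP nrr'; apply: nD; exists j.+2 => //.
  split; first by rewrite wp w1.
  by move=> r r' hr hr' Crr'; apply: (nrr' r); exists r'.
have [m0 h0] := CP j.+1 r; have [m1 h1] := CP j.+1 r'.
exists (odd (C j.+1 r)), (maxn j.+1 (maxn m0 m1)) => m.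
rewrite !geq_max => /andP[jm /andP[hm0 hm1]].
(* Bit [j] is the parity of the prefix of length [j.+1], which is squeezed between its equal
   eventual values at [r] and [r']. *)
rewrite score_odd; congr odd; apply/eqP; rewrite eqn_leq; apply/andP; split.
  by rewrite Crr' -(h1 m)//; apply: mono => //; exact: ltW.
by rewrite -(h0 m)//; apply: mono => //; exact: ltW.
Qed.

End helly.

(** * Convergence of paths from convergence of their bits *)

Section real_sequences.
Context {R : realType}.

(** The limit is the supremum of the rationals eventually below the sequence. A rational just above
    it is decided too, and can only be decided as eventually exceeding the sequence. *)
Lemma rat_cut_cvg (u : nat -> R) (B : R) : (forall m, `|u m| <= B) ->
  (forall q : rat, eventually_constant (fun m => ratr q <= u m)) -> cvgn u.
Proof.
move=> uB uq.
pose S := [set x : R | exists q : rat, x = ratr q /\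
  exists m0, forall m, (m0 <= m)%N -> ratr q <= u m].
have supS : has_sup S.
  split; last first.
    exists B => x [q [-> [m0 /(_ m0 (leqnn _))]]] /le_trans; apply.
    exact: le_trans (ler_norm _) (uB _).
  have /rat_in_itvoo[q] : - B - 1 < - B :> R by lra.
  rewrite in_itv/= => /andP[_ qB]; exists (ratr q), q; split=> //; exists 0%N => m _.
  by rewrite (le_trans (ltW qB))//; have := uB m; rewrite ler_norml => /andP[].
apply/cvg_ex; exists (sup S); apply/cvgrPdist_lt => e e0.
have [_ [q [-> [m0 hq]]] lq] := sup_adherent e0 supS.
have /rat_in_itvoo[q'] : sup S < sup S + e :> R by rewrite ltrDl.
rewrite in_itv/= => /andP[lq' q'e].
have [c [m1 hc]] := uq q'; exists (maxn m0 m1) => // m /=; rewrite geq_max.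
move=> /andP[/hq qu /hc q'u]; rewrite distrC ltr_distl.
rewrite (lt_le_trans lq qu)/=; apply: le_lt_trans q'e; apply: ltW.
rewrite ltNge q'u; apply/negP => ct; move: lq'; rewrite ltNge => /negP; apply.
apply: ub_le_sup; first by case: supS.
by exists q'; split => //; exists m1 => k /hc ->.
Qed.

Lemma cvg_uniform_approx (u : nat -> R) :
  (forall e, 0 < e -> exists2 v, cvgn v & forall m, `|u m - v m| <= e) ->
  cvgn u.
Proof.
move=> uv; apply/cauchy_cvgP/cauchy_exP => e e0.
have [|v cv huv] := uv (e / 2); first by rewrite divr_gt0.
exists (lim (v @ \oo)).
have : \forall m \near \oo, `|lim (v @ \oo) - v m| < e / 2.
  by move/cvgrPdist_lt : cv; apply; rewrite divr_gt0.
apply: filterS => m hm; rewrite /ball/= (splitr e).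
rewrite (_ : _ - u m = (lim (v @ \oo) - v m) - (u m - v m)); last by ring.
by rewrite (le_lt_trans (ler_normB _ _))// ltr_leD.
Qed.

End real_sequences.

Definition lipschitz_path {R : realType} {n : nat} (M : R) (p : R -> 'rV[R]_n) :=
  forall t s, edist (p t) (p s) <= M * `|t - s|.

Section process_limit.
Context {R : realType} {n : nat}.
Local Notation E := 'rV[R]_n.

(* An enumeration of the rational half-spaces met at rational times: the bits
   of a Lipschitz path determine the path. *)
Definition path_bit (p : R -> E) (j : nat) : bool :=
  if (unpickle j : option (rat * 'I_n * rat)) is Some tiq then
    ratr tiq.2 <= p (ratr tiq.1.1) 0 tiq.1.2 else false.

Lemma coord_le_edist (x y : E) i : `|x 0 i - y 0 i| <= edist x y.
Proof. by apply: le_trans (coord_le_enorm _ i); rewrite !mxE. Qed.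

(** At a rational time the bits decide every rational cut of a coordinate, so the coordinate
    converges. The common Lipschitz constant makes a nearby rational time a uniform substitute for
    [t]. *)
Lemma bits_cvg (X : nat -> R -> E) (M B : R) :
  (forall m, lipschitz_path M (X m)) -> (forall m t, enorm (X m t) <= B) ->
  (forall j, eventually_constant (fun m => path_bit (X m) j)) ->
  forall t i, cvgn (fun m => X m t 0 i).
Proof.
move=> lipX XB bits t i; apply: cvg_uniform_approx => e e0.
have M0 : 0 <= M.
  have := le_trans (edist_ge0 _ _) (lipX 0%N 1 0); by rewrite subr0 normr1 mulr1.
have Me0 : 0 < e / (M + 1) by rewrite divr_gt0//; lra.
have /rat_in_itvoo[q] : t < t + e / (M + 1) by rewrite ltrDl.
rewrite in_itv/= => /andP[tq qe].
exists (fun m => X m (ratr q) 0 i).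
  apply: (@rat_cut_cvg _ _ B) => [m|r].
    exact: le_trans (coord_le_enorm _ _) (XB _ _).
  have [c [m0 hc]] := bits (pickle (q, i, r)); exists c, m0 => m /hc.
  by rewrite /path_bit pickleK.
move=> m; apply: le_trans (coord_le_edist _ _ _) _.
apply: le_trans (lipX _ _ _) _.
have tqe : `|t - ratr q| <= e / (M + 1).
  by rewrite distrC ger0_norm; lra.
apply: (le_trans (ler_wpM2l M0 tqe)).
rewrite mulrCA ger_pMr// ler_pdivrMr; lra.
Qed.

(** A Skorokhod representation along a subsequence, with convergence at every time and every sample
    point. Having all bounds for every [w] makes the later integrands bounded everywhere. *)
Theorem path_selection (s : nat -> seq (R * (R -> E))) (M : nat -> R) (K B : R) :
  (forall N, all (fun p => 0 <= p.1) (s N)) ->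
  (forall N, mass (s N) = 1) ->
  (forall N p, p \in s N -> 0 < p.1 ->
    lipschitz_path (M N) p.2 /\ forall t, enorm (p.2 t) <= B) ->
  (forall N, 0 <= M N <= K) ->
  exists2 phi : nat -> nat, {homo phi : i j / (i < j)%N} &
  exists (Y : nat -> R -> R -> E) (L : R -> R -> E),
  [/\ forall m t, measurable_fun [set: R] (fun w => Y m w t),
      forall m t A, measurable A -> unif ((fun w => Y m w t) @^-1` A) =
        (\sum_(p <- s (phi m)) p.1 * `[< A (p.2 t) >]%:R)%:E,
      forall m w, lipschitz_path (M (phi m)) (Y m w),
      forall m w t, enorm (Y m w t) <= B &
      forall w t i, Y m w t 0 i @[m --> \oo] --> L w t 0 i].
Proof.
move=> s0 s1 sM MK.
(* The number of bits used for sorting is finite, to give an integer code, and grows with [N], so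
   that every prefix is eventually monotone. *)
have samp N := sampling (fun=> 0) (fun p => score (path_bit p) N) (s0 N) (s1 N).
have [Z ZP] := choice samp.
pose b N w := path_bit (Z N w).
have mono N w w' : 0 <= w -> w <= w' -> w' < 1 ->
    (score (b N w) N <= score (b N w') N)%N.
  by have [_ _ + _] := ZP N; apply.
have [phi phi_incr [D cD bD]] := helly_selection mono.
exists phi => //.
(* Good sample points. On the null complement the path is replaced by the constant path 0, which
   meets all the bounds and converges trivially. *)
pose G := [set w : R | 0 <= w < 1 /\ ~ D w].
have GE : G = `[0, 1[%classic `\` D.
  by apply/seteqP; split=> w /=; rewrite in_itv.
have mD : measurable (D : set (measurableTypeR R)).
  by apply: countable_measurable => // t; exact: measurable_set1.
have mG : measurable (G : set (measurableTypeR R)).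
  by rewrite GE; apply: measurableD.
have GC : unif (~` G) = 0%E.
  have : unif D = 0%E by exact: unif_countable.
  rewrite /unif /mrestr => D0.
  rewrite (_ : ~` G `&` _ = D `&` `[0, 1[%classic)//.
  rewrite GE; apply/seteqP; split=> w /= [].
    by move=> h h1; split => //; apply: contrapT => nD; apply: h.
  by move=> Dw h1; split => // -[].
pose Y m w : R -> E := if `[< G w >] then Z (phi m) w else fun=> 0.
have B0 : 0 <= B.
  have [_ _ _ /(_ 0)] := ZP 0%N; rewrite lexx ltr01 => /(_ isT)[p ps [p0 _]].
  have [_ h] := sM 0%N p ps p0; exact: le_trans (enorm_ge0 _) (h 0).
have YM m w : lipschitz_path (M (phi m)) (Y m w).
  rewrite /Y; case: asboolP => [[w01 _]|_].
    have [_ _ _ /(_ w w01)[p ps [p0 ->]]] := ZP (phi m).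
    by have [] := sM _ p ps p0.
  move=> t u; rewrite /edist subrr enorm0 mulr_ge0//.
  by have /andP[] := MK (phi m).
have YB m w t : enorm (Y m w t) <= B.
  rewrite /Y; case: asboolP => [[w01 _]|_]; last by rewrite enorm0.
  have [_ _ _ /(_ w w01)[p ps [p0 ->]]] := ZP (phi m).
  by have [] := sM _ p ps p0.
have Ycvg w t i : cvgn (fun m => Y m w t 0 i).
  rewrite /Y; case: asboolP => [[w01 nD]|_]; last exact: is_cvg_cst.
  apply: (@bits_cvg (fun m => Z (phi m) w) K B).
  - move=> m; have := YM m w; rewrite /Y; case: asboolP => [_ lY x y|[]//].
    apply: le_trans (lY x y) _; rewrite ler_wpM2r//.
    by have /andP[] := MK (phi m).
  - by move=> m x; have := YB m w x; rewrite /Y; case: asboolP => [_|[]].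
  - exact: bD.
have preY m t (A : set E) : (fun w => Y m w t) @^-1` A =
    (G `&` (Z (phi m) @^-1` [set p | A (p t)])) `|` (~` G `&` [set _ | A 0]).
  apply/seteqP; split=> w /=; rewrite /Y; case: asboolP => Gw.
  - by left.
  - by right.
  - by move=> [[]|[]].
  - by move=> [[]|[]].
have mY m t : measurable_fun [set: R] (fun w => Y m w t).
  move=> _ A mA; rewrite setTI preY; apply: measurableU.
    by apply: measurableI => //; have [h _ _ _] := ZP (phi m); exact: h.
  apply: measurableI; first exact: measurableC.
  have [A0|A0] := pselect (A 0).
    by rewrite (_ : mkset _ = setT)//; apply/seteqP; split.
  by rewrite (_ : mkset _ = set0)//; apply/seteqP; split.
exists Y, (fun w t => \row_i lim (Y m w t 0 i @[m --> \oo])); split => //; last first.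
  by move=> w t i; rewrite mxE; exact: Ycvg.
move=> m t A mA.
have [mZ lawZ _ _] := ZP (phi m).
rewrite -(lawZ [set p | A (p t)]).
have split_G (S : set R) : measurable (S : set (measurableTypeR R)) ->
    unif S = unif (S `&` G).
  move=> mS; rewrite (measureDI unif mS mG) [X in (X + _)%E](_ : _ = 0%E) ?add0e//.
  apply: subset_measure0 GC; [exact: measurableD|exact: measurableC|].
  by move=> w [].
rewrite [LHS]split_G; last by rewrite -[X in measurable X]setTI; exact: mY.
rewrite [RHS]split_G; last exact: mZ.
congr unif; apply/seteqP; split=> w /= [+ Gw]; rewrite /Y; case: asboolP => //.
Qed.

End process_limit.
(** * The limit curve *)

Lemma bounded_convergence d (T : measurableType d) (R : realType)
    (P : probability T R) (f : nat -> T -> R) (g : T -> R) (c : R) :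
  (forall m, measurable_fun [set: T] (f m)) -> measurable_fun [set: T] g ->
  (forall m x, `|f m x| <= c) -> (forall x, f m x @[m --> \oo] --> g x) ->
  \int[P]_x f m x @[m --> \oo] --> \int[P]_x g x.
Proof.
move=> mf mg fc fg.
have mc : P.-integrable [set: T] (EFin \o cst c).
  by apply: (prob_bounded P (c := `|c|) _ _).1.
have [||||ig _ cvgI] := @dominated_convergence _ _ _ P setT measurableT
  (fun m x => (f m x)%:E) (EFin \o g) (EFin \o cst c) _ _ _ mc _.
- by move=> m; exact/measurable_EFinP.
- exact/measurable_EFinP.
- by apply: aeW => x _; apply: cvg_EFin; [exact: nearW|exact: fg].
- by apply: aeW => x m _; rewrite lee_fin.
apply: fine_cvg; rewrite fineK; first exact: cvgI.
exact: integrable_fin_num.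
Qed.

Lemma edist_cvg {R : realType} {n : nat} (x : nat -> 'rV[R]_n) (y : 'rV[R]_n) :
  (forall i, x m 0 i @[m --> \oo] --> y 0 i) ->
  edist (x m) y @[m --> \oo] --> 0.
Proof.
move=> xy; apply/cvgrPdist_le => e e0.
have e' : 0 < e / (n%:R + 1) by rewrite divr_gt0// ltr_wpDl.
have : \forall m \near \oo, forall i, `|y 0 i - x m 0 i| <= e / (n%:R + 1).
  by apply: filter_forall => i; move/cvgrPdist_le : (xy i); exact.
apply: filterS => m hm; rewrite sub0r normrN ger0_norm ?edist_ge0// edistC.
apply: (@le_trans _ _ (n%:R * (e / (n%:R + 1)))).
  by apply: enorm_le_coord => i; rewrite !mxE.
by rewrite mulrCA ger_pMr// ler_pdivrMr ?ltr_wpDl// mul1r lerDl.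
Qed.

Section limit_curve.
Context {R : realType} {n : nat}.
Local Notation E := 'rV[R]_n.
Variables (Y : nat -> R -> R -> E) (L : R -> R -> E).
Variables (M : nat -> R) (Ml K B : R).
Hypothesis mY : forall m t, measurable_fun [set: R] (fun w => Y m w t).
Hypothesis YM : forall m w, lipschitz_path (M m) (Y m w).
Hypothesis YB : forall m w t, enorm (Y m w t) <= B.
Hypothesis YL : forall w t i, Y m w t 0 i @[m --> \oo] --> L w t 0 i.
Hypothesis MK : forall m, M m <= K.
Hypothesis cvgM : M m @[m --> \oo] --> Ml.

Let K0 : 0 <= K.
Proof.
have := le_trans (edist_ge0 _ _) (YM 0%N 0 1 0).
by rewrite subr0 normr1 mulr1 => /le_trans; exact.
Qed.

Let YL0 w t : edist (Y m w t) (L w t) @[m --> \oo] --> 0.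
Proof. exact: edist_cvg. Qed.

Lemma limit_measurable t : measurable_fun [set: R] (fun w => L w t).
Proof.
apply/measurable_fun_rV => i; apply: measurable_fun_cvg => [m|w _]; last exact: YL.
by move/measurable_fun_rV : (mY m t); exact.
Qed.

Lemma limit_bounded w t : enorm (L w t) <= B.
Proof.
apply/ler_addgt0Pr => e e0.
have /cvgrPdist_le/(_ e e0)[m _ /(_ m (leqnn m))/=] := YL0 w t.
rewrite sub0r normrN ger0_norm ?edist_ge0// edistC => he.
rewrite -[L w t](subrK (Y m w t)) addrC; apply: le_trans (ler_enormD _ _) _.
by rewrite lerD.
Qed.

(** The constants pass to the limit along with the paths: the result is the limit [Ml] of the speeds
    rather than their common bound [K], which is how the sharp constant arises. *)
Lemma limit_lipschitz w : lipschitz_path Ml (L w).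
Proof.
move=> t s; apply/ler_addgt0Pr => e e0.
have e3 : 0 < e / 3 by rewrite divr_gt0.
have e4 : 0 < e / 3 / (`|t - s| + 1) by rewrite divr_gt0// ltr_wpDl.
have [m [h1 h2 h3]] : exists m, [/\ edist (Y m w t) (L w t) <= e / 3,
    edist (Y m w s) (L w s) <= e / 3 & M m <= Ml + e / 3 / (`|t - s| + 1)].
  have /cvgrPdist_le/(_ _ e3) near1 := YL0 w t.
  have /cvgrPdist_le/(_ _ e3) near2 := YL0 w s.
  have /cvgrPdist_le/(_ _ e4) near3 := cvgM.
  have [m [[/= h1 h2] h3]] := filter_ex (filterI (filterI near1 near2) near3).
  exists m; split.
  - by move: h1; rewrite sub0r normrN ger0_norm ?edist_ge0.
  - by move: h2; rewrite sub0r normrN ger0_norm ?edist_ge0.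
  - by move: h3; rewrite ler_distlC => /andP[].
apply: le_trans (edist_triangle (Y m w t) _ _) _.
have := edist_triangle (Y m w s) (Y m w t) (L w s).
have := YM m w t s; rewrite edistC in h1.
have : M m * `|t - s| <= Ml * `|t - s| + e / 3.
  apply: (le_trans (ler_wpM2r (normr_ge0 _) h3)).
  rewrite mulrDl lerD2l -(mulrA (e / 3)) ger_pMr//.
  by rewrite mulrC ler_pdivrMr ?ltr_wpDl// mul1r lerDl.
rewrite edistC; lra.
Qed.

(** The cost of the coupling given by the joint law of approximate and limit position at time [t],
    hence a bound for [W]. *)
Let gap m t := \int[unif]_w edist (Y m w t) (L w t).

Let measurable_gap m t s :
  measurable_fun [set: R] (fun w => edist (Y m w s) (L w t)).
Proof. by apply: edist_measurable; [exact: mY|exact: limit_measurable]. Qed.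

Let edist_bound (x y : E) : enorm x <= B -> enorm y <= B -> `|edist x y| <= B + B.
Proof.
move=> xB yB; rewrite ger0_norm ?edist_ge0//.
by rewrite (le_trans (ler_enormD _ _))// enormN lerD.
Qed.

Let gap_cvg t : gap m t @[m --> \oo] --> 0.
Proof.
rewrite (_ : 0 = \int[unif]_(w in [set: R]) (0 : R)); last first.
  by rewrite Rintegral_cst// mul0r.
apply: (@bounded_convergence _ _ _ unif (fun m w => edist (Y m w t) (L w t)) _ (B + B)) => //.
- by move=> m; exact: measurable_gap.
- by move=> m w; apply: edist_bound => //; exact: limit_bounded.
Qed.

Let gap_lipschitz m t s : gap m t <= gap m s + (K + K) * `|t - s|.
Proof.
have bnd x : `|edist (Y m x t) (L x t)| <= B + B.
  by apply: edist_bound => //; exact: limit_bounded.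
have bnd' x : `|edist (Y m x s) (L x s)| <= B + B.
  by apply: edist_bound => //; exact: limit_bounded.
have ic : unif.-integrable [set: R] (EFin \o cst ((K + K) * `|t - s|)).
  by apply: (prob_bounded unif (c := `|(K + K) * `|t - s| |) _ _).1.
rewrite (_ : (K + K) * _ = \int[unif]_(w in [set: R]) ((K + K) * `|t - s|)); last first.
  by rewrite Rintegral_cst// [X in fine X](_ : _ = 1%E) ?mulr1//; exact: probability_setT.
rewrite -RintegralD//; last exact: (prob_bounded unif (measurable_gap m s s) bnd').1.
apply: le_Rintegral => //.
- exact: (prob_bounded unif (measurable_gap m t t) bnd).1.
- apply: (prob_bounded unif (c := B + B + `|(K + K) * `|t - s| |) _ _).1.
    by apply: measurable_funD; [exact: measurable_gap|exact: measurable_cst].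
  by move=> w; rewrite (le_trans (ler_normD _ _))// lerD.
move=> w _.
have MlK : Ml <= K.
  rewrite -(cvg_lim (@Rhausdorff R) cvgM); apply: limr_le; last exact: nearW.
  by apply/cvg_ex; exists Ml.
have h1 := edist_triangle (Y m w s) (Y m w t) (L w t).
have h2 := edist_triangle (L w s) (Y m w s) (L w t).
have h3 := le_trans (YM m w t s) (ler_wpM2r (normr_ge0 _) (MK m)).
have h4 := le_trans (limit_lipschitz w s t) (ler_wpM2r (normr_ge0 _) MlK).
rewrite mulrDl; rewrite distrC in h4; lra.
Qed.

(** The gap is Lipschitz in time with constant [K + K] for all [m], so smallness at the finitely
    many nodes of a mesh [eta] suffices; moving to the node on the left costs at most [e / 2]. *)
Let gap_uniform (T e : R) : 0 <= T -> 0 < e ->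
  exists m0, forall m, (m0 <= m)%N -> forall t, 0 <= t <= T -> gap m t <= e.
Proof.
move=> T0 e0; pose eta := e / 2 / (K + K + 1).
have KK : 0 < K + K + 1 by have := K0; lra.
have eta0 : 0 < eta by rewrite !divr_gt0.
pose J := (Num.truncn (T / eta)).+1.
have : \forall m \near \oo, forall j : 'I_J, gap m (j%:R * eta) <= e / 2.
  apply: filter_forall => j.
  have /cvgrPdist_le/(_ (e / 2)) := @gap_cvg (j%:R * eta).
  rewrite divr_gt0// => /(_ isT); apply: filterS => m /=.
  by rewrite sub0r normrN; exact: le_trans (ler_norm _).
move=> [m0 _ hm0]; exists m0 => m /hm0 /= hm t /andP[t0 tT].
have te0 : 0 <= t / eta by rewrite divr_ge0// ltW.
pose j := Num.truncn (t / eta).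
have jJ : (j < J)%N.
  by rewrite ltnS; apply: le_truncn; rewrite ler_pM2r// invr_gt0.
have /andP[h1 h2] := truncn_itv te0.
have := hm (Ordinal jJ) => /= hj.
have tj : `|t - j%:R * eta| <= eta.
  rewrite ger0_norm; last by rewrite subr_ge0 -ler_pdivlMr.
  rewrite lerBlDr -[X in X + _]mul1r -mulrDl -ler_pdivrMr// -natr1 in h2 *.
  by rewrite addrC ltW.
apply: le_trans (gap_lipschitz m t (j%:R * eta)) _.
rewrite [leRHS](splitr e) lerD//.
have KK0 : 0 <= K + K by rewrite addr_ge0 ?K0.
apply: (le_trans (ler_wpM2l KK0 tj)).
rewrite /eta mulrCA ger_pMr ?divr_gt0// ler_pdivrMr// mul1r; lra.
Qed.

Let W_gap m t s : (W (law unif (limit_measurable t)) (law unif (mY m s)) <=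
  (gap m t + K * `|t - s|)%:E)%E.
Proof.
apply: le_trans (wasserstein_law (@edist_measurable_pair R n) (@edist_ge0 R n) _ _ _) _.
have bnd x : `|edist (Y m x t) (L x t)| <= B + B.
  by apply: edist_bound => //; exact: limit_bounded.
have ic : unif.-integrable [set: R] (EFin \o cst (K * `|t - s|)).
  by apply: (prob_bounded unif (c := `|K * `|t - s| |) _ _).1.
rewrite (_ : K * _ = \int[unif]_(w in [set: R]) (K * `|t - s|)); last first.
  by rewrite Rintegral_cst// [X in fine X](_ : _ = 1%E) ?mulr1//; exact: probability_setT.
rewrite -RintegralD//; last exact: (prob_bounded unif (measurable_gap m t t) bnd).1.
have i2 : unif.-integrable [set: R] (EFin \o (fun w => edist (Y m w t) (L w t) + K * `|t - s|)).
  apply: (prob_bounded unif (c := B + B + `|K * `|t - s| |) _ _).1.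
    by apply: measurable_funD; [exact: measurable_gap|exact: measurable_cst].
  by move=> w; rewrite (le_trans (ler_normD _ _))// lerD.
rewrite /Rintegral fineK; last exact: integrable_fin_num.
apply: ge0_le_integral => //=.
- by move=> w _; rewrite lee_fin edist_ge0.
- by apply/measurable_EFinP; apply: edist_measurable; [exact: limit_measurable|exact: mY].
- by apply/measurable_EFinP; apply: measurable_funD; [exact: measurable_gap|exact: measurable_cst].
move=> w _; rewrite lee_fin.
have := edist_triangle (Y m w t) (L w t) (Y m w s).
rewrite (edistC (L w t) (Y m w t)) => /le_trans; apply; rewrite lerD2l.
exact: le_trans (YM m w t s) (ler_wpM2r (normr_ge0 _) (MK m)).
Qed.

Lemma W_limit_lipschitz t s :
  (W (law unif (limit_measurable t)) (law unif (limit_measurable s)) <=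
    (Ml * `|t - s|)%:E)%E.
Proof.
apply: le_trans (wasserstein_law (@edist_measurable_pair R n) (@edist_ge0 R n) _ _ _) _.
rewrite -[leRHS]mule1 -[1%E in leRHS](@probability_setT _ _ _ unif).
rewrite -integral_cst//; apply: ge0_le_integral => //=.
- by move=> w _; rewrite lee_fin edist_ge0.
- by apply/measurable_EFinP; apply: edist_measurable; exact: limit_measurable.
- by move=> w _; rewrite lee_fin; exact: limit_lipschitz.
Qed.

(** The first bound gives the uniform convergence of the theorem. The second, at two times, is what
    lets [V] at a node near [t] be compared with [V] at the limit measure of time [t]. *)
Lemma W_limit_cvg (T e : R) : 0 <= T -> 0 < e ->
  exists m0, forall m, (m0 <= m)%N -> forall t, 0 <= t <= T ->
    (W (law unif (mY m t)) (law unif (limit_measurable t)) <= e%:E)%E /\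
    forall s, (W (law unif (limit_measurable t)) (law unif (mY m s)) <=
      (e + K * `|t - s|)%:E)%E.
Proof.
move=> T0 e0; have [m0 hm0] := gap_uniform T0 e0; exists m0 => m /hm0 hm t /hm gt.
split; last first.
  move=> s; apply: le_trans (W_gap m t s) _.
  by rewrite lee_fin lerD2r.
apply: le_trans (wasserstein_law (@edist_measurable_pair R n) (@edist_ge0 R n) _ _ _) _.
have bnd x : `|edist (Y m x t) (L x t)| <= B + B.
  by apply: edist_bound => //; exact: limit_bounded.
rewrite -lee_fin /gap /Rintegral fineK// in gt.
by apply: integrable_fin_num => //; exact: (prob_bounded unif (measurable_gap m t t) bnd).1.
Qed.

End limit_curve.
(** * Test functions *)

Section test_functions.
Context {R : realType} {n : nat}.
Local Notation E := 'rV[R]_n.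
Implicit Types (f : E -> R) (x y v : E).

Lemma continuous_rV_measurable f : continuous f -> measurable_fun [set: E] f.
Proof.
move=> cf; apply: (measurability _ (measurable_realfun.RGenOpens.measurableE R)).
move=> _ [_ [a [b ->]] <-]; rewrite setTI; apply: openrV_measurable.
by apply: open_comp => [x _|]; [exact: cf|exact: interval_open].
Qed.

Lemma derive_dot f x v : differentiable f x -> 'D_v f x = dot (grad f x) v.
Proof.
move=> df; rewrite deriveE// [in LHS](row_sum_delta v) linear_sum.
apply: eq_bigr => i _; rewrite linearZ/= !mxE /partial deriveE//.
by rewrite mulrC.
Qed.

Lemma is_derive_line f x v (t : R) : differentiable f (x + t *: v) ->
  is_derive t 1 (fun s : R => f (x + s *: v)) ('D_v f (x + t *: v)).
Proof.
move=> df; have dv := diff_derivable (v := v) df.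
have e : (fun h : R => h^-1 *: (((fun s : R => f (x + s *: v)) \o shift t) (h *: 1) -
      f (x + t *: v))) =
    (fun h : R => h^-1 *: ((f \o shift (x + t *: v)) (h *: v) - f (x + t *: v))).
  apply/funext => h /=; congr (_ *: (f _ - _)).
  by rewrite [h *: 1]mulr1 scalerDl addrCA.
by split; rewrite /derivable /derive e.
Qed.

Lemma mean_value f x v : (forall y, differentiable f y) ->
  exists2 c : R, 0 <= c <= 1 & f (x + v) - f x = dot (grad f (x + c *: v)) v.
Proof.
move=> df.
have dl (t : R) : is_derive t 1 (fun s : R => f (x + s *: v)) ('D_v f (x + t *: v)).
  exact: is_derive_line.
have cl : {within `[0, 1], continuous (fun s : R => f (x + s *: v))}.
  apply: continuous_subspaceT => t; apply: differentiable_continuous.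
  by apply/derivable1_diffP; exact: (ex_derive (is_derive := dl t)).
have [c] := @MVT_segment R (fun s => f (x + s *: v))
  (fun t => 'D_v f (x + t *: v)) 0 1 ler01 (fun t _ => dl t) cl.
rewrite in_itv/= scale1r scale0r addr0 subr0 mulr1 derive_dot// => c01 e.
by exists c.
Qed.

(** Off the closed support [f] vanishes on a neighbourhood, hence so does its derivative. This
    stability lets bounds on test functions be applied to the entries of [grad f]. *)
Lemma partial_test_function i f : test_function f -> test_function (partial i f).
Proof.
move=> [sf cf]; split.
  by move=> s x; have := sf (rcons s i) x; rewrite foldr_rcons.
apply: (subclosed_compact _ cf); first exact: closed_closure.
rewrite closureE; apply: smallest_sub; first exact: closed_closure.
move=> x /=; apply: contraNP => nx; apply/eqP.
have nf : \forall y \near x, f y = (cst 0 : E -> R) y.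
  have : open (~` closure [set x | f x != 0]).
    by apply: closed_openC; exact: closed_closure.
  rewrite openE => /(_ x nx); apply: filterS => y ny /=; apply/eqP.
  by apply: contraT => fy; case: ny; apply: subset_closure.
by rewrite /partial (near_eq_derive _ nf) derive_cst.
Qed.

Lemma test_differentiable f x : test_function f -> differentiable f x.
Proof. by move=> [/(_ [::])]. Qed.

Lemma test_continuous f : test_function f -> continuous f.
Proof. by move=> tf x; apply: differentiable_continuous; exact: test_differentiable. Qed.

Lemma test_bounded f : test_function f ->
  exists2 c, 0 <= c & forall x, `|f x| <= c.
Proof.
move=> tf; have [_ cK] := tf.
have /compact_bounded[c [_ hc]] : compact (f @` closure [set x | f x != 0]).
  apply: continuous_compact cK; apply: continuous_subspaceT.
  exact: test_continuous.
exists (`|c| + 1); first by rewrite addr_ge0.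
move=> x; have [->|fx] := eqVneq (f x) 0; first by rewrite normr0 addr_ge0.
apply: hc; first by rewrite ltr_pwDr// ler_norm.
by exists x => //; exact: subset_closure.
Qed.

Lemma grad_bounded f : test_function f ->
  exists2 c, 0 <= c & forall x, enorm (grad f x) <= c.
Proof.
move=> tf.
have /choice[c hc] : forall i, exists c, forall x, `|partial i f x| <= c.
  by move=> i; have [c _ hc] := test_bounded (partial_test_function i tf); exists c.
pose C := \sum_i `|c i|.
exists (n%:R * C); first by rewrite mulr_ge0// sumr_ge0.
move=> x; apply: enorm_le_coord => i; rewrite mxE.
apply: (le_trans (hc i x)); rewrite /C (bigD1 i)//=.
by rewrite -[leLHS]addr0 lerD ?ler_norm// sumr_ge0.
Qed.

Lemma test_lipschitz f : test_function f ->
  exists2 c, 0 <= c & forall x y, `|f x - f y| <= c * edist x y.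
Proof.
move=> tf; have [c c0 hc] := grad_bounded tf; exists c => // x y.
have [t _] := mean_value y (x - y) (fun z => test_differentiable z tf).
rewrite (addrC y (x - y)) subrK => ->; apply: le_trans (dot_le_enorm _ _) _.
by rewrite ler_wpM2r ?enorm_ge0.
Qed.

Lemma grad_lipschitz f : test_function f ->
  exists2 c, 0 <= c & forall x y, edist (grad f x) (grad f y) <= c * edist x y.
Proof.
move=> tf.
have /choice[c hc] : forall i, exists c,
    forall x y, `|partial i f x - partial i f y| <= c * edist x y.
  by move=> i; have [c _ hc] := test_lipschitz (partial_test_function i tf); exists c.
pose C := \sum_i `|c i|.
exists (n%:R * C); first by rewrite mulr_ge0// sumr_ge0.
move=> x y; rewrite -mulrA; apply: enorm_le_coord => i; rewrite !mxE.
apply: (le_trans (hc i x y)); rewrite ler_wpM2r ?edist_ge0// /C (bigD1 i)//=.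
by rewrite -[leLHS]addr0 lerD ?ler_norm// sumr_ge0.
Qed.

Lemma grad_measurable f : test_function f -> measurable_fun [set: E] (grad f).
Proof.
move=> tf; apply/measurable_fun_rV => i; under eq_fun do rewrite mxE.
apply: continuous_rV_measurable; apply: test_continuous.
exact: partial_test_function.
Qed.

Definition truncate (r : R) v : E := \row_i Num.max (- r) (Num.min r (v 0 i)).

Lemma truncate_id r v : enorm v <= r -> truncate r v = v.
Proof.
move=> vr; apply/rowP => i; rewrite mxE.
have := le_trans (coord_le_enorm v i) vr; rewrite ler_norml => /andP[h1 h2].
by rewrite (min_idPr h2) (max_idPr h1).
Qed.

Lemma truncate_bounded r v : 0 <= r -> enorm (truncate r v) <= n%:R * r.
Proof.
move=> r0; apply: enorm_le_coord => i; rewrite mxE ler_norml.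
by rewrite le_max lexx/= ge_max ge_min lexx/= andbT; lra.
Qed.

Lemma truncate_lipschitz r v w :
  edist (truncate r v) (truncate r w) <= n%:R * edist v w.
Proof.
apply: enorm_le_coord => i; rewrite !mxE.
apply: le_trans (_ : `|v 0 i - w 0 i| <= _); last exact: coord_le_edist.
move: (v 0 i) (w 0 i) => a b; wlog ab : a b / b <= a => [h|].
  by case: (leP b a) => [/h//|/ltW/h]; rewrite distrC (distrC b).
rewrite (ger0_norm (_ : 0 <= a - b)) ?subr_ge0// ler_norml.
rewrite !minEle !maxEle; case: (leP r a) => ?; case: (leP r b) => ?;
  do ?[case: (leP (- r) _) => ?]; apply/andP; split; lra.
Qed.

Lemma truncate_measurable r : measurable_fun [set: E] (truncate r).
Proof.
apply/measurable_fun_rV => i; under eq_fun do rewrite mxE.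
apply: measurable_maxr => //; apply: measurable_minr => //.
exact: coord_measurable.
Qed.

(** The integrand of the equation with clipped velocities. Unlike [dot (grad f x) v] it is bounded
    and Lipschitz on all of T R^n, and the two agree when [enorm v <= r]. *)
Definition flux f (r : R) (p : E * E) : R := dot (grad f p.1) (truncate r p.2).

Lemma flux_measurable f r : test_function f -> measurable_fun [set: E * E] (flux f r).
Proof.
move=> tf; apply: dot_measurable.
  exact: (measurableT_comp (grad_measurable tf) measurable_fst).
exact: (measurableT_comp (truncate_measurable r) measurable_snd).
Qed.

Lemma flux_bounded f r : 0 <= r -> test_function f ->
  exists c, forall p, `|flux f r p| <= c.
Proof.
move=> r0 tf; have [c c0 hc] := grad_bounded tf; exists (c * (n%:R * r)) => p.
apply: le_trans (dot_le_enorm _ _) _.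
by apply: ler_pM; rewrite ?enorm_ge0// truncate_bounded.
Qed.

Lemma flux_lipschitz f r : 0 <= r -> test_function f ->
  exists2 L, 0 <= L & forall p q, `|flux f r p - flux f r q| <= L * tdist p q.
Proof.
move=> r0 tf; have [c c0 hc] := grad_bounded tf.
have [d d0 hd] := grad_lipschitz tf.
have nr0 : 0 <= n%:R * r by rewrite mulr_ge0.
exists (d * (n%:R * r) + c * n%:R); first by rewrite addr_ge0// mulr_ge0.
move=> p q.
have -> : flux f r p - flux f r q = dot (grad f p.1 - grad f q.1) (truncate r p.2) +
    dot (grad f q.1) (truncate r p.2 - truncate r q.2).
  by rewrite /flux dotDl dotDr (dotC (- _)) !dotNr (dotC _ (grad f q.1)); ring.
apply: le_trans (ler_normD _ _) _; rewrite mulrDl; apply: lerD.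
  apply: le_trans (dot_le_enorm _ _) _; rewrite mulrAC.
  apply: ler_pM; rewrite ?enorm_ge0 ?truncate_bounded//.
  apply: (le_trans (hd _ _)); rewrite ler_wpM2l//; exact: edist1_le_tdist.
apply: le_trans (dot_le_enorm _ _) _; rewrite -mulrA.
apply: ler_pM; rewrite ?enorm_ge0//.
apply: (le_trans (truncate_lipschitz _ _ _)); rewrite ler_wpM2l//.
exact: edist2_le_tdist.
Qed.

(** Mean value theorem along the segment, with two errors: the base point of [grad f] moves, which
    costs [d * r * r * t], and the travelled velocity [q] differs from [v], which costs
    [c * edist q v]. *)
Lemma transport_increment f r : test_function f -> 0 <= r ->
  exists2 c, 0 <= c & forall x v q (t : R), 0 <= t -> enorm q <= r ->
    enorm v <= r ->
    `|f (x + t *: q) - f x - t * flux f r (x, v)| <= c * t * (t + edist q v).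
Proof.
move=> tf r0; have [c c0 hc] := grad_bounded tf.
have [d d0 hd] := grad_lipschitz tf.
exists (d * r * r + c); first by rewrite addr_ge0// !mulr_ge0.
move=> x v q t t0 qr vr.
have [u /andP[u0 u1] ->] := mean_value x (t *: q) (fun z => test_differentiable z tf).
rewrite /flux /= truncate_id// dotZr -mulrBr normrM ger0_norm//.
rewrite [leRHS]mulrAC [leRHS]mulrC; apply: ler_wpM2l => //.
set y := x + _.
have -> : dot (grad f y) q - dot (grad f x) v =
    dot (grad f y - grad f x) q + dot (grad f x) (q - v).
  by rewrite dotDl dotDr (dotC (- _)) !dotNr (dotC _ (grad f x)); ring.
apply: le_trans (ler_normD _ _) _.
have h1 : `|dot (grad f y - grad f x) q| <= d * (t * r) * r.
  apply: le_trans (dot_le_enorm _ _) _.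
  apply: ler_pM; rewrite ?enorm_ge0//.
  apply: (le_trans (hd _ _)); rewrite ler_wpM2l//.
  rewrite /edist /y addrAC subrr add0r !enormZ !ger0_norm//.
  apply: (@le_trans _ _ (t * enorm q)); last by rewrite ler_wpM2l.
  by apply: ler_piMl; rewrite ?mulr_ge0 ?enorm_ge0.
have h2 : `|dot (grad f x) (q - v)| <= c * edist q v.
  apply: le_trans (dot_le_enorm _ _) _.
  by apply: ler_pM; rewrite ?enorm_ge0.
have h3 : 0 <= c * t by rewrite mulr_ge0.
have h4 : 0 <= d * r * r * edist q v by rewrite !mulr_ge0 ?edist_ge0.
rewrite [leRHS]mulrDl !mulrDr; lra.
Qed.

End test_functions.
(** * Lattice Approximate Solutions *)

(** The sets [F i] only have to cover the part of [B] inside [S], which carries all the mass. This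
    turns sums over bounded grids into measures of preimages. *)
Lemma measure_finite_partition d (T : measurableType d) (R : realType)
    (P : probability T R) (I : choiceType) (D : set I) (F : I -> set T)
    (S B : set T) :
  finite_set D -> trivIset D F -> (forall i, D i -> measurable (F i)) ->
  measurable B -> measurable S -> P (~` S) = 0%E ->
  (forall x, S x -> B x -> exists2 i, D i & F i x) ->
  P B = (\sum_(i \in D) P (F i `&` B))%E.
Proof.
move=> fD tF mF mB mS PS SF.
have mU : measurable (\bigcup_(i in D) (F i `&` B)).
  by apply: fin_bigcup_measurable => // i Di; apply: measurableI => //; exact: mF.
rewrite -measure_fin_bigcup//; last 2 first.
- move=> i j Di Dj [x [[Fx _] [Fx' _]]]; apply: (tF i j Di Dj).
  by exists x.
- by move=> i Di; apply: measurableI => //; exact: mF.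
apply/eqP; rewrite eq_le; apply/andP; split; last first.
  rewrite le_measure ?inE//.
  by move=> x [i Di []].
rewrite (measureDI P mB mU) [X in (_ + X)%E](_ : _ = P (\bigcup_(i in D) (F i `&` B))).
  rewrite [X in (X + _)%E](_ : _ = 0%E) ?add0e//.
  apply: subset_measure0 PS; [exact: measurableD|exact: measurableC|].
  move=> x [Bx nUx] Sx; have [i Di Fx] := SF x Sx Bx.
  by apply: nUx; exists i.
by congr (P _); apply/setIidr => x [i Di []].
Qed.

(** * Rounding to a lattice *)

Section quantization.
Context {R : realType} {n : nat}.
Local Notation E := 'rV[R]_n.
Implicit Types (x y a : E) (h b : R).

(** For [h > 0] this is the corner [a] of the half-open lattice cell [cell a h] containing [x];
    through it, sums over cells become image measures. *)
Definition quantize h x : E := \row_i ((Num.floor (x 0 i / h))%:~R * h).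

Lemma quantize_cell h x : 0 < h -> cell (quantize h x) h x.
Proof.
move=> h0 i; rewrite mxE; have /andP[h1 h2] := floor_itv (x 0 i / h).
split; first by rewrite -ler_pdivlMr.
by rewrite -[X in _ + X]mul1r -mulrDl -ltr_pdivrMr// -intrD1.
Qed.

Lemma quantize_unique h x a : 0 < h -> (forall i, exists z : int, a 0 i = z%:~R * h) ->
  cell a h x -> quantize h x = a.
Proof.
move=> h0 az cax; apply/rowP => i; rewrite mxE.
have [z az'] := az i; have := cax i; rewrite az' => -[h1 h2].
congr (_%:~R * _); apply: floor_def; rewrite ler_pdivlMr// h1 ltr_pdivrMr//.
by rewrite intrD1 mulrDl mul1r.
Qed.

Lemma quantize_lattice h x i : exists z : int, quantize h x 0 i = z%:~R * h.
Proof. by rewrite mxE; eexists. Qed.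

Lemma quantize_edist h x : 0 < h -> edist (quantize h x) x <= n%:R * h.
Proof.
move=> h0; apply: enorm_le_coord => i; have [h1 h2] := quantize_cell x h0 i.
move: h1 h2; rewrite !mxE => h1 h2; rewrite distrC ger0_norm ?subr_ge0//.
by rewrite lerBlDl ltW.
Qed.

Lemma quantize_enorm h x : 0 < h -> enorm (quantize h x) <= enorm x + n%:R * h.
Proof.
move=> h0; rewrite -[quantize h x](subrK x) addrC.
by apply: le_trans (ler_enormD _ _) _; rewrite lerD2l; exact: quantize_edist.
Qed.

Lemma quantize_measurable h : 0 <= h -> measurable_fun [set: E] (quantize h).
Proof.
(* The case [h = 0] does occur: the inverse of 0 is 0, and the image measures below are defined for
   [N = 0] too. *)
rewrite le_eqVlt => /predU1P[<-|h0]; apply/measurable_fun_rV => i; under eq_fun do rewrite mxE.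
  by under eq_fun do rewrite mulr0; exact: measurable_cst.
move=> _ A mA; rewrite setTI.
rewrite (_ : _ @^-1` A = \bigcup_(z : int)
    ([set x : E | z%:~R * h <= x 0 i < (z + 1)%:~R * h] `&` [set _ | A (z%:~R * h)])).
  apply: countable_bigcupT_measurable => // z; apply: measurableI.
    rewrite (_ : mkset _ = (fun x : E => x 0 i) @^-1` `[z%:~R * h, (z + 1)%:~R * h[).
      by rewrite -[X in measurable X]setTI; apply: coord_measurable.
    by apply/seteqP; split=> x; rewrite /= in_itv.
  have [Az|Az] := pselect (A (z%:~R * h)).
    by rewrite (_ : mkset _ = setT)//; apply/seteqP; split.
  by rewrite (_ : mkset _ = set0)//; apply/seteqP; split.
apply/seteqP; split=> x /=.
  move=> Ax; exists (Num.floor (x 0 i / h)) => //; split => //=.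
  by rewrite -ler_pdivlMr// -ltr_pdivrMr// floor_itv.
move=> [z _ /= []]; rewrite -ler_pdivlMr// -ltr_pdivrMr// => hz.
by rewrite (floor_def hz).
Qed.

Lemma grid_finite h b : 0 < h -> finite_set (grid h b : set E).
Proof.
move=> h0; pose K := (Num.truncn (`|b| / h)).+1.
pose g (f : {ffun 'I_n -> 'I_(K + K).+1}) : E :=
  \row_i (((f i)%:Z - K%:Z)%:~R * h).
apply: (sub_finite_set _ (finite_image g (finite_finset (X := setT)))).
move=> x gx.
have xz i : exists k : 'I_(K + K).+1, x 0 i = (k%:Z - K%:Z)%:~R * h.
  have [[z xz] xb] := gx i.
  have zK : `|z%:~R| < K%:R :> R.
    rewrite /K; apply: le_lt_trans (truncnS_gt _); rewrite ler_pdivlMr//.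
    by rewrite -[X in _ * X](gtr0_norm h0) -normrM -xz (le_trans xb)// ler_norm.
  have {}zK : (`|z| < K%:Z)%R by rewrite -(ltr_int R) intr_norm.
  have zK0 : (0 <= z + K%:Z)%R by lia.
  have kK : (absz (z + K%:Z)%R < (K + K).+1)%N by lia.
  exists (Ordinal kK) => /=; rewrite xz; congr (_%:~R * _).
  by rewrite gez0_abs// addrK.
exists [ffun i => projT1 (cid (xz i))] => //.
by apply/rowP => i; rewrite mxE ffunE; case: cid.
Qed.

Lemma set1_measurable x : measurable [set x].
Proof.
apply: closedrV_measurable; apply: compact_closed; first exact: norm_hausdorff.
exact: compact_set1.
Qed.

Lemma finite_rV_measurable (A : set E) : finite_set A -> measurable A.
Proof.
move=> fA; apply: countable_measurable; first exact: set1_measurable.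
exact: finite_set_countable.
Qed.

Lemma finite_rV_compact (A : set E) : finite_set A -> compact A.
Proof. exact: finite_compact. Qed.

Lemma cell_measurable h a : 0 < h -> measurable (cell a h).
Proof.
move=> h0; rewrite (_ : cell a h = \bigcap_(i in [set: 'I_n])
    ((fun x : E => x 0 i) @^-1` `[a 0 i, a 0 i + h[)).
  apply: fin_bigcap_measurable => // i _; rewrite -[X in measurable X]setTI.
  exact: coord_measurable.
apply/seteqP; split=> [x cx i _|x cx i]; first by rewrite /= in_itv/=; apply/andP; exact: cx.
by have := cx i I; rewrite /= in_itv/= => /andP[].
Qed.

End quantization.

(** * Lattice Approximate Solutions as image measures *)

Section las_construction.
Context {R : realType} {n : nat}.
Local Notation E := 'rV[R]_n.
Local Notation P := (probability E R).
Variable V : P -> probability (E * E)%type R.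

Definition las_map (N : nat) (t : R) (p : E * E) : E :=
  p.1 + t *: quantize N%:R^-1 p.2.

Lemma las_map_measurable N t : measurable_fun [set: E * E] (las_map N t).
Proof.
apply/measurable_fun_rV => i; under eq_fun do rewrite !mxE.
apply: measurable_funD.
  exact: (measurableT_comp (coord_measurable i) measurable_fst).
apply: measurable_funM => //.
have mq : measurable_fun [set: E] (quantize (N%:R^-1 : R)).
  by apply: quantize_measurable; rewrite invr_ge0.
have /measurable_fun_rV/(_ i) := measurableT_comp mq (@measurable_snd _ _ E E).
by under eq_fun do rewrite /= mxE.
Qed.

Lemma las_init_measurable N :
  measurable_fun [set: E] (quantize (N%:R ^- 2 : R)).
Proof. by apply: quantize_measurable; rewrite invr_ge0 exprn_ge0. Qed.

(** Image measures are probabilities for every [N], and coincide with the sums over grids once the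
    mass stays within the grids. *)
Fixpoint las_seq (mu0 : P) (N l : nat) : P :=
  if l is l'.+1 then
    law (V (las_seq mu0 N l')) (las_map_measurable N N%:R^-1)
  else law mu0 (las_init_measurable N).

Definition las (mu0 : P) (N : nat) (t : R) : P :=
  let l := Num.truncn (t * N%:R) in
  law (V (las_seq mu0 N l)) (las_map_measurable N (t - l%:R / N%:R)).

Hypothesis pvfV : is_pvf V.

Lemma pvf_fst (mu : P) A : measurable A -> V mu (fst @^-1` A) = mu A.
Proof. by move=> mA; have [_ /(_ mu A mA)] := pvfV. Qed.

Lemma las_seqE mu0 N l A : (0 < N)%N -> measurable A ->
  las mu0 N (l%:R / N%:R) A = las_seq mu0 N l A.
Proof.
move=> N0 mA; rewrite /las divfK ?pnatr_eq0 -?lt0n// natrK subrr lawE.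
rewrite -pvf_fst//; congr (V _ _); apply/seteqP.
by split=> p; rewrite /= /las_map scale0r addr0.
Qed.

Lemma las_stepE mu0 N l t A : (0 < N)%N -> 0 <= t <= N%:R^-1 -> measurable A ->
  las mu0 N (l%:R / N%:R + t) A = V (las mu0 N (l%:R / N%:R)) (las_map N t @^-1` A).
Proof.
move=> N0 /andP[t0 tN] mA; have Np : 0 < N%:R :> R by rewrite ltr0n.
have mG : measurable (las_map N t @^-1` A).
  by rewrite -[X in measurable X]setTI; exact: las_map_measurable.
(* At the node, [las] and [las_seq] agree on measurable sets but need not be equal terms; the first
   clause of [is_pvf] carries this agreement through [V]. *)
transitivity (V (las_seq mu0 N l) (las_map N t @^-1` A)); last first.
  have [+ _] := pvfV; apply => // B mB.
  exact/esym/las_seqE.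
(* At [t = 1 / N] the integer part in [las] has already moved to [l.+1]. *)
move: tN; rewrite le_eqVlt => /predU1P[tN|tN].
  have -> : l%:R / N%:R + t = l.+1%:R / N%:R.
    by rewrite tN -natr1 mulrDl mul1r.
  by rewrite las_seqE//= lawE tN.
rewrite /las.
have -> : Num.truncn ((l%:R / N%:R + t) * N%:R) = l.
  apply: truncn_def; rewrite mulrDl divfK ?gt_eqF//.
  have h1 : 0 <= t * N%:R by rewrite mulr_ge0// ltW.
  have h2 : t * N%:R < 1 by rewrite -ltr_pdivlMr// div1r.
  by rewrite -natr1; apply/andP; split; lra.
by rewrite lawE addrAC subrr add0r.
Qed.

Lemma las_initE mu0 N A : (0 < N)%N -> measurable A ->
  las mu0 N 0 A = mu0 (quantize (N%:R ^- 2) @^-1` A).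
Proof.
by move=> N0 mA; have := las_seqE mu0 0 N0 mA; rewrite mul0r.
Qed.

(** The mesh is at most 1, so [r + 1 <= N] leaves room for the corner of every cell that meets the
    ball of radius [r]. *)
Lemma las_init_sum (mu0 : P) N A (r : R) : (0 < N)%N -> measurable A ->
  mu0 (~` [set x | enorm x <= r]) = 0%E -> r + 1 <= N%:R ->
  las_init N mu0 A = mu0 (quantize (N%:R ^- 2) @^-1` A).
Proof.
move=> N0 mA mu0r rN; rewrite /las_init.
have h0 : 0 < N%:R ^- 2 :> R by rewrite invr_gt0 exprn_gt0// ltr0n.
have h1 : N%:R ^- 2 <= 1 :> R by rewrite invf_le1 ?exprn_gt0 ?ltr0n// exprn_ege1// ler1n.
have mQ : measurable (quantize (N%:R ^- 2) @^-1` A : set E).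
  by rewrite -[X in measurable X]setTI; exact: las_init_measurable.
rewrite (@measure_finite_partition _ _ _ mu0 _ (xgrid N)
  (fun x => cell x (N%:R ^- 2)) [set x | enorm x <= r])//.
- apply: eq_fsbigr => x /set_mem gx.
  have qx y : cell x (N%:R ^- 2) y -> quantize (N%:R ^- 2) y = x.
    by apply: quantize_unique => // i; have [] := gx i.
  have [Ax|Ax] := pselect (A x).
    rewrite diracE mem_set// mule1; congr (mu0 _).
    by apply/esym/setIidl => y /qx /= ->.
  rewrite diracE memNset// mule0 (_ : _ `&` _ = set0) ?measure0//.
  by apply/seteqP; split=> // y [/qx /= ->].
- exact: grid_finite.
- move=> x y gx gy [z [xz yz]].
  have ex := quantize_unique h0 (fun i => (gx i).1) xz.
  exact: (etrans (esym ex) (quantize_unique h0 (fun i => (gy i).1) yz)).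
- by move=> x _; exact: cell_measurable.
- by apply: closedrV_measurable; exact: eball_closed.
move=> x /= xr _; exists (quantize (N%:R ^- 2) x); last exact: quantize_cell.
move=> i; split; first exact: quantize_lattice.
have := quantize_cell x h0 i; have := le_trans (coord_le_enorm x i) xr.
rewrite !ler_norml => /andP[a1 a2] [a3 a4]; apply/andP; split; lra.
Qed.

(** The mass is split first by the position, which is exactly a grid point, then by the cell of the
    velocity; on each piece [las_map] is constant. *)
Lemma las_step_sum (mu : P) N t A (S : set E) (r : R) : (0 < N)%N -> measurable A ->
  measurable S -> S `<=` xgrid N -> r + 1 <= N%:R ->
  V mu (~` [set p | S p.1 /\ enorm p.2 <= r]) = 0%E ->
  las_step V N mu t A = V mu (las_map N t @^-1` A).
Proof.
move=> N0 mA mS SX rN VS; rewrite /las_step.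
have h0 : 0 < N%:R^-1 :> R by rewrite invr_gt0 ltr0n.
have h1 : N%:R^-1 <= 1 :> R by rewrite invf_le1 ?ltr0n// ler1n.
have h2 : 0 < N%:R^-2 :> R by rewrite invr_gt0 exprn_gt0// ltr0n.
have mG : measurable (las_map N t @^-1` A).
  by rewrite -[X in measurable X]setTI; exact: las_map_measurable.
have mT : measurable [set p : E * E | S p.1 /\ enorm p.2 <= r].
  rewrite (_ : mkset _ = S `*` [set v | enorm v <= r])//.
  by apply: measurableX => //; apply: closedrV_measurable; exact: eball_closed.
rewrite (@measure_finite_partition _ _ _ (V mu) _ (xgrid N)
  (fun x => [set x] `*` setT) [set p | S p.1 /\ enorm p.2 <= r])//.
- apply: eq_fsbigr => x /set_mem gx.
  rewrite [in RHS](@measure_finite_partition _ _ _ (V mu) _ (vgrid N)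
    (fun v => setT `*` cell v N%:R^-1) [set p | S p.1 /\ enorm p.2 <= r])//.
  + apply: eq_fsbigr => v /set_mem gv.
    have qv y : cell v N%:R^-1 y -> quantize N%:R^-1 y = v.
      by apply: quantize_unique => // i; have [] := gv i.
    have [Ax|Ax] := pselect (A (x + t *: v)).
      rewrite diracE mem_set// mule1; congr (V mu _).
      apply/seteqP; split=> [[y w]/= [-> vw]|[y w]/= [[_ vw] [[-> _] _]]]//.
      by rewrite /las_map /= (qv _ vw).
    rewrite diracE memNset// mule0 (_ : _ `&` _ = set0) ?measure0//.
    apply/seteqP; split=> // -[y w] /= [[_ vw] [[-> _]]].
    by rewrite /las_map /= (qv _ vw).
  + exact: grid_finite.
  + move=> x1 y gx1 gy [[z w] [[_ xz] [_ yz]]].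
    have ex := quantize_unique h0 (fun i => (gx1 i).1) xz.
    exact: (etrans (esym ex) (quantize_unique h0 (fun i => (gy i).1) yz)).
  + by move=> v _; apply: measurableX => //; exact: cell_measurable.
  + by apply: measurableI => //; apply: measurableX => //; exact: set1_measurable.
  + move=> [y w] /= [_ wr] _; exists (quantize N%:R^-1 w); last first.
      by split => //; exact: quantize_cell.
    move=> i; split; first exact: quantize_lattice.
    have := quantize_cell w h0 i; have := le_trans (coord_le_enorm w i) wr.
    rewrite !ler_norml => /andP[a1 a2] [a3 a4]; apply/andP; split; lra.
- exact: grid_finite.
- by move=> x y gx gy [[z w] [[/= <- _] [/= <- _]]].
- by move=> x _; apply: measurableX => //; exact: set1_measurable.
by move=> [x v] /= [Sx _] _; exists x => //; exact: SX.
Qed.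

End las_construction.

(** * Growth of the supports: a discrete Gronwall estimate *)

Section concentration.
Context {R : realType} {n : nat}.
Local Notation E := 'rV[R]_n.
Local Notation P := (probability E R).
Variables (V : P -> probability (E * E)%type R) (C : R).
Hypothesis pvfV : is_pvf V.
Hypothesis C0 : 0 < C.
Hypothesis sublinV : support_sublinear C V.

Lemma concentrated_Pc (mu : P) (S : set E) : compact S -> mu (~` S) = 0%E -> Pc mu.
Proof.
move=> cS mu0; suff : compact (msupport mu) by [].
apply: (subclosed_compact _ cS); first exact: msupport_closed.
by apply: msupport_sub => //; apply: compact_closed => //; exact: norm_hausdorff.
Qed.

Lemma velocity_bound (mu : P) (r : R) : Pc mu ->
  msupport mu `<=` [set x | enorm x <= r] ->
  V mu (~` [set p | enorm p.2 <= C * (1 + r)]) = 0%E.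
Proof.
move=> cmu mur; apply: msupportC_null2.
  apply: closed_openC.
  rewrite (_ : mkset _ = snd @^-1` [set v : E | enorm v <= C * (1 + r)])//.
  by apply: closed_comp => [p _|]; [exact: cvg_snd|exact: eball_closed].
apply/seteqP; split=> // p [/= np mp]; apply: np.
rewrite -lee_fin; apply: (@le_trans _ _
  (C%:E * (1 + ereal_sup [set (enorm x)%:E | x in msupport mu]))%E).
  by apply: le_trans (sublinV cmu); apply: ereal_sup_ubound; exists p.
rewrite EFinM; apply: lee_wpmul2l; first by rewrite lee_fin ltW.
rewrite EFinD; apply: leeD2l.
by apply: ge_ereal_sup => _ [x /mur xr <-]; rewrite lee_fin.
Qed.

Lemma concentrated_velocity (mu : P) (S : set E) (r : R) : compact S ->
  measurable S -> mu (~` S) = 0%E -> S `<=` [set x | enorm x <= r] ->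
  V mu (~` [set p | S p.1 /\ enorm p.2 <= C * (1 + r)]) = 0%E.
Proof.
move=> cS mS mu0 Sr; have cmu := concentrated_Pc cS mu0.
have supS : msupport mu `<=` S.
  by apply: msupport_sub => //; apply: compact_closed => //; exact: norm_hausdorff.
have m1 : measurable (fst @^-1` (~` S) : set (E * E)).
  by rewrite -[X in measurable X]setTI; apply: measurable_fst => //; exact: measurableC.
have m2 : measurable (~` [set p : E * E | enorm p.2 <= C * (1 + r)]).
  apply: measurableC.
  rewrite (_ : mkset _ = snd @^-1` [set v : E | enorm v <= C * (1 + r)])//.
  rewrite -[X in measurable X]setTI; apply: measurable_snd => //.
  by apply: closedrV_measurable; exact: eball_closed.
rewrite (_ : ~` _ = (fst @^-1` (~` S)) `|` ~` [set p | enorm p.2 <= C * (1 + r)]); last first.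
  by apply/seteqP; split=> p /=; rewrite -not_andE.
apply/eqP; rewrite eq_le measure_ge0 andbT (le_trans (measureU2 _ _ _))//.
have h1 : V mu (fst @^-1` (~` S)) = 0%E by rewrite pvf_fst//; exact: measurableC.
have h2 := velocity_bound cmu (subset_trans supS Sr).
rewrite [X in (X + _)%E](_ : _ = 0%E); last exact: h1.
by rewrite [X in (_ + X)%E](_ : _ = 0%E) ?adde0//; exact: h2.
Qed.

Variables (T R0 : R) (mu0 : P).
Hypothesis T0 : 0 < T.
Hypothesis R00 : 0 <= R0.
Hypothesis cmu0 : Pc mu0.
Hypothesis mu0R : msupport mu0 `<=` [set x | enorm x <= R0].

(** Gronwall bound at node [l]: the exponential dominates the growth by [1 + C / N] per step,
    [n / N] covers the rounding of the initial datum, and each step adds [n / N^2] for the rounding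
    of the velocity. *)
Definition las_radius (N l : nat) : R :=
  expR (C * (l%:R / N%:R)) *
    (1 + R0 + n%:R / N%:R + l%:R * (n%:R * N%:R ^- 2)) - 1.

Definition las_speed (N : nat) : R :=
  C * (expR (C * T) * (1 + R0 + n%:R * (1 + T) / N%:R)) + n%:R / N%:R.

(** Makes the radius reached by time [T] at most [N] and the velocities at most [N - 1]; the spare
    unit holds a velocity cell. *)
Definition fine_enough (N : nat) : Prop := (0 < N)%N /\
  expR (C * T) * (1 + R0 + n%:R * (1 + T)) +
    C * (expR (C * T) * (1 + R0 + n%:R * (1 + T))) + n%:R + 1 <= N%:R.

(** Write [1 + las_radius] as [a * b]. A step multiplies it by at most [1 + C * h <= expR (C * h)],
    and the new rounding term only grows when multiplied by [a * e], which is at least 1. *)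
Lemma las_radius_step N l : (0 < N)%N ->
  las_radius N l + N%:R^-1 * (C * (1 + las_radius N l) + n%:R * N%:R^-1) <=
  las_radius N l.+1.
Proof.
move=> N0; have Np : 0 < N%:R :> R by rewrite ltr0n.
rewrite /las_radius -!exprVn; set h := (N%:R)^-1.
have h0 : 0 < h by rewrite invr_gt0.
have -> : C * (l.+1%:R * h) = C * (l%:R * h) + C * h.
  by rewrite -natr1; ring.
rewrite expRD -[l.+1%:R]natr1.
set a := expR (C * (l%:R * h)).
have h0' := ltW h0; have C0' := ltW C0.
have a1 : 1 <= a by rewrite -expR0 ler_expR !mulr_ge0.
have e1 : 1 + C * h <= expR (C * h) by exact: expR_ge1Dx.
set e := expR (C * h).
have nh : 0 <= n%:R * h ^+ 2 by rewrite mulr_ge0// exprn_ge0.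
set b := 1 + R0 + n%:R * h + l%:R * (n%:R * h ^+ 2).
have b0 : 0 <= b by rewrite !addr_ge0 ?mulr_ge0 ?exprn_ge0.
have ab0 : 0 <= a * b by rewrite mulr_ge0// (le_trans _ a1).
have Ch : 0 <= C * h by rewrite mulr_ge0.
have s1 : a * b + C * h * (a * b) <= e * (a * b).
  by rewrite -[X in X + _]mul1r -mulrDl ler_wpM2r.
have ea : 1 <= a * e.
  by rewrite -[leLHS]mul1r ler_pM// (le_trans _ e1)// lerDl.
have s2 : n%:R * h ^+ 2 <= a * e * (n%:R * h ^+ 2) by rewrite ler_peMl.
have -> : 1 + R0 + n%:R * h + (l%:R + 1) * (n%:R * h ^+ 2) = b + n%:R * h ^+ 2.
  by rewrite /b; ring.
have -> : 1 + (a * b - 1) = a * b by ring.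
move: s1 s2; clearbody a b e; lra.
Qed.

Lemma las_radius_bound N l : fine_enough N -> l%:R / N%:R <= T ->
  [/\ 1 + las_radius N l <= expR (C * T) * (1 + R0 + n%:R * (1 + T) / N%:R),
      las_radius N l <= N%:R, C * (1 + las_radius N l) + 1 <= N%:R &
      C * (1 + las_radius N l) + n%:R / N%:R <= las_speed N].
Proof.
move=> [N0 Nbig] lT; have Np : 0 < N%:R :> R by rewrite ltr0n.
have N1 : 1 <= N%:R :> R by rewrite ler1n.
have lN : 0 <= l%:R / N%:R :> R by rewrite divr_ge0.
have nN : 0 <= n%:R / N%:R :> R by rewrite divr_ge0.
have b1 : 1 + las_radius N l <= expR (C * T) * (1 + R0 + n%:R * (1 + T) / N%:R).
  rewrite /las_radius addrC subrK; apply: ler_pM; rewrite ?expR_ge0//.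
  - rewrite !addr_ge0 ?mulr_ge0 ?exprn_ge0// ?invr_ge0// exprn_ge0//.
  - by rewrite ler_expR ler_wpM2l// ltW.
  rewrite -addrA lerD2l.
  have -> : n%:R / N%:R + l%:R * (n%:R * N%:R ^- 2) =
      n%:R / N%:R * (1 + l%:R / N%:R) :> R.
    by field; rewrite gt_eqF.
  by rewrite [leRHS]mulrAC ler_wpM2l// lerD2l.
have b2 : n%:R * (1 + T) / N%:R <= n%:R * (1 + T).
  by rewrite ler_pdivrMr// ler_peMr// mulr_ge0// addr_ge0// ltW.
have b3 : expR (C * T) * (1 + R0 + n%:R * (1 + T) / N%:R) <=
    expR (C * T) * (1 + R0 + n%:R * (1 + T)).
  by rewrite ler_wpM2l ?expR_ge0// lerD2l.
have b4 := ler_wpM2l (ltW C0) b1; have b5 := ler_wpM2l (ltW C0) b3.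
have n0 : 0 <= n%:R :> R by [].
have pos : 0 <= expR (C * T) * (1 + R0 + n%:R * (1 + T)).
  by rewrite mulr_ge0 ?expR_ge0// !addr_ge0// mulr_ge0// addr_ge0// ltW.
have pos' := mulr_ge0 (ltW C0) pos.
split => //; rewrite /las_speed; lra.
Qed.

Definition las_support N l : set E :=
  xgrid N `&` [set x | enorm x <= las_radius N l].

Lemma las_support_finite N l : (0 < N)%N -> finite_set (las_support N l).
Proof.
move=> N0; apply: (sub_finite_set (@subIsetl _ _ _)); apply: grid_finite.
by rewrite invr_gt0 exprn_gt0// ltr0n.
Qed.

Lemma las_support_velocity N l : (0 < N)%N ->
  las_seq V mu0 N l (~` las_support N l) = 0%E ->
  V (las_seq V mu0 N l) (~` [set p | las_support N l p.1 /\
    enorm p.2 <= C * (1 + las_radius N l)]) = 0%E.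
Proof.
move=> N0 h; have fS := @las_support_finite N l N0.
apply: concentrated_velocity h _;
  [exact: finite_rV_compact|exact: finite_rV_measurable|by move=> x []].
Qed.

(** The two meshes fit: in time [1 / N], a velocity in the lattice of mesh [1 / N] produces a shift
    in the lattice of mesh [1 / N^2], so positions remain grid points. *)
Lemma las_support_step N l p : fine_enough N -> l.+1%:R / N%:R <= T ->
  las_support N l p.1 -> enorm p.2 <= C * (1 + las_radius N l) ->
  las_support N l.+1 (las_map N N%:R^-1 p).
Proof.
move=> bN lT [gp rp] vp; have [N0 _] := bN; have Np : 0 < N%:R :> R by rewrite ltr0n.
have h0 : 0 < N%:R^-1 :> R by rewrite invr_gt0.
have ry : enorm (las_map N N%:R^-1 p) <= las_radius N l.+1.
  apply: le_trans (las_radius_step l N0).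
  apply: le_trans (ler_enormD _ _) _; apply: lerD => //.
  rewrite enormZ gtr0_norm//; apply: ler_wpM2l; first exact: ltW.
  by apply: le_trans (quantize_enorm _ h0) _; rewrite lerD2r.
have [_ rN _ _] := las_radius_bound bN lT.
split => // i; split; last first.
  exact: (le_trans (coord_le_enorm _ i) (le_trans ry rN)).
have [[z pz] _] := gp i; have [z' qz] := quantize_lattice N%:R^-1 p.2 i.
exists (z + z'); rewrite /las_map 2!mxE pz qz intrD mulrDl.
by congr (_ + _); rewrite mulrCA -expr2 exprVn.
Qed.

Lemma las_seq_concentrated N l : fine_enough N -> l%:R / N%:R <= T ->
  las_seq V mu0 N l (~` las_support N l) = 0%E.
Proof.
move=> bN; have [N0 _] := bN; have Np : 0 < N%:R :> R by rewrite ltr0n.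
have mC l' : measurable (~` las_support N l').
  by apply: measurableC; apply: finite_rV_measurable; exact: las_support_finite.
elim: l => [|l ih] lT.
  have mb : measurable [set x : E | enorm x <= R0].
    by apply: closedrV_measurable; exact: eball_closed.
  rewrite /= lawE; apply: (@subset_measure0 _ _ _ mu0 _ (~` [set x | enorm x <= R0])).
  - by rewrite -[X in measurable X]setTI; exact: las_init_measurable.
  - exact: measurableC.
  - move=> x /= nq xR; apply: nq.
    have h0 : 0 < N%:R ^- 2 :> R by rewrite invr_gt0 exprn_gt0.
    have qr : enorm (quantize (N%:R ^- 2) x) <= las_radius N 0.
      apply: le_trans (quantize_enorm _ h0) _.
      rewrite /las_radius !mul0r mulr0 expR0 mul1r addr0.
      have : n%:R * N%:R ^- 2 <= n%:R / N%:R :> R.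
        rewrite ler_wpM2l// lef_pV2 ?posrE// ?exprn_gt0// -natrX ler_nat.
        by rewrite expnS expn1 leq_pmulr.
      lra.
    have [_ rN _ _] := las_radius_bound bN lT.
    split => // i; split; first exact: quantize_lattice.
    exact: (le_trans (coord_le_enorm _ i) (le_trans qr rN)).
  - apply: msupportC_null; first by apply: closed_openC; exact: eball_closed.
    by apply/seteqP; split=> // x [/= nx /mu0R].
have lT' : l%:R / N%:R <= T.
  by apply: le_trans lT; rewrite ler_pM2r ?invr_gt0// ler_nat.
have h := las_support_velocity N0 (ih lT').
suff : V (las_seq V mu0 N l) (las_map N N%:R^-1 @^-1` (~` las_support N l.+1)) = 0%E by [].
apply: subset_measure0 h.
- by rewrite -[X in measurable X]setTI; exact: las_map_measurable.
- have mS : measurable (las_support N l).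
    by apply: finite_rV_measurable; exact: las_support_finite.
  apply: measurableC; rewrite (_ : mkset _ = las_support N l `*`
    [set v | enorm v <= C * (1 + las_radius N l)])//.
  by apply: measurableX => //; apply: closedrV_measurable; exact: eball_closed.
by move=> p /= nG [Sp vp]; apply: nG; exact: las_support_step.
Qed.

Lemma las_concentrated N l : fine_enough N -> l%:R / N%:R <= T ->
  [/\ Pc (las V mu0 N (l%:R / N%:R)),
      las V mu0 N (l%:R / N%:R) (~` las_support N l) = 0%E &
      V (las V mu0 N (l%:R / N%:R)) (~` [set p | las_support N l p.1 /\
        enorm p.2 <= C * (1 + las_radius N l)]) = 0%E].
Proof.
move=> bN lT; have [N0 _] := bN; have fS := @las_support_finite N l N0.
have mS := finite_rV_measurable fS.
have h : las V mu0 N (l%:R / N%:R) (~` las_support N l) = 0%E.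
  rewrite las_seqE//; [exact: las_seq_concentrated|exact: measurableC].
split => //; first by apply: concentrated_Pc h; exact: finite_rV_compact.
by apply: concentrated_velocity h _ => //; [exact: finite_rV_compact|move=> x []].
Qed.

Lemma las_is_las N : fine_enough N -> is_las V T mu0 N (las V mu0 N).
Proof.
move=> bN; have [N0 Nbig] := bN; have Np : 0 < N%:R :> R by rewrite ltr0n.
have mX : measurable (xgrid N : set E).
  by apply: finite_rV_measurable; apply: grid_finite; rewrite invr_gt0 exprn_gt0.
split.
- move=> A mA; rewrite las_initE//; apply/esym; apply: (@las_init_sum _ _ _ _ _ R0) => //.
    apply: msupportC_null; first by apply: closed_openC; exact: eball_closed.
    by apply/seteqP; split=> // x [/= nx /mu0R].
  have e1 : 1 <= expR (C * T) by rewrite -expR0 ler_expR mulr_ge0// ltW.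
  have b0 : 0 <= n%:R * (1 + T) by rewrite mulr_ge0// addr_ge0// ltW.
  have e2 : 1 + R0 + n%:R * (1 + T) <= expR (C * T) * (1 + R0 + n%:R * (1 + T)).
    by rewrite ler_peMl// !addr_ge0.
  have e3 : 0 <= C * (expR (C * T) * (1 + R0 + n%:R * (1 + T))).
    by rewrite !mulr_ge0 ?expR_ge0 ?addr_ge0// ltW.
  have n0 : 0 <= n%:R :> R by [].
  lra.
- move=> l lT; have [_ h _] := las_concentrated bN lT.
  have fS := @las_support_finite N l N0; have mS := finite_rV_measurable fS.
  have hX : las V mu0 N (l%:R / N%:R) (~` xgrid N) = 0%E.
    apply: subset_measure0 h; [exact: measurableC|exact: measurableC|].
    by move=> x nx [].
  rewrite -(setCK (xgrid N)) probability_setC; last exact: measurableC.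
  by rewrite [X in (_ - X)%E](_ : _ = 0%E) ?sube0.
move=> l t /[dup] t01 /andP[t0 t1] lT A mA.
have lT' : l%:R / N%:R <= T by apply: le_trans lT; rewrite lerDl.
rewrite las_stepE//; apply/esym.
have [_ _ h] := las_concentrated bN lT'.
have [_ _ rN _] := las_radius_bound bN lT'.
apply: las_step_sum h => //; last by move=> x [].
by apply: finite_rV_measurable; exact: las_support_finite.
Qed.

End concentration.

Arguments las_radius {R} n C R0 N l.
Arguments las_speed {R} n C T R0 N.
Arguments fine_enough {R} n C T R0 N.

(** * Extending a random path by one time step *)

Section path_extension.
Context {R : realType} {n : nat}.
Local Notation E := 'rV[R]_n.
Implicit Types (v : E).

(** Time spent in [[t0, t0 + h]] up to [t]: adding [elapsed t0 h t *: v] to a path moves it during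
    that step only. *)
Definition elapsed (t0 h t : R) : R := Num.max 0 (Num.min h (t - t0)).

Lemma elapsed_before t0 h t : t <= t0 -> elapsed t0 h t = 0.
Proof.
by move=> tt0; apply/max_idPl; rewrite ge_min subr_le0 tt0 orbT.
Qed.

Lemma elapsed_during t0 h t : 0 <= t <= h -> elapsed t0 h (t0 + t) = t.
Proof.
move=> /andP[t_ge0 th]; rewrite /elapsed addrAC subrr add0r.
by rewrite (min_idPr th) (max_idPr t_ge0).
Qed.

Lemma elapsed_after t0 h t : 0 <= h -> t0 + h <= t -> elapsed t0 h t = h.
Proof.
move=> h0 ht; rewrite /elapsed (min_idPl _) ?(max_idPr h0)//.
by rewrite lerBrDl.
Qed.

Lemma elapsed_lipschitz t0 h s t : s <= t ->
  0 <= elapsed t0 h t - elapsed t0 h s <= t - s.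
Proof.
move=> st; rewrite /elapsed !maxEle !minEle.
case: (leP h (t - t0)) => ?; case: (leP h (s - t0)) => ?;
  case: (leP 0 h) => ?; case: (leP 0 (t - t0)) => ?; case: (leP 0 (s - t0)) => ?;
  apply/andP; split; lra.
Qed.

(** The old path rests after [t0] and the new term rests before, so the two speeds never add up and
    the constant stays [M]. *)
Lemma extend_lipschitz (M t0 h : R) (p : R -> E) v : lipschitz_path M p ->
  (forall t, t0 <= t -> p t = p t0) -> enorm v <= M ->
  lipschitz_path M (fun t => p t + elapsed t0 h t *: v).
Proof.
move=> lp pc vM; have M0 := le_trans (enorm_ge0 v) vM.
move=> t s; wlog st : t s / s <= t => [H|].
  by case: (leP s t) => [/H//|/ltW/H]; rewrite edistC distrC.
rewrite (ger0_norm (_ : 0 <= t - s)) ?subr_ge0//.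
have lp' x y : x <= y -> edist (p y) (p x) <= M * (y - x).
  by move=> xy; have := lp y x; rewrite ger0_norm ?subr_ge0.
rewrite /edist.
have -> : p t + elapsed t0 h t *: v - (p s + elapsed t0 h s *: v) =
    (p t - p s) + (elapsed t0 h t - elapsed t0 h s) *: v.
  by rewrite scalerBl opprD addrACA.
have evM x : 0 <= x -> enorm (x *: v) <= x * M.
  by move=> x0; rewrite enormZ ger0_norm// ler_wpM2l.
have [tt0|t0t] := leP t t0.
  rewrite !elapsed_before ?subrr ?scale0r ?addr0//; first exact: lp'.
  exact: le_trans tt0.
have /andP[e0 e1] := elapsed_lipschitz t0 h st.
have [t0s|st0] := leP t0 s.
  rewrite (pc t (ltW t0t)) (pc s t0s) subrr add0r.
  by apply: (le_trans (evM _ e0)); rewrite mulrC ler_wpM2l.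
have /andP[f0 f1] := elapsed_lipschitz t0 h (ltW t0t).
rewrite (pc t (ltW t0t)) [elapsed t0 h s]elapsed_before; last exact: ltW.
rewrite [elapsed t0 h t0]elapsed_before// in f0 f1.
apply: le_trans (ler_enormD _ _) _.
have := lp' _ _ (ltW st0); have := evM _ f0.
have := ler_wpM2r M0 f1; rewrite /edist; lra.
Qed.

(** A step of a Markov chain: a path sitting at [x] is continued with velocity [v] with probability
    [m x v / a x], where [a x] is the mass at [x]. By the last hypothesis these probabilities sum to
    1 where [a x] is positive. *)
Lemma extend_paths (s : seq (R * (R -> E))) (t0 h M : R) (gx gv : seq E)
    (m : E -> E -> R) :
  0 <= h -> all (fun p => 0 <= p.1) s -> uniq gx ->
  (forall p, p \in s -> 0 < p.1 -> p.2 t0 \in gx) ->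
  (forall p, p \in s -> 0 < p.1 -> lipschitz_path M p.2) ->
  (forall p, p \in s -> forall t, t0 <= t -> p.2 t = p.2 t0) ->
  (forall x v, 0 <= m x v) ->
  (forall x v, 0 < m x v -> v \in gv -> enorm v <= M) ->
  (forall x, x \in gx ->
    \sum_(v <- gv) m x v = \sum_(p <- s) p.1 * (p.2 t0 == x)%:R) ->
  exists s' : seq (R * (R -> E)),
  [/\ all (fun p => 0 <= p.1) s',
      forall p, p \in s' -> 0 < p.1 -> lipschitz_path M p.2 /\
        exists2 q, q \in s & 0 < q.1 /\ forall t, t <= t0 -> p.2 t = q.2 t,
      forall p, p \in s' -> forall t, t0 + h <= t -> p.2 t = p.2 (t0 + h),
      forall (A : set E) t, t <= t0 ->
        \sum_(p <- s') p.1 * `[< A (p.2 t) >]%:R =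
        \sum_(p <- s) p.1 * `[< A (p.2 t) >]%:R &
      forall (A : set E) t, 0 <= t <= h ->
        \sum_(p <- s') p.1 * `[< A (p.2 (t0 + t)) >]%:R =
        \sum_(x <- gx) \sum_(v <- gv) m x v * `[< A (x + t *: v) >]%:R].
Proof.
move=> h0 /allP s0 ugx sgx sM sc m0 mM am.
pose a x := \sum_(p <- s) p.1 * (p.2 t0 == x)%:R.
have a0 x : 0 <= a x.
  by rewrite /a big_seq sumr_ge0// => p ps; rewrite mulr_ge0// s0.
have ap p : p \in s -> 0 < p.1 -> 0 < a (p.2 t0).
  move=> ps p0; apply: (lt_le_trans p0).
  rewrite /a (big_rem p ps)/= eqxx mulr1 lerDl big_seq.
  by apply: sumr_ge0 => q /mem_rem qs; rewrite mulr_ge0// s0.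
exists [seq (p.1 * (m (p.2 t0) v / a (p.2 t0)),
             fun t => p.2 t + elapsed t0 h t *: v) | p <- s, v <- gv].
split.
- apply/allP => _ /allpairsP[[p v]/= [ps vg ->]] /=.
  by rewrite mulr_ge0 ?divr_ge0// s0.
- move=> _ /allpairsP[[p v]/= [ps vg ->]] /= w0.
  have p0 : 0 < p.1.
    rewrite lt_neqAle s0// andbT; apply/eqP => p0; move: w0.
    by rewrite -p0 mul0r ltxx.
  have mp : 0 < m (p.2 t0) v.
    rewrite lt_neqAle m0 andbT; apply/eqP => mp; move: w0.
    by rewrite -mp mul0r mulr0 ltxx.
  split.
    by apply: extend_lipschitz; [exact: sM|exact: sc|exact: mM mp vg].
  exists p => //; split => // t tt0.
  by rewrite elapsed_before// scale0r addr0.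
- move=> _ /allpairsP[[p v]/= [ps vg ->]] /= t ht.
  rewrite !elapsed_after// (sc p ps t) ?(sc p ps (t0 + h))//.
    by rewrite lerDl.
  by rewrite (le_trans _ ht)// lerDl.
- move=> A t tt0; rewrite big_allpairs_dep big_seq [RHS]big_seq.
  apply: eq_bigr => p ps /=.
  have [p0|p0] := eqVneq p.1 0.
    by rewrite p0 mul0r big1// => v _; rewrite !mul0r.
  have {}p0 : 0 < p.1 by rewrite lt_neqAle eq_sym p0 s0.
  have : \sum_(v <- gv) m (p.2 t0) v / a (p.2 t0) = 1.
    by rewrite -mulr_suml am ?sgx// divff// gt_eqF// ap.
  move=> sum1; rewrite -[RHS]mulr1 -sum1 mulr_sumr; apply: eq_bigr => v _.
  by rewrite elapsed_before// scale0r addr0 mulrAC.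
- move=> A t th; rewrite big_allpairs_dep.
  pose g x := \sum_(v <- gv) m x v / a x * `[< A (x + t *: v) >]%:R.
  transitivity (\sum_(p <- s) p.1 * g (p.2 t0)).
    rewrite big_seq [RHS]big_seq; apply: eq_bigr => p ps.
    rewrite mulr_sumr; apply: eq_bigr => v _ /=.
    rewrite elapsed_during// (sc p ps (t0 + t)) ?mulrA//.
    by rewrite lerDl; case/andP: th.
  transitivity (\sum_(x <- gx) a x * g x).
    under [RHS]eq_bigr do rewrite mulr_suml.
    rewrite exchange_big/=; rewrite big_seq [RHS]big_seq; apply: eq_bigr => p ps.
    have [p0|p0] := eqVneq p.1 0.
      by rewrite p0 mul0r big1// => v _; rewrite !mul0r.
    have {}p0 : 0 < p.1 by rewrite lt_neqAle eq_sym p0 s0.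
    rewrite (bigD1_seq (p.2 t0))/= ?sgx// eqxx mulr1 big1 ?addr0// => x xp.
    by rewrite eq_sym (negbTE xp) mulr0 mul0r.
  rewrite big_seq [RHS]big_seq; apply: eq_bigr => x xg.
  rewrite mulr_sumr big_seq [RHS]big_seq; apply: eq_bigr => v vg.
  (* Where no mass sits the quotient is 0 by convention, and the numbers [m x v] vanish as well,
     being nonnegative with zero sum. *)
  have [ax|ax] := eqVneq (a x) 0; last by rewrite mulrA mulrCA divff// mulr1.
  suff -> : m x v = 0 by rewrite !mul0r mulr0.
  have : \sum_(v <- gv) m x v = 0 by rewrite am.
  move=> /eqP; rewrite psumr_eq0// => /allP/(_ v vg) /=.
  by move/eqP.
Qed.

End path_extension.
Lemma dirac_asbool d (T : measurableType d) (R : realType) (x : T) (A : set T) :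
  (\d_x A = (`[< A x >]%:R)%:E :> \bar R)%E.
Proof.
rewrite diracE; case: asboolP => Ax; first by rewrite mem_set.
by rewrite memNset.
Qed.

(** * Lattice Approximate Solutions as laws of random paths *)

Section las_paths.
Context {R : realType} {n : nat}.
Local Notation E := 'rV[R]_n.
Local Notation P := (probability E R).

Definition xgrid_seq (N : nat) : seq E := finmap.enum_fset (fset_set (xgrid N : set E)).

Definition vgrid_seq (N : nat) : seq E := finmap.enum_fset (fset_set (vgrid N : set E)).

Definition cell_mass (V : P -> probability (E * E)%type R) (N : nat) (mu : P)
  (x v : E) : R := fine (V mu ([set x] `*` cell v N%:R^-1)).

Lemma mem_xgrid_seq N x : (0 < N)%N -> (x \in xgrid_seq N) = `[< (xgrid N : set E) x >].
Proof.
move=> N0; rewrite in_fset_set//; apply: grid_finite.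
by rewrite invr_gt0 exprn_gt0// ltr0n.
Qed.

Lemma las_step_seq (V : P -> probability (E * E)%type R) N mu t A : (0 < N)%N ->
  las_step V N mu t A = (\sum_(x <- xgrid_seq N) \sum_(v <- vgrid_seq N)
    cell_mass V N mu x v * `[< A (x + t *: v) >]%:R)%:E.
Proof.
move=> N0; have h0 : 0 < N%:R^-1 :> R by rewrite invr_gt0 ltr0n.
have h2 : 0 < N%:R^-2 :> R by rewrite invr_gt0 exprn_gt0// ltr0n.
rewrite /las_step fsbig_finite; last exact: grid_finite.
rewrite -sumEFin; apply: eq_bigr => x _.
rewrite fsbig_finite; last exact: grid_finite.
rewrite -sumEFin; apply: eq_bigr => v _.
rewrite dirac_asbool EFinM fineK// fin_num_measure//.
by apply: measurableX; [exact: set1_measurable|exact: cell_measurable].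
Qed.

Variables (V : P -> probability (E * E)%type R) (C : R).
Hypothesis pvfV : is_pvf V.
Hypothesis C0 : 0 < C.
Hypothesis sublinV : support_sublinear C V.
Variables (T R0 : R) (mu0 : P).
Hypothesis T0 : 0 < T.
Hypothesis R00 : 0 <= R0.
Hypothesis mu0R : msupport mu0 `<=` [set x | enorm x <= R0].

Let las := las V mu0.
Let speed := las_speed n C T R0.

(** A velocity cell of positive mass contains a velocity of norm at most [C * (1 + las_radius)], and
    its corner is within [n / N] of that velocity. *)
Lemma cell_mass_speed N l x v : fine_enough n C T R0 N -> l%:R / N%:R <= T ->
  0 < cell_mass V N (las N (l%:R / N%:R)) x v -> enorm v <= speed N.
Proof.
move=> bN lT; have [N0 _] := bN; have Np : 0 < N%:R :> R by rewrite ltr0n.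
have [_ _ Vc] := las_concentrated pvfV C0 sublinV T0 R00 mu0R bN lT.
have [_ _ _ rspeed] := las_radius_bound C0 T0 R00 bN lT.
have h0 : 0 < N%:R^-1 :> R by rewrite invr_gt0.
rewrite /cell_mass => mp; rewrite leNgt; apply/negP => vs; move: mp.
suff -> : V (las N (l%:R / N%:R)) ([set x] `*` cell v N%:R^-1) = 0%E by rewrite ltxx.
apply: subset_measure0 Vc.
- by apply: measurableX; [exact: set1_measurable|exact: cell_measurable].
- have mS : measurable (las_support C R0 N l : set E).
    by apply: finite_rV_measurable; exact: las_support_finite.
  apply: measurableC; rewrite (_ : mkset _ = las_support C R0 N l `*`
    [set v | enorm v <= C * (1 + las_radius n C R0 N l)])//.
  by apply: measurableX => //; apply: closedrV_measurable; exact: eball_closed.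
move=> [y w] /= [-> vw] [_ wr]; move: vs; rewrite ltNge => /negP; apply.
apply: le_trans rspeed.
rewrite -[v](subrK w) addrC; apply: le_trans (ler_enormD _ _) _.
apply: lerD => //; apply: enorm_le_coord => i; rewrite !mxE.
have [a1 a2] := vw i; rewrite distrC ger0_norm ?subr_ge0// lerBlDl.
exact: ltW.
Qed.

(** The paths represent the approximate solution up to time [L] and rest afterwards, as
    [extend_paths] requires. [S] bounds the starting points only; later positions follow from the
    speed. *)
Definition paths_of N (s : seq (R * (R -> E))) (L : R) (S : R) :=
  [/\ all (fun p => 0 <= p.1) s,
      forall p, p \in s -> 0 < p.1 ->
        lipschitz_path (speed N) p.2 /\ enorm (p.2 0) <= S,
      forall p, p \in s -> forall t, L <= t -> p.2 t = p.2 L &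
      forall t A, 0 <= t <= L -> measurable A ->
        las N t A = (\sum_(p <- s) p.1 * `[< A (p.2 t) >]%:R)%:E].

Lemma las_paths_init N : fine_enough n C T R0 N ->
  exists s, paths_of N s (0%:R / N%:R) (las_radius n C R0 N 0).
Proof.
move=> bN; have [N0 _] := bN; have Np : 0 < N%:R :> R by rewrite ltr0n.
have T0' : 0%:R / N%:R <= T by rewrite mul0r ltW.
have [_ Sc _] := las_concentrated pvfV C0 sublinV T0 R00 mu0R bN T0'.
have speed0 : 0 <= speed N.
  have e0 := expR_ge0 (C * T); rewrite /speed /las_speed addr_ge0 ?divr_ge0//.
  rewrite !mulr_ge0 ?(ltW C0)// !addr_ge0 ?divr_ge0// mulr_ge0// addr_ge0//.
  exact: ltW.
pose mu := las N (0%:R / N%:R).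
have mS : measurable (las_support C R0 N 0 : set E).
  by apply: finite_rV_measurable; exact: las_support_finite.
exists [seq (fine (mu [set x]), fun=> x) |
  x <- finmap.enum_fset (fset_set (las_support C R0 N 0 : set E))].
split.
- by apply/allP => _ /mapP[x _ ->] /=; rewrite fine_ge0.
- move=> _ /mapP[x xS ->] /= _; split.
    by move=> t s; rewrite /edist subrr enorm0 mulr_ge0.
  by move: xS; rewrite in_fset_set ?inE => [[]|]//; exact: las_support_finite.
- by move=> _ /mapP[x xS ->] /=.
move=> t A; rewrite mul0r => /andP[t0 t0'] mA.
have -> : t = 0%:R / N%:R by rewrite mul0r; apply/eqP; rewrite eq_le t0 t0'.
rewrite -/mu big_map/= -sumEFin.
rewrite (@measure_finite_partition _ _ _ mu _ (las_support C R0 N 0 : set E)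
  (fun x => [set x]) (las_support C R0 N 0))//.
- rewrite fsbig_finite; last exact: las_support_finite.
  apply: eq_bigr => x _; rewrite EFinM fineK; last first.
    by apply: fin_num_measure; exact: set1_measurable.
  case: asboolP => Ax.
    by rewrite mule1; congr (mu _); apply/setIidl => y ->.
  rewrite mule0 (_ : _ `&` _ = set0) ?measure0//.
  by apply/seteqP; split=> // y [->].
- exact: las_support_finite.
- by move=> x y _ _ [z [-> ->]].
- by move=> x _; exact: set1_measurable.
by move=> x Sx _; exists x.
Qed.

Lemma las_paths_step N l s S : fine_enough n C T R0 N -> l%:R / N%:R <= T ->
  paths_of N s (l%:R / N%:R) S ->
  exists s', paths_of N s' (l.+1%:R / N%:R) S.
Proof.
move=> bN lT [s0 sM sc slaw].
have [N0 _] := bN; have Np : 0 < N%:R :> R by rewrite ltr0n.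
have h0 : 0 < N%:R^-1 :> R by rewrite invr_gt0.
have [_ Sc Vc] := las_concentrated pvfV C0 sublinV T0 R00 mu0R bN lT.
have [_ _ rN _] := las_radius_bound C0 T0 R00 bN lT.
pose t0 : R := l%:R / N%:R; pose mu := las N t0.
have t00 : 0 <= t0 by rewrite divr_ge0.
have tl : 0 <= t0 <= t0 by rewrite t00 lexx.
have mS : measurable (las_support C R0 N l : set E).
  by apply: finite_rV_measurable; exact: las_support_finite.
have SX : (las_support C R0 N l : set E) `<=` xgrid N by move=> x [].
have step t A : 0 <= t <= N%:R^-1 -> measurable A -> las N (t0 + t) A =
    (\sum_(x <- xgrid_seq N) \sum_(v <- vgrid_seq N)
      cell_mass V N mu x v * `[< A (x + t *: v) >]%:R)%:E.
  move=> ht mA; rewrite /las las_stepE//.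
  by rewrite -(las_step_sum t N0 mA mS SX rN Vc) las_step_seq.
have := @extend_paths R n s t0 N%:R^-1 (speed N) (xgrid_seq N) (vgrid_seq N)
  (cell_mass V N mu).
case.
- exact: ltW.
- exact: s0.
- exact: finmap.fset_uniq.
(* A path of positive weight outside the grid would charge the complement of the grid, which is
   null. *)
- move=> p ps p0; rewrite mem_xgrid_seq//; apply/asboolP; apply: contrapT => np.
  have := slaw t0 (~` (xgrid N : set E)) tl.
  have mX : measurable (~` xgrid N : set E).
    apply: measurableC; apply: finite_rV_measurable; apply: grid_finite.
    by rewrite invr_gt0 exprn_gt0.
  rewrite (_ : las N t0 _ = 0%E); last first.
    apply: subset_measure0 Sc => //; first exact: measurableC.
    by move=> x nx /SX.
  move=> /(_ mX) => -[]; apply/eqP; rewrite lt_eqF// (big_rem p ps)/= asboolT//.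
  rewrite mulr1 ltr_wpDr// big_seq; apply: sumr_ge0 => q /mem_rem qs.
  by rewrite mulr_ge0//; move/allP : s0; exact.
- by move=> p ps p0; have [] := sM p ps p0.
- exact: sc.
- by move=> x v; rewrite fine_ge0.
- by move=> x v mp _; exact: (cell_mass_speed bN lT mp).
(* The mass at a grid point is the total mass of its velocity cells: the step formula at elapsed
   time 0, compared with the law of [s]. *)
- move=> x xg; have := slaw t0 [set x] tl (set1_measurable x).
  rewrite -[in LHS](addr0 t0) step ?lexx ?(ltW h0)//; last exact: set1_measurable.
  move=> -[]; rewrite (bigD1_seq x)//=; last exact: finmap.fset_uniq.
  rewrite [X in _ + X]big1 ?addr0; last first.
    move=> y yx; rewrite big1// => v _; rewrite asboolF ?mulr0//.
    by rewrite scale0r addr0 => /= yx'; move: yx; rewrite yx' eqxx.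
  under eq_bigr do rewrite scale0r addr0 asboolT// mulr1.
  move=> ->; apply: eq_bigr => p _; congr (_ * _%:R).
  by case: asboolP => [->|/eqP/negbTE ->]; rewrite ?eqxx.
have t01 : t0 + N%:R^-1 = l.+1%:R / N%:R.
  by rewrite /t0 -natr1 mulrDl mul1r.
move=> s' [s0' sM' sc' law1 law2]; exists s'; split => //.
- move=> p ps p0; have [lp [q qs [q0 pq]]] := sM' p ps p0; split => //.
  by rewrite pq//; have [] := sM q qs q0.
- by rewrite -t01.
move=> t A /andP[t_ge0 tl1] mA; have [tt0|t0t] := leP t t0.
  by rewrite law1// slaw// t_ge0 tt0.
have th : 0 <= t - t0 <= N%:R^-1.
  by rewrite subr_ge0 (ltW t0t)/= lerBlDl t01.
by have := step (t - t0) A th mA; rewrite -law2// addrC subrK.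
Qed.

(** The condition bears on [l.-1] so as to allow one node beyond [T]: the last step starts by time
    [T] and may end after it. *)
Lemma las_paths N l : fine_enough n C T R0 N -> l.-1%:R / N%:R <= T ->
  exists s, paths_of N s (l%:R / N%:R) (las_radius n C R0 N 0).
Proof.
move=> bN; elim: l => [_|l ih lT]; first exact: las_paths_init.
have [|s hs] := ih; last exact: las_paths_step hs.
apply: le_trans lT; rewrite ler_wpM2r ?invr_ge0// ler_nat.
exact: leq_pred.
Qed.

(* Freezing the paths outside of [0, T] makes them Lipschitz on the whole line. *)
Lemma las_frozen_paths N : fine_enough n C T R0 N ->
  exists s : seq (R * (R -> E)),
  [/\ all (fun p => 0 <= p.1) s, mass s = 1,
      forall p, p \in s -> 0 < p.1 -> lipschitz_path (speed N) p.2 /\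
        forall t, enorm (p.2 t) <= las_radius n C R0 N 0 + speed N * T &
      forall t A, 0 <= t <= T -> measurable A ->
        las N t A = (\sum_(p <- s) p.1 * `[< A (p.2 t) >]%:R)%:E].
Proof.
move=> bN; have [N0 _] := bN; have Np : 0 < N%:R :> R by rewrite ltr0n.
have TN0 : 0 <= T * N%:R by rewrite mulr_ge0 ?ltW.
(* [k / N] is the last node not after [T]; the paths are built up to node [k.+1] so as to cover
   [[0, T]]. *)
have /andP[k1 k2] := truncn_itv TN0; set k := Num.truncn _ in k1 k2.
have [|s [s0 sM _ slaw]] := @las_paths N k.+1 bN.
  by rewrite ler_pdivrMr.
have Tk : T <= k.+1%:R / N%:R by rewrite ler_pdivlMr// ltW.
pose fr t := Num.max 0 (Num.min T t).
have frid t : 0 <= t <= T -> fr t = t.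
  by move=> /andP[t0 tT]; rewrite /fr (min_idPr tT) (max_idPr t0).
have frT t : 0 <= fr t <= T.
  by rewrite /fr le_max lexx/= ge_max ge_min lexx/= (ltW T0).
have frlip t t' : `|fr t - fr t'| <= `|t - t'|.
  wlog tt' : t t' / t' <= t => [H|].
    by case: (leP t' t) => [/H//|/ltW/H]; rewrite distrC (distrC t').
  have /andP[e0 e1] := @elapsed_lipschitz R 0 T t' t tt'.
  rewrite (ger0_norm (_ : 0 <= t - t')) ?subr_ge0// ger0_norm.
    by move: e1; rewrite /elapsed !subr0.
  by move: e0; rewrite /elapsed !subr0.
exists [seq (p.1, p.2 \o fr) | p <- s]; split.
- by rewrite all_map; apply: sub_all s0.
- rewrite /mass big_map/=; apply: EFin_inj.
  have k0 : 0 <= (0 : R) <= k.+1%:R / N%:R by rewrite lexx divr_ge0.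
  have := slaw 0 setT k0 measurableT.
  rewrite probability_setT => ->; congr (_%:E); apply: eq_bigr => p _.
  by rewrite asboolT// mulr1.
- move=> _ /mapP[p ps ->] /= p0; have [lp p00] := sM p ps p0.
  have sp0 : 0 <= speed N.
    by have := le_trans (edist_ge0 _ _) (lp 1 0); rewrite subr0 normr1 mulr1.
  split=> [t t'|t].
    by apply: le_trans (lp _ _) _; rewrite ler_wpM2l.
  have /andP[f0 f1] := frT t.
  rewrite -[p.2 _](subrK (p.2 0)) addrC; apply: le_trans (ler_enormD _ _) _.
  apply: lerD => //; apply: le_trans (lp _ _) _.
  by rewrite ler_wpM2l// subr0 ger0_norm.
move=> t A tT mA; have /andP[t0 tT'] := tT.
rewrite slaw ?t0 ?(le_trans tT')// big_map/=.
by congr (_%:E); apply: eq_bigr => p _; rewrite frid.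
Qed.

End las_paths.
(** * The equation in the limit *)

Section telescoping.
Context {R : realType}.
Variables (J : R -> R) (h e T t eta : R).
Hypothesis h0 : 0 < h.
Hypothesis e0 : 0 <= e.
Hypothesis h_eta : h <= eta.
Hypothesis stepJ : forall (l : nat) u, 0 <= u <= h -> l%:R * h + u <= T ->
  `|l%:R * h - t| <= eta + eta -> `|J (l%:R * h + u) - J (l%:R * h)| <= e * u.

Let near_t x : t - (eta + eta) <= x -> x <= t + (eta + eta) ->
  `|x - t| <= eta + eta.
Proof. by move=> x1 x2; rewrite ler_norml; apply/andP; split; lra. Qed.

Let chainJ (l q : nat) : (l + q)%:R * h <= T -> t - (eta + eta) <= l%:R * h ->
  (l + q)%:R * h <= t + (eta + eta) ->
  `|J ((l + q)%:R * h) - J (l%:R * h)| <= e * (q%:R * h).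
Proof.
elim: q => [|q ih] lqT lt lqt; first by rewrite addn0 subrr normr0 mul0r mulr0.
have lqE : (l + q.+1)%:R * h = (l + q)%:R * h + h.
  by rewrite addnS -natr1 mulrDl mul1r.
have lql : l%:R * h <= (l + q)%:R * h by rewrite ler_pM2r// ler_nat leq_addr.
rewrite lqE in lqT lqt *.
have lq0 : (l + q)%:R * h <= (l + q)%:R * h + h by rewrite lerDl ltW.
have step1 : `|J ((l + q)%:R * h + h) - J ((l + q)%:R * h)| <= e * h.
  apply: stepJ => //; first by rewrite lexx ltW.
  by apply: near_t; [exact: le_trans lt lql|exact: le_trans lq0 lqt].
have ih' := ih (le_trans lq0 lqT) lt (le_trans lq0 lqt).
have -> : J ((l + q)%:R * h + h) - J (l%:R * h) =
  (J ((l + q)%:R * h + h) - J ((l + q)%:R * h)) +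
  (J ((l + q)%:R * h) - J (l%:R * h)) by ring.
apply: le_trans (ler_normD _ _) _.
by rewrite -natr1 mulrDl mul1r mulrDr [leRHS]addrC lerD.
Qed.

Let stepJ' (l : nat) x : l%:R * h <= x -> x < l%:R * h + h -> x <= T ->
  t - (eta + eta) <= l%:R * h -> l%:R * h <= t + (eta + eta) ->
  `|J x - J (l%:R * h)| <= e * (x - l%:R * h).
Proof.
move=> lx xl xT l1 l2; have xE : x = l%:R * h + (x - l%:R * h) by ring.
rewrite [in J x]xE; apply: stepJ; rewrite -?xE//; last exact: near_t.
by rewrite subr_ge0 lx lerBlDl ltW.
Qed.

(** Whole steps add up exactly. Starting from the node before [s] costs [e * h] twice: in the length
    of the sum, and in the incomplete step to be subtracted. That node is within [h <= eta] of [s],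
    whence the window [eta + eta]. *)
Lemma telescoping s s' : 0 <= s -> s <= s' -> s' <= T -> t - eta <= s ->
  s' <= t + eta -> `|J s' - J s| <= e * (s' - s) + 2 * (e * h).
Proof.
move=> s0 ss' s'T ts s't.
have trunc u : 0 <= u -> exists l : nat, [/\ l = Num.truncn (u / h),
    l%:R * h <= u & u < l%:R * h + h].
  move=> u0; exists (Num.truncn (u / h)).
  have uN : 0 <= u / h by rewrite divr_ge0// ltW.
  have /andP[t1 t2] := truncn_itv uN; split => //.
    by rewrite -ler_pdivlMr.
  by rewrite -[X in _ + X]mul1r -mulrDl natr1 -ltr_pdivrMr.
have [l [lE l1 l2]] := trunc s s0.
have [l' [lE' l1' l2']] := trunc s' (le_trans s0 ss').
have ll' : (l <= l')%N.
  by rewrite lE lE'; apply: le_truncn; rewrite ler_pM2r// invr_gt0.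
have llh : l%:R * h <= l'%:R * h by rewrite ler_pM2r// ler_nat.
have A1 := stepJ' l1 l2 (le_trans ss' s'T).
have A2 := stepJ' l1' l2' s'T.
have A3 := @chainJ l (l' - l)%N; rewrite subnKC// natrB// mulrBl in A3.
have eta0 : 0 <= eta by exact: le_trans (ltW h0) h_eta.
have b1 : t - (eta + eta) <= l%:R * h.
  by have := h_eta; lra.
have b2 : l'%:R * h <= t + (eta + eta).
  by lra.
have {}A1 := A1 b1 (le_trans llh b2).
have {}A2 := A2 (le_trans b1 llh) b2.
have {}A3 := A3 (le_trans l1' s'T) b1 b2.
have -> : J s' - J s = (J s' - J (l'%:R * h)) + (J (l'%:R * h) - J (l%:R * h)) -
    (J s - J (l%:R * h)) by ring.
apply: le_trans (ler_normB _ _) _.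
apply: (le_trans (lerD (ler_normD _ _) (lexx _))).
have : e * (s - l%:R * h) <= e * h by apply: ler_wpM2l => //; lra.
move: A1 A2 A3; lra.
Qed.

End telescoping.

Section weak_solution.
Context {R : realType} {n : nat}.
Local Notation E := 'rV[R]_n.
Local Notation P := (probability E R).
Variables (V : P -> probability (E * E)%type R).
Hypothesis pvfV : is_pvf V.
Hypothesis contV : continuous_on_Pc V.
Variables (T K r : R) (mu : R -> P) (N : nat -> nat) (nu : nat -> R -> P).
Hypothesis T0 : 0 < T.
Hypothesis K0 : 0 <= K.
Hypothesis r0 : 0 <= r.
Hypothesis mu_Pc : forall t, Pc (mu t).
Hypothesis mu_speed : forall t, V (mu t) (~` [set p | enorm p.2 <= r]) = 0%E.
Hypothesis mu_lipschitz : forall t s, (W (mu t) (mu s) <= (K * `|t - s|)%:E)%E.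
Hypothesis nu_cvg : forall e : R, 0 < e -> exists m0, forall m, (m0 <= m)%N ->
  forall t s, 0 <= t <= T -> 0 <= s <= T ->
  (W (mu t) (nu m s) <= (e + K * `|t - s|)%:E)%E.
Hypothesis N_gt0 : forall m, (0 < N m)%N.
Hypothesis N_cvg : forall k, exists m0, forall m, (m0 <= m)%N -> (k <= N m)%N.
Hypothesis nu_Pc : forall m l, l%:R / (N m)%:R <= T -> Pc (nu m (l%:R / (N m)%:R)).
Hypothesis nu_speed : forall m l, l%:R / (N m)%:R <= T ->
  V (nu m (l%:R / (N m)%:R)) (~` [set p | enorm p.2 <= r]) = 0%E.
Hypothesis nu_step : forall m l t A, 0 <= t <= (N m)%:R^-1 ->
  l%:R / (N m)%:R + t <= T -> measurable A ->
  nu m (l%:R / (N m)%:R + t) A = V (nu m (l%:R / (N m)%:R)) (las_map (N m) t @^-1` A).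
Variable f : E -> R.
Hypothesis tf : test_function f.

Let F (p : E * E) := dot (grad f p.1) p.2.
(** Rounding adds at most [n / N <= n] to a velocity, so [rr] bounds both the velocities drawn from
    [V] and the rounded ones. *)
Let rr := r + n%:R.
Let rr0 : 0 <= rr. Proof. by rewrite addr_ge0. Qed.

Let mf : measurable_fun [set: E] f.
Proof. by apply: continuous_rV_measurable; exact: test_continuous. Qed.

Let mF : measurable_fun [set: E * E] F.
Proof.
apply: dot_measurable => //.
exact: (measurableT_comp (grad_measurable tf) measurable_fst).
Qed.

Let speed_ae (lam : probability (E * E)%type R) :
  lam (~` [set p | enorm p.2 <= r]) = 0%E ->
  {ae lam, forall p, enorm p.2 <= r}.
Proof.
move=> h; apply/negligibleP => //; apply: measurableC.
rewrite (_ : mkset _ = snd @^-1` [set v : E | enorm v <= r])//.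
rewrite -[X in measurable X]setTI; apply: measurable_snd => //.
by apply: closedrV_measurable; exact: eball_closed.
Qed.

Lemma flux_integral (lam : probability (E * E)%type R) :
  lam (~` [set p | enorm p.2 <= r]) = 0%E ->
  lam.-integrable setT (EFin \o F) /\
  \int[lam]_p F p = \int[lam]_p flux f rr p.
Proof.
move=> /speed_ae h.
have Ff : {ae lam, forall p, F p = flux f rr p}.
  apply: filterS h => p pr; rewrite /flux truncate_id//.
  by rewrite (le_trans pr)// lerDl.
have [c hc] := flux_bounded rr0 tf.
have c0 : 0 <= c by exact: le_trans (normr_ge0 _) (hc (0, 0)).
split.
  apply: (prob_ae_bounded c0 mF _).1.
  by apply: filterS Ff => p ->.
rewrite /Rintegral; congr fine; apply: ae_eq_integral => //.
- exact/measurable_EFinP.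
- by apply/measurable_EFinP; exact: flux_measurable.
by apply: filterS Ff => p -> _.
Qed.

Let Phi t := \int[V (mu t)]_p F p.
Let D t := \int[mu t]_x f x.

(** Continuity of [V] at the single point [mu t] makes [WT] small, and the truncated integrand,
    which agrees almost everywhere with [F], is bounded and Lipschitz. *)
Lemma flux_continuity t e : 0 < e -> exists2 dl : R, 0 < dl &
  forall lam, Pc lam -> V lam (~` [set p | enorm p.2 <= r]) = 0%E ->
    (W (mu t) lam < dl%:E)%E ->
    `|\int[V lam]_p F p - Phi t| <= e.
Proof.
move=> e0; have [c hc] := flux_bounded rr0 tf.
have [L L0 hL] := flux_lipschitz rr0 tf.
have e1 : 0 < e / (L + 1) by rewrite divr_gt0// ltr_wpDl.
have [_ /(_ (mu t) (@mu_Pc t) _ e1)[dl dl0 hdl]] := contV.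
exists dl => // lam clam slam Wlam.
rewrite /Phi (flux_integral slam).2 (flux_integral (mu_speed t)).2 distrC.
have := wasserstein_Rintegral (@tdist_measurable R n) (@tdist_ge0 R n)
  (flux_measurable rr tf) hc L0 hL (hdl lam clam Wlam).
move=> /le_trans; apply.
by rewrite mulrCA ger_pMr// ler_pdivrMr ?ltr_wpDl// mul1r lerDl.
Qed.

Let Phi_continuous : continuous Phi.
Proof.
move=> t; apply/cvgrPdist_le => e e0.
have [dl dl0 hdl] := flux_continuity t e0.
have : \forall s \near t, `|t - s| < dl / (K + 1).
  by apply: nbhsx_ballx; rewrite divr_gt0// ltr_wpDl.
apply: filterS => s hs; rewrite distrC; apply: hdl => //.
apply: le_lt_trans (mu_lipschitz t s) _; rewrite lte_fin.
move: hs; rewrite ltr_pdivlMr ?ltr_wpDl// => hs.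
have := normr_ge0 (t - s); rewrite mulrDr mulr1 in hs; lra.
Qed.

(** The factor [1 + n] comes from [transport_increment]: the elapsed time is at most [1 / N], the
    rounding error at most [n / N]. *)
Let step_increment : exists2 c, 0 <= c & forall m l t, 0 <= t <= (N m)%:R^-1 ->
  l%:R / (N m)%:R + t <= T ->
  `|\int[nu m (l%:R / (N m)%:R + t)]_x f x -
    \int[nu m (l%:R / (N m)%:R)]_x f x -
    t * \int[V (nu m (l%:R / (N m)%:R))]_p F p| <= c * t / (N m)%:R.
Proof.
have [c c0 hc] := transport_increment tf rr0.
exists (c * (1 + n%:R)); first by rewrite mulr_ge0// addr_ge0.
move=> m l t /[dup] tN /andP[t_ge0 t1] lT.
have Np : 0 < (N m)%:R :> R by rewrite ltr0n.
have h0 : 0 < (N m)%:R^-1 :> R by rewrite invr_gt0.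
have h1 : (N m)%:R^-1 <= 1 :> R by rewrite invf_le1// ler1n.
have lT' : l%:R / (N m)%:R <= T by apply: le_trans lT; rewrite lerDl.
set mul := nu m (l%:R / (N m)%:R).
have [b b0 hb] := test_bounded tf.
have sl := nu_speed lT'.
rewrite (flux_integral sl).2.
have -> : \int[nu m (l%:R / (N m)%:R + t)]_x f x =
    \int[V mul]_p f (las_map (N m) t p).
  rewrite -(law_Rintegral (V mul) (las_map_measurable (N m) t) mf hb).
  by apply: eq_Rintegral_measure => A mA; rewrite nu_step.
have -> : \int[mul]_x f x = \int[V mul]_p f p.1.
  rewrite -(law_Rintegral (V mul) measurable_fst mf hb).
  by apply: eq_Rintegral_measure => A mA; exact: (esym (pvf_fst pvfV mul mA)).
have m1 : measurable_fun [set: E * E] (fun p => f (las_map (N m) t p)).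
  exact: (measurableT_comp mf (las_map_measurable (N m) t)).
have m2 : measurable_fun [set: E * E] (fun p : E * E => f p.1).
  exact: (measurableT_comp mf measurable_fst).
have m3 := flux_measurable rr tf.
have [bf hbf] := flux_bounded rr0 tf.
have i1 := (prob_bounded (V mul) m1 (fun p => hb _)).1.
have i2 := (prob_bounded (V mul) m2 (fun p => hb _)).1.
have i3 := (prob_bounded (V mul) m3 hbf).1.
have m12 := measurable_funB m1 m2.
have i12 : (V mul).-integrable [set: E * E]
    (EFin \o (fun p => f (las_map (N m) t p) - f p.1)).
  apply: (prob_bounded (V mul) (c := b + b) m12 _).1 => p.
  by rewrite (le_trans (ler_normB _ _))// lerD.
have i3t : (V mul).-integrable [set: E * E] (EFin \o (fun p => t * flux f rr p)).
  apply: (prob_bounded (V mul) (c := `|t| * bf) _ _).1; first exact: measurable_funM.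
  by move=> p; rewrite normrM ler_wpM2l.
rewrite -RintegralB// -RintegralZl// -RintegralB//.
apply: (prob_ae_bounded _ _ _).2.
- by rewrite divr_ge0 ?(ltW Np)// !mulr_ge0// addr_ge0.
- by apply: measurable_funB => //; exact: measurable_funM.
apply: filterS (speed_ae sl) => -[x v] /= vr.
have qv := quantize_edist v h0.
have := hc x v (quantize (N m)%:R^-1 v) t t_ge0.
have rrr : r <= rr by rewrite lerDl.
have qr : enorm (quantize (N m)%:R^-1 v) <= rr.
  apply: (le_trans (quantize_enorm v h0)); apply: lerD => //.
  by rewrite ler_piMr.
move=> /(_ qr (le_trans vr rrr)) /le_trans; apply.
rewrite [leRHS]mulrAC -[leRHS]mulrA [leRHS]mulrC mulrAC.
have ct : 0 <= c * t by rewrite mulr_ge0.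
have : t + edist (quantize (N m)%:R^-1 v) v <= (1 + n%:R) * (N m)%:R^-1.
  by rewrite mulrDl mul1r lerD.
move=> /(ler_wpM2l ct); lra.
Qed.

Let nu_test_cvg s e : 0 <= s <= T -> 0 < e -> exists m0, forall m, (m0 <= m)%N ->
  `|D s - \int[nu m s]_x f x| <= e.
Proof.
move=> sT e0; have [c c0 hc] := test_lipschitz tf.
have [b b0 hb] := test_bounded tf.
have e1 : 0 < e / (c + 1) / 2 by rewrite !divr_gt0// ltr_wpDl.
have [m0 hm0] := nu_cvg e1; exists m0 => m /hm0/(_ s s sT sT).
rewrite subrr normr0 mulr0 addr0 => Ws.
have Ws' : (W (mu s) (nu m s) < (e / (c + 1))%:E)%E.
  apply: (le_lt_trans Ws); rewrite lte_fin.
  have : 0 < e / (c + 1) by rewrite divr_gt0// ltr_wpDl.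
  lra.
have := wasserstein_Rintegral (@edist_measurable_pair R n) (@edist_ge0 R n)
  mf hb c0 hc Ws'.
move=> /le_trans; apply.
by rewrite mulrCA ger_pMr// ler_pdivrMr ?ltr_wpDl// mul1r lerDl.
Qed.

(* Telescoping over the time steps between s and s': since each of them starts
   close to t, its increment is its length times Phi t, up to a small factor;
   the two incomplete steps at the ends disappear in the limit. *)
Let local_increment t e : 0 <= t <= T -> 0 < e -> exists2 eta : R, 0 < eta &
  forall s s', 0 <= s -> s <= s' -> s' <= T -> t - eta <= s -> s' <= t + eta ->
  `|D s' - D s - (s' - s) * Phi t| <= e * (s' - s).
Proof.
move=> tT e0; have e2 : 0 < e / 2 by rewrite divr_gt0.
have [dl dl0 hdl] := flux_continuity t e2.
(* The distance from [mu t] to the approximation at a node within [2 * eta] is at most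
   [dl / 4 + K * (2 * eta)], which this choice makes less than [dl]. *)
pose eta := dl / 4 / (K + 1).
have K1 : 0 < K + 1 by rewrite ltr_wpDl.
have eta0 : 0 < eta by rewrite !divr_gt0.
have Keta : K * (eta + eta) <= dl / 2.
  have : (K + 1) * eta = dl / 4 by rewrite /eta mulrC divfK// gt_eqF.
  lra.
exists eta => // s s' s_ge0 ss' s'T ts s't.
(* The slack [d] pays for what depends on [m], [d / 3] each: replacing the limit by an approximation
   at [s], the same at [s'], and the incomplete steps. *)
apply/ler_addgt0Pr => d d0.
have [c c0 hc] := step_increment.
have dl4 : 0 < dl / 4 by rewrite divr_gt0.
have [m1 hm1] := nu_cvg dl4.
(* The three terms ensure in turn [h <= eta], [c * h <= e / 2] and [2 * (e * h) <= d / 3] for the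
   time step [h]. *)
pose k := (Num.truncn (eta^-1 + 2 * c / e + 6 * e / d)).+1.
have [m2 hm2] := N_cvg k.
have d3 : 0 < d / 3 by rewrite divr_gt0.
have sT : 0 <= s <= T by rewrite s_ge0 (le_trans ss').
have s'T' : 0 <= s' <= T by rewrite s'T (le_trans s_ge0).
have [m3 hm3] := nu_test_cvg sT d3; have [m4 hm4] := nu_test_cvg s'T' d3.
pose m := maxn (maxn m1 m2) (maxn m3 m4).
have {}hm1 := hm1 m; have {}hm2 := hm2 m.
have {}hm3 : `|D s - \int[nu m s]_x f x| <= d / 3.
  by apply: hm3; rewrite /m !leq_max leqnn orbT.
have {}hm4 : `|D s' - \int[nu m s']_x f x| <= d / 3.
  by apply: hm4; rewrite /m !leq_max leqnn !orbT.
have {}hm1 : forall t0 s0, 0 <= t0 <= T -> 0 <= s0 <= T ->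
    (W (mu t0) (nu m s0) <= (dl / 4 + K * `|t0 - s0|)%:E)%E.
  by apply: hm1; rewrite /m !leq_max leqnn.
have {}hm2 : (k <= N m)%N by apply: hm2; rewrite /m !leq_max leqnn orbT.
clearbody m.
have Np : 0 < (N m)%:R :> R by rewrite ltr0n.
set h : R := (N m)%:R^-1; have h0 : 0 < h by rewrite invr_gt0.
have kN : eta^-1 + 2 * c / e + 6 * e / d <= (N m)%:R.
  apply: (le_trans (ltW (truncnS_gt _))).
  by rewrite ler_nat.
have p1 : 0 < eta^-1 by rewrite invr_gt0.
have p2 : 0 <= 2 * c / e by rewrite divr_ge0 ?mulr_ge0// ltW.
have p3 : 0 <= 6 * e / d by rewrite divr_ge0 ?mulr_ge0// ltW.
have h_eta : h <= eta.
  by rewrite /h invf_ple ?posrE//; lra.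
have h_c : c * h <= e / 2.
  rewrite ler_pdivrMr//; have : 2 * c / e <= (N m)%:R by lra.
  by rewrite ler_pdivrMr// ; lra.
have h_d : 2 * (e * h) <= d / 3.
  have : 6 * e / d <= (N m)%:R by lra.
  rewrite ler_pdivrMr// mulrA ler_pdivrMr//; lra.
(* Removing the drift [u * Phi t] leaves small increments, as [telescoping] wants: half of [e] comes
   from [step_increment], half from the flux near [t]. *)
pose J u := \int[nu m u]_x f x - u * Phi t.
have stepJ l u : 0 <= u <= h -> l%:R * h + u <= T -> `|l%:R * h - t| <= eta + eta ->
    `|J (l%:R * h + u) - J (l%:R * h)| <= e * u.
  move=> /[dup] hu /andP[u0 uh] luT lt.
  have lT : l%:R * h <= T by apply: le_trans luT; rewrite lerDl.
  have lT0 : 0 <= l%:R * h <= T by rewrite lT mulr_ge0// ltW.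
  have h2 : `|\int[V (nu m (l%:R * h))]_p F p - Phi t| <= e / 2.
    apply: hdl; [exact: nu_Pc|exact: nu_speed|].
    apply: le_lt_trans (hm1 _ _ tT lT0) _; rewrite lte_fin distrC.
    have := ler_wpM2l K0 lt; lra.
  have h3 := hc m l u hu luT.
  rewrite /J.
  have -> : \int[nu m (l%:R * h + u)]_x f x - (l%:R * h + u) * Phi t -
      (\int[nu m (l%:R * h)]_x f x - l%:R * h * Phi t) =
      (\int[nu m (l%:R * h + u)]_x f x - \int[nu m (l%:R * h)]_x f x -
        u * \int[V (nu m (l%:R * h))]_p F p) +
      u * (\int[V (nu m (l%:R * h))]_p F p - Phi t) by ring.
  apply: le_trans (ler_normD _ _) _.
  rewrite normrM (ger0_norm u0) [e in leRHS]splitr mulrDl lerD//.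
    apply: (le_trans h3); rewrite mulrAC; exact: ler_wpM2r.
  by rewrite mulrC ler_wpM2r.
have A := telescoping h0 (ltW e0) h_eta stepJ s_ge0 ss' s'T ts s't.
have -> : D s' - D s - (s' - s) * Phi t =
    (J s' - J s) + (D s' - \int[nu m s']_x f x) -
    (D s - \int[nu m s]_x f x) by rewrite /J; ring.
apply: le_trans (ler_normB _ _) _.
apply: (le_trans (lerD (ler_normD _ _) (lexx _))).
move: A hm3 hm4 h_d; lra.
Qed.

Lemma weak_derivative t : 0 < t < T -> is_derive t 1 D (Phi t).
Proof.
move=> /andP[t0 tT].
suff dq : (fun h => h^-1 *: ((D \o shift t) (h *: 1) - D t)) @ 0^' --> Phi t.
  by split; [apply/cvg_ex; exists (Phi t)|exact: (cvg_lim (@Rhausdorff R) dq)].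
apply/cvgrPdist_le => e e0.
have tT01 : 0 <= t <= T by rewrite !ltW.
have [eta eta0 heta] := local_increment tT01 e0.
pose d := Num.min eta (Num.min t (T - t)).
have d0 : 0 < d by rewrite !lt_min eta0 t0 subr_gt0.
have : \forall h \near (0 : R)^', h != 0 /\ `|h| < d.
  near=> h; split; first by near: h; exact: nbhs_dnbhs_neq.
  near: h; apply: nbhs_dnbhs; near=> h.
  by rewrite -[h]opprK normrN -sub0r; near: h; apply: nbhsx_ballx.
apply: filterS => h [h0 hd] /=.
move: hd; rewrite !lt_min => /andP[h1 /andP[h2 h3]].
have -> : h *: 1 = h :> R by rewrite [LHS]mulr1.
have -> : Phi t - h^-1 *: (D (h + t) - D t) = - (h^-1 * (D (h + t) - D t - h * Phi t)).
  by rewrite [h^-1 *: _]mulrC; field.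
rewrite normrN normrM normfV ler_pdivrMl ?normr_gt0//.
have [hp|hn] := leP 0 h.
  have g1 := le_lt_trans (ler_norm h) h1.
  have g3 := le_lt_trans (ler_norm h) h3.
  have hB : `|D (h + t) - D t - (h + t - t) * Phi t| <= e * (h + t - t).
    by apply: heta; lra.
  by rewrite addrK (mulrC e) in hB; rewrite (ger0_norm hp).
have hN : - h <= `|h| by rewrite -normrN ler_norm.
have g1 := le_lt_trans hN h1; have g2 := le_lt_trans hN h2.
have hB : `|D t - D (h + t) - (t - (h + t)) * Phi t| <= e * (t - (h + t)).
  by apply: heta; lra.
have -> : D (h + t) - D t - h * Phi t = - (D t - D (h + t) - (t - (h + t)) * Phi t).
  by ring.
rewrite normrN (ltr0_norm hn).
have -> : - h = t - (h + t) by ring.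
by rewrite (mulrC _ e).
Unshelve. all: by end_near. Qed.

Lemma weak_lipschitz : exists2 c, 0 <= c & forall t s, `|D t - D s| <= c * `|t - s|.
Proof.
have [c c0 hc] := test_lipschitz tf; have [b b0 hb] := test_bounded tf.
exists (c * K); first exact: mulr_ge0.
move=> t s; apply/ler_addgt0Pr => e e0.
have e1 : 0 < e / (c + 1) by rewrite divr_gt0// ltr_wpDl.
have Wts : (W (mu t) (mu s) < (K * `|t - s| + e / (c + 1))%:E)%E.
  by apply: (le_lt_trans (mu_lipschitz t s)); rewrite lte_fin ltrDl.
have := wasserstein_Rintegral (@edist_measurable_pair R n) (@edist_ge0 R n)
  mf hb c0 hc Wts.
move=> /le_trans; apply; rewrite mulrDr mulrA lerD2l.
by rewrite mulrCA ger_pMr// ler_pdivrMr ?ltr_wpDl// mul1r lerDl.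
Qed.

Lemma weak_formulation :
  let leb := @lebesgue_measure R in
  [/\ {ae leb, forall s, `[0, T]%classic s ->
           (V (mu s)).-integrable setT (EFin \o F)},
      exists2 g : R -> R, leb.-integrable `[0, T]%classic (EFin \o g) &
        {ae leb, forall s, `[0, T]%classic s -> \int[V (mu s)]_p F p = g s},
      absolutely_continuous 0 T (fun t => \int[mu t]_x f x) &
      {ae leb, forall t, `[0, T]%classic t ->
         is_derive t 1 (fun t => \int[mu t]_x f x : R)
           (\int[V (mu t)]_p F p)}].
Proof.
move=> leb; split.
- by apply: aeW => s _; have [] := flux_integral (mu_speed s).
- exists Phi; last exact: aeW.
  apply: continuous_compact_integrable; first exact: segment_compact.
  exact: continuous_subspaceT.
- have [c c0 hc] := weak_lipschitz => e e0.
  exists (e / (c + 1)); first by rewrite divr_gt0// ltr_wpDl.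
  move=> m lo up lu _ sum_lt.
  apply: (@le_lt_trans _ _ (c * \sum_(k < m) (up k - lo k))).
    rewrite mulr_sumr; apply: ler_sum => k _.
    have [_ [luk _]] := lu k.
    by apply: le_trans (hc _ _) _; rewrite ger0_norm// subr_ge0.
  have sum0 : 0 <= \sum_(k < m) (up k - lo k).
    by apply: sumr_ge0 => k _; rewrite subr_ge0; have [_ []] := lu k.
  move: sum_lt; rewrite ltr_pdivlMr ?ltr_wpDl//; lra.
have : leb.-negligible [set 0; T].
  apply/negligibleP; first by apply: measurableU; exact: measurable_set1.
  apply: countable_lebesgue_measure0; apply: finite_set_countable.
  by rewrite finite_setU; split; exact: finite_set1.
apply: negligibleS => t /= /not_implyP[]; rewrite in_itv/= => /andP[t0 tT] nd.
apply: contrapT => /not_orP[t_neq0 t_neqT]; apply: nd.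
apply: weak_derivative; rewrite !lt_neqAle t0 tT !andbT.
by apply/andP; split; apply/eqP => // h; apply: t_neq0.
Qed.

End weak_solution.
(** * The initial datum *)

Section lipschitz_functions.
Context {R : realType} {n : nat}.
Local Notation E := 'rV[R]_n.
Implicit Types (g : E -> R) (c : R).

Definition lipschitz_fun c g := forall x y, `|g x - g y| <= c * edist x y.

Lemma lipschitz_fun_continuous c g : lipschitz_fun c g -> continuous g.
Proof.
move=> gc x; apply/(@cvgrPdist_le R R _ (nbhs x) (nbhs_filter x)) => e e0.
have c0 : 0 < `|c| + 1 by rewrite ltr_wpDl.
have n0 : 0 < n%:R + 1 :> R by rewrite ltr_wpDl.
pose d := e / (`|c| + 1) / (n%:R + 1).
have d0 : 0 < d by rewrite !divr_gt0.
have : \forall y \near x, ball x d y by apply: nbhsx_ballx.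
apply: filterS => y [_ xy]; apply: le_trans (gc x y) _.
have xyd : edist x y <= n%:R * d.
  by apply: enorm_le_coord => i; rewrite !mxE ltW//; exact: (xy 0 i).
apply: (@le_trans _ _ ((`|c| + 1) * (n%:R * d))).
  apply: (le_trans (ler_wpM2r (edist_ge0 x y) (_ : c <= `|c| + 1))).
    by rewrite (le_trans (ler_norm _))// lerDl.
  by rewrite ler_wpM2l// ltW.
have -> : (`|c| + 1) * (n%:R * d) = e * (n%:R / (n%:R + 1)).
  by rewrite /d; field; rewrite !gt_eqF.
by rewrite ger_pMr// ler_pdivrMr// mul1r lerDl.
Qed.

Lemma lipschitz_fun_measurable c g : lipschitz_fun c g ->
  measurable_fun [set: E] g.
Proof. by move=> /lipschitz_fun_continuous; exact: continuous_rV_measurable. Qed.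

Definition setdist (F : set E) x : R := inf [set edist x y | y in F].

Lemma setdist_lb F x e : F !=set0 -> (forall y, F y -> e <= edist x y) ->
  e <= setdist F x.
Proof.
move=> [y Fy] h; apply: lb_le_inf; first by exists (edist x y), y.
by move=> _ [z Fz <-]; exact: h.
Qed.

Lemma setdist_le F x y : F y -> setdist F x <= edist x y.
Proof.
move=> Fy; apply: ge_inf; last by exists y.
by exists 0 => _ [z _ <-]; exact: edist_ge0.
Qed.

Lemma setdist_lipschitz F : F !=set0 -> lipschitz_fun 1 (setdist F).
Proof.
move=> F0; have key x y : setdist F x - edist x y <= setdist F y.
  apply: setdist_lb => // z Fz; rewrite lerBlDl.
  exact: le_trans (setdist_le x Fz) (edist_triangle _ _ _).
move=> x y; rewrite mul1r ler_norml.
by have := key x y; have := key y x; rewrite (edistC y x) => ? ?; apply/andP; split; lra.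
Qed.

(** The functions are multiples, capped at 1, of the distance to the complement, which is positive
    on [U]. A nonempty complement gives that distance its meaning. *)
Lemma open_indic_approx (U : set E) : open U -> ~` U !=set0 ->
  exists g : nat -> E -> R, [/\ forall k, exists2 c, 0 <= c & lipschitz_fun c (g k),
    forall k x, `|g k x| <= 1 & forall x, g k x @[k --> \oo] --> (\1_U x : R)].
Proof.
move=> oU U0; have d0 x : 0 <= setdist (~` U) x.
  by apply: setdist_lb => // y _; exact: edist_ge0.
have g0 k x : 0 <= Num.min 1 (k%:R * setdist (~` U) x).
  by rewrite le_min ler01 mulr_ge0.
exists (fun k x => Num.min 1 (k%:R * setdist (~` U) x)); split.
- move=> k; exists k%:R => // x y.
  apply: (@le_trans _ _ (k%:R * `|setdist (~` U) x - setdist (~` U) y|)).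
    rewrite -[X in X * `|_|]ger0_norm// -normrM mulrBr.
    move: (_ * _) (_ * setdist _ y) => a b; wlog ab : a b / b <= a => [h|].
      by case: (leP b a) => [/h//|/ltW/h]; rewrite distrC (distrC b).
    rewrite (ger0_norm (_ : 0 <= a - b)) ?subr_ge0// ler_norml !minEle.
    by case: (leP 1 a) => ?; case: (leP 1 b) => ?; apply/andP; split; lra.
  by rewrite ler_wpM2l//; have := setdist_lipschitz U0 x y; rewrite mul1r.
- by move=> k x; rewrite ger0_norm// ge_min lexx.
move=> x; rewrite indicE; have [xU|xU] := boolP (x \in U); last first.
  have dx : setdist (~` U) x = 0.
    apply/eqP; rewrite eq_le d0 andbT.
    have := @setdist_le (~` U) x x; rewrite /edist subrr enorm0; apply.
    by move=> Ux; move: xU; rewrite mem_set.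
  under eq_cvg do rewrite dx mulr0 (min_idPr ler01).
  exact: cvg_cst.
have /nbhs_ballP[e /= e0 eU] : nbhs x U.
  by apply: open_nbhs_nbhs; split => //; exact: set_mem.
have dx : e <= setdist (~` U) x.
  apply: setdist_lb => // y nUy; rewrite leNgt; apply/negP => xy; apply: nUy.
  apply: eU; split => // i j; rewrite (ord1 i) /ball_/=.
  by apply: le_lt_trans (coord_le_edist _ _ _) xy.
apply: cvg_near_cst; exists (Num.truncn e^-1).+1 => // k /= hk.
apply/min_idPl; have ek : e^-1 <= k%:R.
  by apply: (le_trans (ltW (truncnS_gt _))); rewrite ler_nat.
have := ler_pM (ltW e0) _ dx ek; rewrite divff ?gt_eqF// invr_ge0 (ltW e0).
by rewrite mulrC; apply.
Qed.

(** Integrals of Lipschitz functions determine the measure of open sets, a class stable under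
    intersection that generates the Borel sets. *)
Lemma lipschitz_measure_eq (mu nu : probability E R) :
  (forall g c, 0 <= c -> lipschitz_fun c g -> (forall x, `|g x| <= 1) ->
    \int[mu]_x g x = \int[nu]_x g x) ->
  forall A, measurable A -> mu A = nu A.
Proof.
move=> h.
have hU U : open U -> mu U = nu U.
  move=> oU; have mU := openrV_measurable oU.
  have [U0|] := eqVneq (~` U) set0.
    rewrite (_ : U = setT); last by rewrite -[LHS]setCK U0 setC0.
    exact: (etrans (probability_setT _) (esym (probability_setT _))).
  move=> /set0P U0; have [g [gl g1 gU]] := open_indic_approx oU U0.
  have mg k : measurable_fun [set: E] (g k).
    by have [c _] := gl k; exact: lipschitz_fun_measurable.
  have c1 := bounded_convergence (P := mu) mg (measurable_indic mU) g1 gU.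
  have c2 := bounded_convergence (P := nu) mg (measurable_indic mU) g1 gU.
  have e : \int[mu]_x (\1_U x : R) = \int[nu]_x (\1_U x : R).
    apply: (cvg_unique _ c1) => //.
    suff -> : (fun k => \int[mu]_x g k x) = (fun k => \int[nu]_x g k x) by [].
    by apply/funext => k; have [c c0 gc] := gl k; exact: h c0 gc (g1 k).
  rewrite /Rintegral !integral_indic// !setIT in e.
  by rewrite -[mu U]fineK ?fin_num_measure// -[nu U]fineK ?fin_num_measure// e.
move=> A mA; apply: (@measure_unique _ _ _ (@open E) (fun=> setT)) => //.
- by move=> U1 U2; exact: openI.
- by move=> k; exact: openT.
- by rewrite bigcup_const//; exists 0%N.
- by move=> k; rewrite -ge0_fin_numE// fin_num_measure.
Qed.

End lipschitz_functions.
Section initial_datum.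
Context {R : realType} {n : nat}.
Local Notation E := 'rV[R]_n.
Local Notation P := (probability E R).

(** At time 0 the approximate solution is the image of [mu0] under rounding, which moves points by
    at most [n / N^2]; against a Lipschitz function it is thus close both to [mu] and to [mu0]. *)
Lemma las_initial_limit (V : P -> probability (E * E)%type R) (mu0 mu : P)
    (N : nat -> nat) : is_pvf V -> (forall m, (0 < N m)%N) ->
  (forall k, exists m0, forall m, (m0 <= m)%N -> (k <= N m)%N) ->
  (forall e : R, 0 < e -> exists m0, forall m, (m0 <= m)%N ->
    (W mu (las V mu0 (N m) 0) <= e%:E)%E) ->
  forall A, measurable A -> mu A = mu0 A.
Proof.
move=> pvfV N0 N_cvg Wmu; apply: lipschitz_measure_eq => g c c0 gc g1.
have mg := lipschitz_fun_measurable gc.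
apply/eqP; rewrite -subr_eq0 -normr_le0; apply/ler_addgt0Pr => e e0; rewrite add0r.
have ec : 0 < e / (c + 1) / 4 by rewrite !divr_gt0// ltr_wpDl.
have [m1 hm1] := Wmu _ ec.
have [m2 hm2] := N_cvg (Num.truncn (2 * c * n%:R / e)).+1.
pose m := maxn m1 m2.
have {}hm1 := hm1 m (leq_maxl _ _); have {}hm2 := hm2 m (leq_maxr _ _).
clearbody m; set k := N m in hm1 hm2.
have kp : 0 < k%:R :> R by rewrite ltr0n N0.
have h0 : 0 < k%:R ^- 2 :> R by rewrite invr_gt0 exprn_gt0.
have -> : \int[mu]_x g x - \int[mu0]_x g x =
  (\int[mu]_x g x - \int[las V mu0 k 0]_x g x) +
  (\int[las V mu0 k 0]_x g x - \int[mu0]_x g x) by ring.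
apply: le_trans (ler_normD _ _) _; rewrite [leRHS]splitr; apply: lerD.
  have Ws : (W mu (las V mu0 k 0) < (e / (c + 1) / 2)%:E)%E.
    by apply: (le_lt_trans hm1); rewrite lte_fin; lra.
  apply: le_trans (wasserstein_Rintegral (@edist_measurable_pair R n)
    (@edist_ge0 R n) mg g1 c0 gc Ws) _.
  rewrite mulrA ler_pM2r ?invr_gt0// mulrCA ger_pMr// ler_pdivrMr ?ltr_wpDl//.
  by rewrite mul1r lerDl.
have mq := @las_init_measurable R n k.
have -> : \int[las V mu0 k 0]_x g x = \int[mu0]_x g (quantize (k%:R ^- 2) x).
  rewrite -(law_Rintegral mu0 mq mg g1).
  by apply: eq_Rintegral_measure => A mA; exact: (las_initE pvfV mu0 (N0 m) mA).
have mgq : measurable_fun [set: E] (fun x => g (quantize (k%:R ^- 2) x)).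
  exact: (measurableT_comp mg mq).
rewrite -RintegralB//; last 2 first.
- exact: (prob_bounded mu0 mgq (fun x => g1 _)).1.
- exact: (prob_bounded mu0 mg g1).1.
apply: (prob_bounded mu0 _ _).2; first exact: measurable_funB.
move=> x; apply: (le_trans (gc _ _)).
apply: (le_trans (ler_wpM2l c0 (quantize_edist x h0))).
have kk : k%:R ^- 2 <= k%:R^-1 :> R.
  rewrite lef_pV2 ?posrE ?exprn_gt0//; apply: ler_eXnr => //.
  by rewrite ler1n N0.
have ck : 2 * c * n%:R / e <= k%:R.
  by apply: (le_trans (ltW (truncnS_gt _))); rewrite ler_nat.
rewrite ler_pdivrMr// in ck.
have n0 : 0 <= n%:R :> R by [].
apply: (@le_trans _ _ (c * (n%:R * k%:R^-1))).
  by rewrite ler_wpM2l// ler_wpM2l.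
rewrite mulrA ler_pdivrMr//; lra.
Qed.

(** Taking the least radius makes one estimate, with [R0], imply the estimate for every admissible
    [r]. The support is nonempty, since otherwise the whole space would be null. *)
Lemma support_radius (mu0 : P) : Pc mu0 -> exists R0 : R,
  [/\ 0 <= R0, msupport mu0 `<=` [set x | enorm x <= R0] &
      forall r, msupport mu0 `<=` [set x | enorm x <= r] -> R0 <= r].
Proof.
move=> cmu0; pose S := [set enorm x | x in msupport mu0].
have [x0 mx0] : msupport mu0 !=set0.
  apply/set0P/eqP => m0.
  have := @msupportC_null R n mu0 setT openT; rewrite m0 setI0 => /(_ erefl).
  move=> /(etrans (esym (probability_setT mu0)))/eqP.
  by rewrite eqe oner_eq0.
have cS : compact S.
  apply: continuous_compact cmu0; apply: continuous_subspaceT.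
  exact: enorm_continuous.
have [b [_ hb]] := compact_bounded cS.
have supS : has_sup S.
  split; first by exists (enorm x0), x0.
  exists (b + 1) => y Sy; apply: (le_trans (ler_norm y)).
  by apply: hb Sy; rewrite ltrDl.
have ubS x : msupport mu0 x -> enorm x <= sup S.
  by move=> mx; apply: ub_le_sup; [case: supS|exists x].
exists (sup S); split => //.
  exact: le_trans (enorm_ge0 _) (ubS _ mx0).
move=> r hr; apply: ge_sup; first by case: supS.
by move=> _ [x mx <-]; exact: hr.
Qed.

End initial_datum.

(** * Assembly: constants, subsequence and limit curve *)

Lemma ereal_cvg0 {R : realType} (u : nat -> \bar R) : (forall k, (0 <= u k)%E) ->
  (forall e : R, 0 < e -> exists m0, forall m, (m0 <= m)%N -> (u m <= e%:E)%E) ->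
  u @ \oo --> 0%E.
Proof.
move=> u0 ue; apply/fine_cvgP; split.
  have [m0 hm0] := ue 1 ltr01; exists m0 => // m /= /hm0 um.
  by rewrite ge0_fin_numE// (le_lt_trans um)// ltry.
apply/cvgrPdist_le => e e0; have [m0 hm0] := ue e e0; exists m0 => // m /= /hm0 um.
rewrite sub0r normrN ger0_norm ?fine_ge0// -lee_fin fineK//.
by rewrite ge0_fin_numE// (le_lt_trans um)// ltry.
Qed.
Theorem theorem3p1 (R : realType) (n : nat)
    (V : probability 'rV[R]_n R ->
         probability ('rV[R]_n * 'rV[R]_n)%type R) (C : R) :
  is_pvf V -> 0 < C -> support_sublinear C V -> continuous_on_Pc V ->
  forall (T : R) (mu0 : probability 'rV[R]_n R), 0 < T -> Pc mu0 ->
  exists las : nat -> R -> probability 'rV[R]_n R,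
    (exists N0 : nat, forall N, (N0 <= N)%N -> is_las V T mu0 N (las N)) /\
    exists mu : R -> probability 'rV[R]_n R,
      [/\ forall t, 0 <= t <= T -> Pc (mu t),
          is_solution V T mu0 mu,
          exists2 phi : nat -> nat, {homo phi : i j / (i < j)%N} &
            (fun k => ereal_sup
               [set W (las (phi k) t) (mu t) | t in `[0, T]%classic])
              @ \oo --> 0%E &
          forall r : R, msupport mu0 `<=` [set x | enorm x <= r] ->
            forall t s, 0 <= t <= T -> 0 <= s <= T ->
              (W (mu t) (mu s) <=
                 (C * expR (C * T) * (r + 1) * `|t - s|)%:E)%E].
Proof.
move=> pvfV C0 sublinV contV T mu0 T0 cmu0.
have [R0 [R00 mu0R R0min]] := support_radius cmu0.
have n0 : 0 <= n%:R :> R by [].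
have CT : 1 <= expR (C * T) by rewrite -expR0 ler_expR mulr_ge0 // ltW.
pose c := expR (C * T) * (1 + R0 + n%:R * (1 + T)).
have nT0 : 0 <= n%:R * (1 + T) by rewrite mulr_ge0// addr_ge0// ltW.
have c0 : 0 <= c by rewrite mulr_ge0 ?expR_ge0// !addr_ge0.
have Cc0 : 0 <= C * c by rewrite mulr_ge0// ltW.
pose N0 := (Num.truncn (c + C * c + n%:R + 1)).+1.
have fineN N : (N0 <= N)%N -> fine_enough n C T R0 N.
  move=> N0N; split; first exact: leq_trans N0N.
  by apply: (le_trans (ltW (truncnS_gt _))); rewrite ler_nat.
exists (las V mu0); split.
  by exists N0 => N /fineN bN; exact: (las_is_las pvfV C0 sublinV T0 R00 mu0R bN).
(* [Ml] is the Lipschitz constant of the theorem and [K] a bound for all speeds; the speeds equal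
   [Ml + d / N], so they converge to [Ml]. *)
pose K := C * c + n%:R; pose Ml := C * expR (C * T) * (R0 + 1).
pose d := C * (expR (C * T) * (n%:R * (1 + T))) + n%:R.
have d0 : 0 <= d.
  by rewrite /d addr_ge0// mulr_ge0 ?(ltW C0)// mulr_ge0 ?expR_ge0.
have speedE N : las_speed n C T R0 N = Ml + d / N%:R.
  by rewrite /las_speed /Ml /d; ring.
have speedK N : (0 < N)%N -> 0 <= las_speed n C T R0 N <= K.
  move=> Np; have Np' : 1 <= N%:R :> R by rewrite ler1n.
  rewrite speedE; apply/andP; split.
    by rewrite addr_ge0 ?divr_ge0// !mulr_ge0 ?(ltW C0) ?expR_ge0// addr_ge0.
  have -> : K = Ml + d by rewrite /K /Ml /d /c; ring.
  by rewrite lerD2l ler_pdivrMr ?(lt_le_trans ltr01)// ler_peMr.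
(* Paths start within [R0 + n] of the origin and travel at most [K * T] during [[0, T]]. *)
pose B := R0 + n%:R + K * T.
have paths m : exists s : seq (R * (R -> 'rV[R]_n)),
  [/\ all (fun p => 0 <= p.1) s, mass s = 1,
      forall p, p \in s -> 0 < p.1 ->
        lipschitz_path (las_speed n C T R0 (m + N0)%N) p.2 /\
        forall t, enorm (p.2 t) <= B &
      forall t A, 0 <= t <= T -> measurable A ->
        las V mu0 (m + N0)%N t A = (\sum_(p <- s) p.1 * `[< A (p.2 t) >]%:R)%:E].
  have bN := fineN _ (leq_addl m N0); have [Np _] := bN.
  have [s [s0 s1 sp sl]] := las_frozen_paths pvfV C0 sublinV T0 R00 mu0R bN.
  exists s; split => // p ps p0; have [lp pb] := sp p ps p0; split => // t.
  apply: (le_trans (pb t)); rewrite /B; apply: lerD; last first.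
    by have /andP[_ sK] := speedK _ Np; rewrite ler_wpM2r// ltW.
  rewrite /las_radius !mul0r mulr0 expR0 mul1r addr0.
  have : n%:R / (m + N0)%:R <= n%:R :> R.
    by rewrite ler_pdivrMr ?ltr0n// ler_peMr// ler1n.
  lra.
have [s sP] := choice paths.
have [|||m|phi phi_incr [Y [L [mY lawY YM YB YL]]]] :=
  @path_selection R n s (fun m => las_speed n C T R0 (m + N0)%N) K B.
- by move=> m; have [] := sP m.
- by move=> m; have [] := sP m.
- by move=> m p; have [_ _ + _] := sP m; exact.
- by apply: speedK; rewrite addn_gt0 orbT.
have le_phi m : (m <= phi m)%N.
  by elim: m => // m ih; rewrite (leq_ltn_trans ih)// phi_incr.
(* The shift by [N0] makes every approximation of the sequence fine enough. *)
pose N m := (phi m + N0)%N.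
have N_gt0 m : (0 < N m)%N by rewrite addn_gt0 orbT.
have N_fine m : fine_enough n C T R0 (N m) by apply: fineN; exact: leq_addl.
have N_cvg k : exists m0, forall m, (m0 <= m)%N -> (k <= N m)%N.
  exists k => m km; apply: leq_trans (leq_addr _ _); exact: leq_trans (le_phi m).
pose M m := las_speed n C T R0 (N m).
have MK m : M m <= K by have /andP[] := speedK _ (N_gt0 m).
have cvgM : M m @[m --> \oo] --> Ml.
  apply/cvgrPdist_le => e e0; have [m0 hm0] := N_cvg (Num.truncn (d / e)).+1.
  exists m0 => // m /hm0 hm; rewrite /M speedE opprD addNKr normrN.
  rewrite ger0_norm ?divr_ge0// ler_pdivrMr ?ltr0n// -ler_pdivrMl//.
  rewrite mulrC; apply: (le_trans (ltW (truncnS_gt _))).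
  by rewrite ler_nat.
have K0 : 0 <= K by have /andP[k1 k2] := speedK _ (N_gt0 0%N); exact: le_trans k2.
have Ml0 : 0 <= Ml by rewrite !mulr_ge0 ?(ltW C0) ?expR_ge0// addr_ge0.
pose mL := limit_measurable mY YL.
pose mu t := law unif (mL t).
have lawN m t A : 0 <= t <= T -> measurable A ->
    law unif (mY m t) A = las V mu0 (N m) t A.
  move=> tT mA; have [_ _ _ /(_ t A tT mA) h] := sP (phi m).
  exact: (etrans (lawY m t A mA) (esym h)).
have muB t : mu t (~` [set x | enorm x <= B]) = 0%E.
  suff : unif ((fun w => L w t) @^-1` (~` [set x | enorm x <= B])) = 0%E by [].
  rewrite (_ : _ @^-1` _ = set0) ?measure0//.
  by apply/seteqP; split=> // w /= []; exact: (limit_bounded YB YL).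
have mu_Pc t : Pc (mu t).
  by apply: concentrated_Pc (muB t); exact: eball_compact.
have W_mu t s0 : (W (mu t) (mu s0) <= (Ml * `|t - s0|)%:E)%E.
  exact: (W_limit_lipschitz mY YM YL cvgM).
have W_cvg e : 0 < e -> exists m0, forall m, (m0 <= m)%N -> forall t, 0 <= t <= T ->
    (W (las V mu0 (N m) t) (mu t) <= e%:E)%E /\
    forall s0, 0 <= s0 <= T ->
      (W (mu t) (las V mu0 (N m) s0) <= (e + K * `|t - s0|)%:E)%E.
  move=> e0; have [m0 hm0] := W_limit_cvg mY YM YB YL MK cvgM (ltW T0) e0.
  exists m0 => m /hm0 hm t tT; have [h1 h2] := hm t tT; split.
    have -> : W (las V mu0 (N m) t) (mu t) = W (law unif (mY m t)) (mu t).
      by apply: eq_wasserstein => // A mA; rewrite lawN.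
    exact: h1.
  move=> s0 s0T.
  have -> : W (mu t) (las V mu0 (N m) s0) = W (mu t) (law unif (mY m s0)).
    by apply: eq_wasserstein => // A mA; rewrite lawN.
  exact: h2.
have MlK : Ml <= K.
  rewrite -(cvg_lim (@Rhausdorff R) cvgM); apply: limr_le; last exact: nearW.
  by apply/cvg_ex; exists Ml.
exists mu; split.
- by move=> t _; exact: mu_Pc.
- split.
    apply: (las_initial_limit pvfV N_gt0 N_cvg) => e e0.
    have [m0 hm0] := W_cvg e e0; exists m0 => m /hm0 hm.
    have T00 : 0 <= (0 : R) <= T by rewrite lexx ltW.
    by have [_ /(_ 0 T00)] := hm 0 T00; rewrite subrr normr0 mulr0 addr0.
  (* One bound for all velocities: [C * (1 + B)] serves the limit curve, whose supports lie in the
     ball of radius [B], and [K] the approximations at the nodes. *)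
  move=> f tf; pose r := C * (1 + B) + K.
  have B0 : 0 <= B by rewrite !addr_ge0// mulr_ge0// ltW.
  have CB0 : 0 <= C * (1 + B) by rewrite mulr_ge0 ?(ltW C0)// addr_ge0.
  have speed_sub (lam : probability ('rV[R]_n * 'rV[R]_n)%type R)
      (S : set ('rV[R]_n * 'rV[R]_n)) : measurable S ->
      S `<=` [set p | enorm p.2 <= r] -> lam (~` S) = 0%E ->
      lam (~` [set p | enorm p.2 <= r]) = 0%E.
    move=> mS Sr; apply: subset_measure0.
    - apply: measurableC.
      rewrite (_ : mkset _ = snd @^-1` [set v : 'rV[R]_n | enorm v <= r])//.
      rewrite -[X in measurable X]setTI; apply: measurable_snd => //.
      by apply: closedrV_measurable; exact: eball_closed.
    - exact: measurableC.
    - exact: subsetC.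
  have mball x : measurable [set v : 'rV[R]_n | enorm v <= x].
    by apply: closedrV_measurable; exact: eball_closed.
  apply: (@weak_formulation R n V pvfV contV T K r mu N (fun m => las V mu0 (N m))) => //.
  + by rewrite addr_ge0.
  + move=> t; have supB : msupport (mu t) `<=` [set x | enorm x <= B].
      by apply: msupport_sub; [exact: eball_closed|exact: muB].
    apply: speed_sub (velocity_bound C0 sublinV (mu_Pc t) supB).
      rewrite (_ : mkset _ = setT `*` [set v : 'rV[R]_n | enorm v <= C * (1 + B)]).
        exact: measurableX.
      by apply/seteqP; split=> p //= [].
    by move=> p /= pB; rewrite (le_trans pB)// lerDl.
  + move=> t s0; apply: (le_trans (W_mu t s0)); rewrite lee_fin.
    by rewrite ler_wpM2r.
  + move=> e e0; have [m0 hm0] := W_cvg e e0; exists m0 => m /hm0 hm t s0 tT.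
    by have [_] := hm t tT; exact.
  + move=> m l lT.
    by have [] := las_concentrated pvfV C0 sublinV T0 R00 mu0R (N_fine m) lT.
  + move=> m l lT.
    have [_ _ h] := las_concentrated pvfV C0 sublinV T0 R00 mu0R (N_fine m) lT.
    have [_ _ _ rspeed] := las_radius_bound C0 T0 R00 (N_fine m) lT.
    apply: speed_sub h.
      rewrite (_ : mkset _ = las_support C R0 (N m) l `*`
        [set v | enorm v <= C * (1 + las_radius n C R0 (N m) l)])//.
      apply: measurableX => //; apply: finite_rV_measurable.
      exact: las_support_finite.
    move=> p /= [_ pr]; apply: (le_trans pr); have := MK m; rewrite /M /r.
    have : 0 <= n%:R / (N m)%:R :> R by rewrite divr_ge0.
    move: rspeed CB0; lra.
  + by move=> m l t A tN _ mA; exact: (las_stepE pvfV mu0 l (N_gt0 m) tN mA).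
- exists N => [i j ij|]; first by rewrite ltn_add2r phi_incr.
  apply: ereal_cvg0 => [k|e e0].
    apply: (@le_trans _ _ (W (las V mu0 (N k) 0) (mu 0))).
      exact: wasserstein_ge0 (@edist_ge0 R n) _ _.
    by apply: ereal_sup_ubound; exists 0 => //; rewrite /= in_itv/= lexx ltW.
  have [m0 hm0] := W_cvg e e0; exists m0 => m /hm0 hm.
  apply: ge_ereal_sup => _ [t tT <-]; rewrite /= in_itv/= in tT.
  by have [] := hm t tT.
move=> r hr t s0 _ _; apply: (le_trans (W_mu t s0)); rewrite lee_fin.
rewrite ler_wpM2r// /Ml ler_wpM2l ?mulr_ge0 ?(ltW C0) ?expR_ge0//.
by rewrite lerD2r; exact: R0min.
Qed.
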